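(* Let $k$ be a field of characteristic $p>0$ containing a primitive $l'$-th root of unity $\varepsilon$ ($l'\ge 3$), let $l=l'$ if $l'$ is odd and $l=l'/2$ if $l'$ is even, and let $n$ be a positive integer and $r\ge0$ an integer. The little $q$-Schur algebra $\tilde u_k(n,r)$ is semisimple if and only if either $l>r$, or $l=n=2$ and $r\ge 3$ is odd.
   Context: $\mathbb N=\{0,1,2,\dots\}$, $\upsilon$ is an indeterminate, $\mathcal Z=\mathbb Z[\upsilon,\upsilon^{-1}]$, and $k$ is a $\mathcal Z$-algebra via $\upsilon\mapsto\varepsilon$. $[m]=\frac{\upsilon^m-\upsilon^{-m}}{\upsilon-\upsilon^{-1}}$, $[m]!=[1]\cdots[m]$. Quantum $\mathfrak{gl}_n$: $\mathbf U(n)$ is the $\mathbb Q(\upsilon)$-algebra with generators $E_i,F_i$ ($1\le i\le n-1$), $K_j^{\pm1}$ ($1\le j\le n$) and relations $K_iK_j=K_jK_i$, $K_iK_i^{-1}=1$; $K_iE_j=\upsilon^{\delta_{i,j}-\delta_{i,j+1}}E_jK_i$; $K_iF_j=\upsilon^{-\delta_{i,j}+\delta_{i,j+1}}F_jK_i$; $E_iF_j-F_jE_i=\delta_{ij}\frac{\tilde K_i-\tilde K_i^{-1}}{\upsilon-\upsilon^{-1}}$ with $\tilde K_i=K_iK_{i+1}^{-1}$; $E_iE_j=E_jE_i$, $F_iF_j=F_jF_i$ if $|i-j|>1$; $E_i^2E_j-(\upsilon+\upsilon^{-1})E_iE_jE_i+E_jE_i^2=0$ and likewise for the $F$'s if $|i-j|=1$.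 $U_{\mathcal Z}(n)$ is its $\mathcal Z$-subalgebra generated by all $E_i^{(m)}=E_i^m/[m]!$, $F_i^{(m)}=F_i^m/[m]!$, $K_j^{\pm1}$ and $\left[{K_j;0\atop t}\right]=\prod_{s=1}^t\frac{K_j\upsilon^{1-s}-K_j^{-1}\upsilon^{s-1}}{\upsilon^s-\upsilon^{-s}}$ ($m,t\in\mathbb N$). $U_k(n)=U_{\mathcal Z}(n)\otimes_{\mathcal Z}k$, and $\tilde u_k(n)$ is the $k$-subalgebra of $U_k(n)$ generated by all $E_i,F_i,K_j^{\pm1}$. $q$-Schur algebras: for a commutative ring $R$ and $q^{1/2}\in R$, $A_q(n)$ is the $R$-algebra generated by $c_{ij}$ ($1\le i,j\le n$) with relations $c_{ij}c_{im}=c_{im}c_{ij}$ for all $i,j,m$; $c_{ij}c_{rs}=qc_{rs}c_{ij}$ for $i>r$, $j\le s$; $c_{ij}c_{rs}=(q-1)c_{rj}c_{is}+c_{rs}c_{ij}$ for $i>r$, $j>s$. It is a bialgebra with $\Delta(c_{ij})=\sum_tc_{it}\otimes c_{tj}$, counit $c_{ij}\mapsto\delta_{ij}$. Its degree $r$ part $A_q(n,r)$ is a subcoalgebra, and $U_R(n,r)=A_q(n,r)^*$ is the $q$-Schur algebra. Let $\Xi(n,r)$ be the set of $n\times n$ matrices over $\mathbb N$ with entry sum $r$; $\{\xi_A\}_{A\in\Xi(n,r)}$ is the basis dual to the monomials $c^A=c_{11}^{a_{11}}c_{21}^{a_{21}}\cdots c_{n1}^{a_{n1}}c_{12}^{a_{12}}\cdots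 c_{nn}^{a_{nn}}$, and $[A]=q^{-d_A/2}\xi_A$ with $d_A=-\sum_{i<s,j>t}a_{ij}a_{st}+\sum_{j>t}a_{ij}a_{it}$. Write $\mathbf U(n,r)=U_{\mathbb Q(\upsilon)}(n,r)$ and $U_{\mathcal Z}(n,r)$ for $q^{1/2}=\upsilon$, and $U_k(n,r)\cong U_{\mathcal Z}(n,r)\otimes_{\mathcal Z}k$ for $q^{1/2}=\varepsilon$. For a matrix $A$ over $\mathbb N$ with zero diagonal and $\mathbf j\in\mathbb Z^n$ put $A(\mathbf j,r)=\sum_D\upsilon^{\sum_id_ij_i}[A+D]$, over diagonal $D=\mathrm{diag}(d_1,\dots,d_n)$ over $\mathbb N$ with $A+D\in\Xi(n,r)$. There is an algebra epimorphism $\zeta_r:\mathbf U(n)\to\mathbf U(n,r)$ with $E_h\mapsto E_{h,h+1}(\mathbf 0,r)$, $F_h\mapsto E_{h+1,h}(\mathbf 0,r)$ ($E_{i,j}$ matrix units), $K_1^{j_1}\cdots K_n^{j_n}\mapsto 0(\mathbf j,r)$, mapping $U_{\mathcal Z}(n)$ onto $U_{\mathcal Z}(n,r)$; base change gives $\zeta_r:U_k(n)\to U_k(n,r)$. The little $q$-Schur algebra is $\tilde u_k(n,r)=\zeta_r(\tilde u_k(n))$.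
   Formalization: The formal theorem assumes n ≥ 2 instead of n a positive integer: for n = 1 the algebra is just k, semisimple for every r, so the stated equivalence fails whenever r ≥ l. *)

(* Defs.v *)
From HB Require Import structures.
From mathcomp Require Import all_boot all_order all_algebra.
From mathcomp Require Import boolp classical_sets.

Set Implicit Arguments.
Unset Strict Implicit.
Unset Printing Implicit Defensive.

Import Order.TTheory GRing.Theory Num.Theory.

Local Open Scope classical_set_scope.
Local Open Scope ring_scope.
Local Open Scope quotient_scope.

Inductive term (R X : Type) : Type :=
  | Gen of X
  | Cst of R
  | Add of term R X & term R X
  | Mul of term R X & term R X.

Arguments Gen {R X} _.
Arguments Cst {R X} _.

HB.instance Definition _ (R X : Type) := gen_eqMixin (term R X).
HB.instance Definition _ (R X : Type) := gen_choiceMixin (term R X).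

Declare Scope term_scope.
Delimit Scope term_scope with T.
Bind Scope term_scope with term.
Notation "s + t" := (Add s t) : term_scope.
Notation "s * t" := (Mul s t) : term_scope.
Notation "a *: t" := (Mul (Cst a%R) t) : term_scope.
Notation "s - t" := (Add s (Mul (Cst (- 1)%R) t)) : term_scope.

Section Presentation.
Variables (R : comPzRingType) (X : Type) (rel : term R X -> term R X -> Prop).
Implicit Types (a b : R) (s t u : term R X).

(* The least congruence containing [rel] whose quotient is an R-algebra. *)
Inductive cong : term R X -> term R X -> Prop :=
  | cong_rel s t : rel s t -> cong s t
  | cong_refl t : cong t t
  | cong_sym s t : cong s t -> cong t s
  | cong_trans t s u : cong s t -> cong t u -> cong s u
  | cong_add s s' t t' : cong s s' -> cong t t' -> cong (s + t) (s' + t')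
  | cong_mul s s' t t' : cong s s' -> cong t t' -> cong (s * t) (s' * t')
  | cong_addA s t u : cong (s + (t + u)) ((s + t) + u)
  | cong_addC s t : cong (s + t) (t + s)
  | cong_add0 t : cong (Cst 0%R + t) t
  | cong_mulA s t u : cong (s * (t * u)) ((s * t) * u)
  | cong_mul1 t : cong (Cst 1%R * t) t
  | cong_mul0 t : cong (Cst 0%R * t) (Cst 0%R)
  | cong_mulDl s t u : cong ((s + t) * u) (s * u + t * u)
  | cong_mulDr s t u : cong (u * (s + t)) (u * s + u * t)
  | cong_cstD a b : cong (Cst (a + b)%R) (Cst a + Cst b)
  | cong_cstM a b : cong (Cst (a * b)%R) (Cst a * Cst b)
  | cong_cstC a t : cong (Cst a * t) (t * Cst a).

Definition congb s t := `[< cong s t >].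

Lemma congb_refl : reflexive congb.
Proof. by move=> t; apply/asboolP/cong_refl. Qed.

Lemma congb_sym : symmetric congb.
Proof. by move=> s t; apply/asboolP/asboolP; apply: cong_sym. Qed.

Lemma congb_trans : transitive congb.
Proof.
by move=> t s u /asboolP st /asboolP tu; apply/asboolP/(cong_trans st tu).
Qed.

Canonical cong_equiv := EquivRel congb congb_refl congb_sym congb_trans.

Definition presented := {eq_quot cong_equiv}.
HB.instance Definition _ := Choice.on presented.
HB.instance Definition _ := EqQuotient.on presented.

Definition pclass t : presented := \pi_presented t.

Lemma pclassP s t : pclass s = pclass t <-> cong s t.
Proof. by split=> [/eqmodP/asboolP|st] //; apply/eqmodP/asboolP. Qed.

Lemma pclassW (P : presented -> Prop) : (forall t, P (pclass t)) -> forall x, P x.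
Proof. by move=> Pt x; rewrite -[x]reprK; apply: Pt. Qed.

Lemma cong_repr t : cong (repr (pclass t)) t.
Proof. by apply/pclassP; rewrite /pclass reprK. Qed.

Definition padd (x y : presented) := pclass (Add (repr x) (repr y)).
Definition pmul (x y : presented) := pclass (Mul (repr x) (repr y)).
Definition popp (x : presented) := pclass (Mul (Cst (- 1)) (repr x)).
Definition pscale a (x : presented) := pclass (Mul (Cst a) (repr x)).

Lemma paddE s t : padd (pclass s) (pclass t) = pclass (Add s t).
Proof. by apply/pclassP/cong_add; apply: cong_repr. Qed.

Lemma pmulE s t : pmul (pclass s) (pclass t) = pclass (Mul s t).
Proof. by apply/pclassP/cong_mul; apply: cong_repr. Qed.

Lemma poppE t : popp (pclass t) = pclass (Mul (Cst (- 1)) t).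
Proof. by apply/pclassP/cong_mul; [apply: cong_refl|apply: cong_repr]. Qed.

Lemma pscaleE a t : pscale a (pclass t) = pclass (Mul (Cst a) t).
Proof. by apply/pclassP/cong_mul; [apply: cong_refl|apply: cong_repr]. Qed.

Definition pE := (paddE, pmulE, poppE, pscaleE).

Lemma paddA : associative padd.
Proof.
move=> x y z; elim/pclassW: x => s; elim/pclassW: y => t; elim/pclassW: z => u.
by rewrite !pE; apply/pclassP/cong_addA.
Qed.

Lemma paddC : commutative padd.
Proof.
move=> x y; elim/pclassW: x => s; elim/pclassW: y => t.
by rewrite !pE; apply/pclassP/cong_addC.
Qed.

Lemma padd0 : left_id (pclass (Cst 0)) padd.
Proof. by elim/pclassW => t; rewrite !pE; apply/pclassP/cong_add0. Qed.

Lemma paddN : left_inverse (pclass (Cst 0)) popp padd.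
Proof.
elim/pclassW => t; rewrite !pE; apply/pclassP.
apply: (@cong_trans (Add (Mul (Cst (- 1)) t) (Mul (Cst 1) t))).
  by apply: cong_add; [apply: cong_refl|apply/cong_sym/cong_mul1].
apply: cong_trans (cong_sym (cong_mulDl _ _ _)) _.
apply: cong_trans (cong_mul0 t); apply: cong_mul (cong_refl _).
have -> : 0 = - 1 + 1 :> R by rewrite addNr.
exact/cong_sym/cong_cstD.
Qed.

HB.instance Definition _ :=
  GRing.isZmodule.Build presented paddA paddC padd0 paddN.

Lemma pmulA : associative pmul.
Proof.
move=> x y z; elim/pclassW: x => s; elim/pclassW: y => t; elim/pclassW: z => u.
by rewrite !pE; apply/pclassP/cong_mulA.
Qed.

Lemma pmul1l : left_id (pclass (Cst 1)) pmul.
Proof. by elim/pclassW => t; rewrite !pE; apply/pclassP/cong_mul1. Qed.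

Lemma pmul1r : right_id (pclass (Cst 1)) pmul.
Proof.
elim/pclassW => t; rewrite !pE; apply/pclassP.
exact: cong_trans (cong_sym (cong_cstC _ _)) (cong_mul1 _).
Qed.

Lemma pmulDl : left_distributive pmul padd.
Proof.
move=> x y z; elim/pclassW: x => s; elim/pclassW: y => t; elim/pclassW: z => u.
by rewrite !pE; apply/pclassP/cong_mulDl.
Qed.

Lemma pmulDr : right_distributive pmul padd.
Proof.
move=> x y z; elim/pclassW: x => s; elim/pclassW: y => t; elim/pclassW: z => u.
by rewrite !pE; apply/pclassP/cong_mulDr.
Qed.

HB.instance Definition _ :=
  GRing.Zmodule_isPzRing.Build presented pmulA pmul1l pmul1r pmulDl pmulDr.

Lemma pscaleA a b (x : presented) : pscale a (pscale b x) = pscale (a * b) x.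
Proof.
elim/pclassW: x => t; rewrite !pE; apply/pclassP.
apply: cong_trans (cong_mulA _ _ _) (cong_mul _ (cong_refl _)).
exact/cong_sym/cong_cstM.
Qed.

Lemma pscale1 : left_id 1 pscale.
Proof. by elim/pclassW => t; rewrite !pE; apply/pclassP/cong_mul1. Qed.

Lemma pscaleDr : right_distributive pscale padd.
Proof.
move=> a x y; elim/pclassW: x => s; elim/pclassW: y => t.
by rewrite !pE; apply/pclassP/cong_mulDr.
Qed.

Lemma pscaleDl (x : presented) :
  {morph pscale^~ x : a b / a + b >-> padd a b}.
Proof.
move=> a b; elim/pclassW: x => t; rewrite !pE; apply/pclassP.
apply: cong_trans (cong_mul (cong_cstD _ _) (cong_refl _)) _.
exact: cong_mulDl.
Qed.

HB.instance Definition _ :=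
  GRing.Zmodule_isLmodule.Build R presented pscaleA pscale1 pscaleDr pscaleDl.

Definition pgen (x : X) : presented := pclass (Gen x).

Inductive gen_subalg (S : set R) (G : set presented) : set presented :=
  | gen_subalg_gen x : G x -> gen_subalg S G x
  | gen_subalg_one : gen_subalg S G 1
  | gen_subalg_add x y :
      gen_subalg S G x -> gen_subalg S G y -> gen_subalg S G (x + y)%R
  | gen_subalg_mul x y :
      gen_subalg S G x -> gen_subalg S G y -> gen_subalg S G (x * y)%R
  | gen_subalg_scale a x : S a -> gen_subalg S G x -> gen_subalg S G (a *: x)%R.

Definition alg_hom N (f : presented -> 'M[R]_N) : Prop :=
  [/\ f 1%R = 1%:M, {morph f : x y / (x + y)%R}, 
      forall x y, f (x * y)%R = f x *m f y & forall a x, f (a *: x)%R = a *: f x].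

End Presentation.

Definition left_ideal (A : pzRingType) (S I : set A) : Prop :=
  [/\ I `<=` S, I 0, forall x y, I x -> I y -> I (x + y)
    & forall a x, S a -> I x -> I (a * x)].

(* A subring [S] of [A] is semisimple when every submodule of the left regular
   module of [S] is a direct summand. *)
Definition semisimple (A : pzRingType) (S : set A) : Prop :=
  forall I, left_ideal S I -> exists J,
    [/\ left_ideal S J, I `&` J = [set 0]
      & forall x, S x -> exists y z, [/\ I y, J z & x = y + z]].

Notation Qv := {fraction {poly rat}}.
Definition ups : Qv := FracField.tofrac 'X.

(* The image of the Laurent polynomial P(v) v^-m under v |-> x. *)
Definition laurent (R : comUnitRingType) (x : R) (P : {poly int}) (m : nat) : R :=
  (map_poly intr P).[x] / x ^+ m.

Definition ZZ : set Qv := [set z | exists P m, z = laurent ups P m].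

Definition qint (m : nat) : Qv := (ups ^+ m - ups ^- m) / (ups - ups^-1).
Definition qfact (m : nat) : Qv := \prod_(1 <= s < m.+1) qint s.

Lemma hi_subproof n (h : 'I_n.-1) : (h.+1 < n)%N.
Proof. by rewrite -ltn_predRL. Qed.

Definition lo n (h : 'I_n.-1) : 'I_n := widen_ord (leq_pred n) h.
Definition hi n (h : 'I_n.-1) : 'I_n := Ordinal (hi_subproof h).

(* Indices are 0-based: [GE h] and [GF h] belong to the pair [lo h], [hi h]
   of consecutive elements of 'I_n; [GK' j] is the inverse of [GK j]. *)
Inductive Ugen (n : nat) : Type :=
  | GE of 'I_n.-1 | GF of 'I_n.-1 | GK of 'I_n | GK' of 'I_n.

Section QuantumGl.
Variable n : nat.
Implicit Types (i j : 'I_n) (g h : 'I_n.-1).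

Local Notation tE h := (Gen (GE h) : term Qv (Ugen n)).
Local Notation tF h := (Gen (GF h) : term Qv (Ugen n)).
Local Notation tK j := (Gen (GK j) : term Qv (Ugen n)).
Local Notation tK' j := (Gen (GK' j) : term Qv (Ugen n)).

Inductive Urel : term Qv (Ugen n) -> term Qv (Ugen n) -> Prop :=
  | Urel_KK i j : Urel (tK i * tK j) (tK j * tK i)
  | Urel_KK' i : Urel (tK i * tK' i) (Cst 1)
  | Urel_K'K i : Urel (tK' i * tK i) (Cst 1)
  | Urel_KE i h : Urel (tK i * tE h)
      (ups ^ ((i == lo h)%:Z - (i == hi h)%:Z) *: (tE h * tK i))
  | Urel_KF i h : Urel (tK i * tF h)
      (ups ^ ((i == hi h)%:Z - (i == lo h)%:Z) *: (tF h * tK i))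
  | Urel_EF g h : Urel (tE g * tF h - tF h * tE g)
      ((g == h)%:R / (ups - ups^-1) *:
        (tK (lo g) * tK' (hi g) - tK' (lo g) * tK (hi g)))
  | Urel_EE g h : 1 < `|g%:Z - h%:Z| -> Urel (tE g * tE h) (tE h * tE g)
  | Urel_FF g h : 1 < `|g%:Z - h%:Z| -> Urel (tF g * tF h) (tF h * tF g)
  | Urel_SerreE g h : `|g%:Z - h%:Z| = 1 ->
      Urel (tE g * tE g * tE h - (ups + ups^-1) *: (tE g * tE h * tE g)
            + tE h * tE g * tE g) (Cst 0)
  | Urel_SerreF g h : `|g%:Z - h%:Z| = 1 ->
      Urel (tF g * tF g * tF h - (ups + ups^-1) *: (tF g * tF h * tF g)
            + tF h * tF g * tF g) (Cst 0).

Definition U := presented Urel.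

Definition E h : U := pgen Urel (GE h).
Definition F h : U := pgen Urel (GF h).
Definition K j : U := pgen Urel (GK j).
Definition K' j : U := pgen Urel (GK' j).

Definition Kint j (z : int) : U :=
  match z with Posz m => K j ^+ m | Negz m => K' j ^+ m.+1 end.

Definition Kbin j (t : nat) : U :=
  \prod_(1 <= s < t.+1) ((ups ^+ s - ups ^- s)^-1 *:
    (ups ^ (1 - s%:Z) *: K j - ups ^ (s%:Z - 1) *: K' j)).

Definition UZ : set U :=
  gen_subalg ZZ [set x |
    [\/ exists h m, x = (qfact m)^-1 *: E h ^+ m,
         exists h m, x = (qfact m)^-1 *: F h ^+ m,
         exists j, x = K j \/ x = K' j
       | exists j t, x = Kbin j t]].

Section BaseChange.
Variables (k : fieldType) (eps : k).

Local Notation UZt := {x : U | UZ x}.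
Local Notation tens x := (Gen x : term k UZt).

(* UZ (x)_ZZ k is the k-algebra generated by the symbols x (x) 1 subject to
   the ring operations of [UZ] and to (z x) (x) 1 = z(eps) (x (x) 1). *)
Inductive Ukrel : term k UZt -> term k UZt -> Prop :=
  | Ukrel_one (x : UZt) : sval x = 1%R -> Ukrel (tens x) (Cst 1)
  | Ukrel_add (x y z : UZt) : sval z = (sval x + sval y)%R ->
      Ukrel (tens z) (tens x + tens y)
  | Ukrel_mul (x y z : UZt) : sval z = (sval x * sval y)%R ->
      Ukrel (tens z) (tens x * tens y)
  | Ukrel_scale P m (x y : UZt) : sval y = (laurent ups P m *: sval x)%R ->
      Ukrel (tens y) (laurent eps P m *: tens x).

Definition Uk := presented Ukrel.

Definition base_change (x : {x : U | UZ x}) : Uk := pgen Ukrel x.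

Definition small_u : set Uk :=
  gen_subalg setT [set y | exists2 x : {x : U | UZ x}, y = base_change x &
    (exists h, sval x = E h \/ sval x = F h) \/
    (exists j, sval x = K j \/ sval x = K' j)].

End BaseChange.
End QuantumGl.

Arguments small_u n {k} eps.

Section QSchur.
Variables (R : comUnitRingType) (v : R) (n r : nat).

Local Notation q := (v ^+ 2).
Local Notation tc i j := (Gen (i, j) : term R ('I_n * 'I_n)).

Inductive Aqrel : term R ('I_n * 'I_n) -> term R ('I_n * 'I_n) -> Prop :=
  | Aqrel_row (i j m : 'I_n) : Aqrel (tc i j * tc i m) (tc i m * tc i j)
  | Aqrel_le (i j s t : 'I_n) : (s < i)%N -> (j <= t)%N ->
      Aqrel (tc i j * tc s t) (q *: (tc s t * tc i j))
  | Aqrel_gt (i j s t : 'I_n) : (s < i)%N -> (t < j)%N ->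
      Aqrel (tc i j * tc s t)
        ((q - 1)%R *: (tc s j * tc i t) + tc s t * tc i j).

Definition Aq := presented Aqrel.

Definition cgen (i j : 'I_n) : Aq := pgen Aqrel (i, j).

Local Notation word := (r.-tuple 'I_n).
Local Notation N := #|{: word}|.

Definition cmon (i j : word) : Aq := \prod_(a < r) cgen (tnth i a) (tnth j a).

Definition Aqr : set Aq :=
  [set x | exists a : word -> word -> R, x = \sum_i \sum_j a i j *: cmon i j].

Definition functional (f : Aq -> R) : Prop :=
  forall a x y, Aqr x -> Aqr y -> f (a *: x + y) = a * f x + f y.

(* An element f of the dual of [Aqr] is determined by its values on the
   spanning family [cmon i j], and is stored as the matrix of these values.
   As Delta (cmon i j) = \sum_t cmon i t (x) cmon t j and the counit maps
   [cmon i j] to (i == j)%:R, the product (f (x) g) \o Delta is the product of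
   matrices and the unit of the dual algebra is the identity matrix. *)
Definition table (f : Aq -> R) : 'M[R]_N :=
  \matrix_(a, b) f (cmon (enum_val a) (enum_val b)).

Definition qSchur : set 'M[R]_N :=
  [set M | exists2 f, functional f & M = table f].

Definition Xi : set 'M[nat]_n := [set A | (\sum_i \sum_j A i j)%N = r].

Definition cpow (A : 'M[nat]_n) : Aq := \prod_j \prod_i cgen i j ^+ A i j.

Definition xi (A : 'M[nat]_n) : 'M[R]_N :=
  xget 0 [set M | exists f, [/\ functional f, M = table f
    & forall B, Xi B -> f (cpow B) = (B == A)%:R]].

Definition dA (A : 'M[nat]_n) : int :=
  (\sum_(i < n) \sum_(j < n) \sum_(t < n | (t < j)%N) (A i j * A i t)%N%:Z)
  - \sum_(i < n) \sum_(j < n) \sum_(s < n | (i < s)%N) \sum_(t < n | (t < j)%N)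
      (A i j * A s t)%N%:Z.

Definition br (A : 'M[nat]_n) : 'M[R]_N := v ^ (- dA A) *: xi A.

Definition add_diag (A : 'M[nat]_n) (d : 'I_n -> nat) : 'M[nat]_n :=
  \matrix_(i, j) (A i j + (if i == j then d i else 0))%N.

(* D is bounded by r without loss because A + D has entry sum r. *)
Definition Ajr (A : 'M[nat]_n) (j : 'I_n -> int) : 'M[R]_N :=
  \sum_(d : {ffun 'I_n -> 'I_r.+1} | `[< Xi (add_diag A (fun i => d i)) >])
     v ^ (\sum_i (d i)%:Z * j i) *: br (add_diag A (fun i => d i)).

End QSchur.

Notation words n r := #|{: r.-tuple 'I_n}|.

Definition is_zeta n r (zeta : U n -> 'M[Qv]_(words n r)) : Prop :=
  [/\ alg_hom zeta, forall x, qSchur ups (zeta x),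
      forall h, zeta (E h) = Ajr ups r (delta_mx (lo h) (hi h)) (fun=> 0),
      forall h, zeta (F h) = Ajr ups r (delta_mx (hi h) (lo h)) (fun=> 0)
    & forall j : 'I_n -> int,
        zeta (\prod_i Kint i (j i)) = Ajr ups r (const_mx 0%N) j].

(* [zetak] is the base change of [zeta]: the values of zeta x for x in [UZ]
   lie in ZZ, and those of zetak (x (x) 1) are their images under v |-> eps. *)
Definition is_zeta_base_change n r (k : fieldType) (eps : k)
    (zeta : U n -> 'M[Qv]_(words n r))
    (zetak : Uk n eps -> 'M[k]_(words n r)) : Prop :=
  [/\ alg_hom zetak, forall x, qSchur eps (zetak x)
    & forall (x : {x : U n | UZ x}) a b, exists P m,
        zeta (sval x) a b = laurent ups P m /\
        zetak (base_change eps x) a b = laurent eps P m].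

Definition little_qSchur n r (k : fieldType) (eps : k)
    (zetak : Uk n eps -> 'M[k]_(words n r)) : set 'M[k]_(words n r) :=
  zetak @` small_u n eps.

(* Main.v *)
(** Let V have basis e_0, ..., e_{n-1}.  The little q-Schur algebra is the
    algebra of operators on the r-th tensor power of V generated by the E_h, F_h
    and K_j; as it acts faithfully, it is semisimple if and only if this tensor
    power is a semisimple module.

    If r < l, the quantum integers [1], ..., [r] are invertible, and induction on
    r (tensoring a singular vector with V) shows that every tensor is a sum of
    singular vectors, i.e. vectors killed by all E_h, and of images of the F_h.  A
    contravariant form makes singular vectors orthogonal to the images of the
    F_h, so a singular vector generates a simple module, and these modules span.

    If l <= r, the q-symmetric tensors are spanned by vectors indexed by the
    contents c = (c_0, ..., c_{n-1}), and E_h, F_h never increase the sum of the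
    c_i %/ l.  A vector x with c_0 = l is sent by F_0 to a strictly lower level of
    this filtration, but F_0 x is not in the image of that lower level under F_0,
    so this level is not a direct summand.  This fails only when n = 2 and l
    divides r - l + 1; then the same construction in degree r - 2, tensored with
    the quantum determinant, works unless l = 2.

    If l = n = 2 and r is odd, E^2 = F^2 = 0 and EF + FE = 1, so that each weight
    vector x is EFx + FEx, a sum of vectors in simple two-dimensional modules. *)

Require Import Defs.
From HB Require Import structures.
From mathcomp Require Import all_boot all_order all_algebra.
From mathcomp Require Import boolp classical_sets functions.
From mathcomp Require Import mpoly zify ring.

Set Implicit Arguments.
Unset Strict Implicit.
Unset Printing Implicit Defensive.

Import Order.TTheory GRing.Theory Num.Theory.
Local Open Scope ring_scope.

(** * Operators on tensor powers *)

(** The algebra S consists of matrices acting on the tensor power, and the full matrix algebra is,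
    as a left S-module, a direct sum of copies of that tensor power; this is how facts on vectors
    become facts on left ideals of S. Two obstacles shape the proof. First, [xi] is chosen by [xget]
    among functionals dual to the monomials, so the images of E, F and K have to be computed.
    Spanning of the sorted monomials makes a dual functional unique, and for the few shapes that
    occur one is read off an explicit representation of [Aq] by triangular 2 x 2 matrices; linear
    independence of the monomials is thus avoided. Second, at a root of unity neither complete
    reducibility nor positivity of a form is at hand: dominance of the weight of a singular vector
    is carried along as data, and the form enters only through adjointness and nondegeneracy, which
    force a singular vector in the image of the F's to be 0. For n = 1 the tensor power is a line
    and S = k is semisimple for every r, which is why the theorem is stated for n at least 2. *)

Section Tensor.
Variables (k : fieldType) (v : k).
(* An element of the tensor algebra on e_0, e_1, ... is the family of its
   coefficients on words; infinite families are harmless since every operator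
   below preserves length. *)
Local Notation M := (seq nat -> k^o).
Implicit Types (x y : M) (w : seq nat) (lam : nat -> int).

Definition twist h j : k := if j == h then v^-1 else if j == h.+1 then v else 1.
Definition slice x j : M := fun w => x (j :: w).
Definition tens j x : M :=
  fun w => if w is i :: w' then (if i == j then x w' else 0) else 0.

(* Replaces e_b by e_a in one tensor factor, the factors to its left being acted
   upon by K_h^-1 K_{h+1}. *)
Fixpoint hop h a b x w {struct w} : k^o :=
  if w is j :: w' then
    (if j == a then x (b :: w') else 0) + twist h j * hop h a b (slice x j) w'
  else 0.

Lemma addME x y w : (x + y) w = x w + y w.
Proof. by []. Qed.
Lemma sclME (c : k) x w : (c *: x) w = c * x w.
Proof. by []. Qed.

Lemma zeroME w : (0 : M) w = 0.
Proof. by []. Qed.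

Lemma hop_is_linear h a b : linear (hop h a b).
Proof.
move=> c x y; apply/funext => w; rewrite addME sclME.
elim: w x y => [|j w IH] x y /=; first by rewrite mulr0 addr0.
have -> : slice (c *: x + y) j = c *: slice x j + slice y j by [].
by rewrite IH addME sclME; case: eqP => _; ring.
Qed.
HB.instance Definition _ h a b :=
  GRing.isLinear.Build k M M _ (hop h a b) (hop_is_linear h a b).

Lemma tens_is_linear j : linear (tens j).
Proof.
move=> c x y; apply/funext => -[|i w]; rewrite addME sclME /=.
  by rewrite mulr0 addr0.
by case: eqP => _; rewrite ?mulr0 ?addr0.
Qed.
HB.instance Definition _ j :=
  GRing.isLinear.Build k M M _ (tens j) (tens_is_linear j).

(* E_h and F_h up to products of the K_j, chosen so that they are adjoint to each
   other for the form making words orthonormal. *)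
Definition eop h x : M := hop h h h.+1 x.
Definition fop h x : M := hop h h.+1 h x.
HB.instance Definition _ h :=
  GRing.isLinear.Build k M M _ (eop h) (hop_is_linear h h h.+1).
HB.instance Definition _ h :=
  GRing.isLinear.Build k M M _ (fop h) (hop_is_linear h h.+1 h).

Lemma slice_hop h a b x j : slice (hop h a b x) j =
  (if j == a then slice x b else 0) + twist h j *: hop h a b (slice x j).
Proof. by apply/funext => w /=; rewrite /slice /= addME; case: eqP. Qed.

Lemma slice_eop h x j : slice (eop h x) j =
  (if j == h then slice x h.+1 else 0) + twist h j *: eop h (slice x j).
Proof. exact: slice_hop. Qed.

Lemma slice_fop h x j : slice (fop h x) j =
  (if j == h.+1 then slice x h else 0) + twist h j *: fop h (slice x j).
Proof. exact: slice_hop. Qed.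

Lemma sliceD x y j : slice (x + y) j = slice x j + slice y j.
Proof. by []. Qed.
Lemma sliceZ c x j : slice (c *: x) j = c *: slice x j.
Proof. by []. Qed.

Lemma eop_cons h x j w : eop h x (j :: w) =
  (if j == h then x (h.+1 :: w) else 0) + twist h j * eop h (slice x j) w.
Proof. by []. Qed.
Lemma fop_cons h x j w : fop h x (j :: w) =
  (if j == h.+1 then x (h :: w) else 0) + twist h j * fop h (slice x j) w.
Proof. by []. Qed.

(* v^(1-a) [a] *)
Definition phi (a : int) : k := (1 - v ^ (- (a * 2%:Z))) / (1 - v ^- 2).

Definition far g h := [&& g != h, g != h.+1 & h != g.+1].

(** The two operators move disjoint pairs of letters, so the twist of each is 1 on the letters moved
    by the other ([k1], [k2]); on all other letters the twists are commuting scalars. *)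
Lemma hop_far g h a b a' b' x : far g h -> (a \in [:: g; g.+1]) -> (b \in [:: g; g.+1]) ->
  (a' \in [:: h; h.+1]) -> (b' \in [:: h; h.+1]) ->
  hop g a b (hop h a' b' x) = hop h a' b' (hop g a b x).
Proof.
move=> gh ag bg ah bh; apply/funext => w.
have k1 c : c \in [:: g; g.+1] -> twist h c = 1.
  move: gh; rewrite /far !inE /twist => gh cg.
  by rewrite (_ : (c == h) = false) 1?(_ : (c == h.+1) = false) //; lia.
have k2 c : c \in [:: h; h.+1] -> twist g c = 1.
  move: gh; rewrite /far !inE /twist => gh cg.
  by rewrite (_ : (c == g) = false) 1?(_ : (c == g.+1) = false) //; lia.
have dis c c' : c \in [:: g; g.+1] -> c' \in [:: h; h.+1] -> (c == c') = false.
  by move: gh; rewrite /far !inE; lia.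
have dis' c c' ch cg := etrans (eq_sym c' c) (dis c c' ch cg).
elim: w x => [|j w IH] x //.
rewrite /= !slice_hop !linearD !linearZ /= !(addME, sclME) /= IH.
have [ja|ja] := eqVneq j a.
  subst j; rewrite (dis a a') // !linear0 ?(dis b a') // /= (k1 b bg) (k1 a ag).
  by rewrite zeroME; ring.
have [ja'|ja'] := eqVneq j a'.
  by subst j; rewrite (dis' a b') // !linear0 /= ?zeroME (k2 b' bh) (k2 a' ah); ring.
by rewrite !linear0 /= ?zeroME; ring.
Qed.

Lemma eop_fop_far g h x : far g h -> eop g (fop h x) = fop h (eop g x).
Proof. by move=> gh; apply: hop_far; rewrite ?inE ?eqxx ?orbT. Qed.
Lemma fop_fop_far g h x : far g h -> fop g (fop h x) = fop h (fop g x).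
Proof. by move=> gh; apply: hop_far; rewrite ?inE ?eqxx ?orbT. Qed.

(** Source of all later statements on weights and supports; the letter counts are compared
    additively to avoid truncated subtraction. *)
Lemma hop_supp h a b x w : hop h a b x w != 0 -> exists w',
  [/\ x w' != 0, size w' = size w &
   forall j, (count_mem j w' + (a == j) = count_mem j w + (b == j))%N].
Proof.
elim: w x => [|j w IH] x /=; first by rewrite eqxx.
have [ja|_] := eqVneq j a; last first.
  rewrite add0r mulf_eq0 negb_or => /andP[_ /IH[w' [xw' sw' cw']]].
  by exists (j :: w'); split => //= [|i]; rewrite ?sw' -?addnA ?cw'.
have [->|xb _] := eqVneq (x (b :: w)) 0; last first.
  by exists (b :: w); split => //= i; rewrite ja addnAC [RHS]addnAC (addnC (b == i)).
rewrite add0r mulf_eq0 negb_or => /andP[_ /IH[w' [xw' sw' cw']]].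
by exists (j :: w'); split => //= [|i]; rewrite ?sw' -?addnA ?cw'.
Qed.

Hypothesis v_neq0 : v != 0.
Hypothesis v2 : v ^+ 2 != 1.

Lemma den_neq0 : 1 - v ^- 2 != 0.
Proof.
rewrite subr_eq0 eq_sym; apply: contra v2 => /eqP h.
by rewrite -[v ^+ 2]invrK h invr1.
Qed.

Lemma phi0 : phi 0 = 0.
Proof. by rewrite /phi mul0r oppr0 expr0z subrr mul0r. Qed.

Lemma phiS a : phi (a + 1) = 1 + v ^- 2 * phi a.
Proof.
rewrite /phi (mulrDl a) mul1r opprD expfzDr // -[v ^ - 2%:Z]exprnN.
have := den_neq0; move: (v ^ (- (a * 2))) => y d.
by field; rewrite v_neq0 subr_eq0 v2.
Qed.

Lemma phiS' a : phi (a + 1) = phi a + v ^ (- (a * 2%:Z)).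
Proof.
rewrite /phi (mulrDl a) mul1r opprD expfzDr // -[v ^ - 2%:Z]exprnN.
have := den_neq0; move: (v ^ (- (a * 2))) => y d.
by field; rewrite v_neq0 subr_eq0 v2.
Qed.

Lemma phiD a b : phi (a + b) = phi a + v ^ (- (a * 2%:Z)) * phi b.
Proof.
rewrite /phi (mulrDl a) opprD expfzDr //; have := den_neq0.
by move: (v ^ (- (a * 2))) (v ^ (- (b * 2))) => y z d; field; rewrite v_neq0 subr_eq0 v2.
Qed.

Lemma phiN1 a : phi (a - 1) = v ^+ 2 * (phi a - 1).
Proof.
rewrite -{2}[a](subrK 1) phiS addrAC subrr add0r mulrA mulfV ?mul1r //.
by rewrite expf_neq0.
Qed.

Definition wt lam x :=
  forall w, x w != 0 -> forall j, (count_mem j w)%:Z = lam j.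

(** Both operators carry the same twist, so the commutator of quantum gl_n becomes a v^2-commutator
    and its torus term becomes v^(1-a)[a], with a the difference of the two multiplicities. A front
    letter h or h+1 shifts a by one, and [phiS] and [phiN1] absorb this shift in the induction. *)
Lemma eop_fop_w h x w : eop h (fop h x) w =
  v ^+ 2 * fop h (eop h x) w
  + phi ((count_mem h w)%:Z - (count_mem h.+1 w)%:Z) * x w.
Proof.
elim: w x => [|j w IH] x.
  by rewrite /= /eop /fop /= subrr phi0 mul0r mulr0 addr0.
rewrite eop_cons slice_fop fop_cons (fop_cons _ (eop h x)) slice_eop eop_cons.
rewrite !linearD !linearZ /= !(addME, sclME) /= IH.
rewrite /twist eqxx.
have hS : (h.+1 == h) = false by lia.
have hS' : (h == h.+1) = false by lia.
rewrite hS hS' eqxx.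
have [->|jh] := eqVneq j h.
  rewrite hS' /= add1n add0n linear0 /= ?zeroME.
  have -> : (count_mem h w).+1%:Z - (count_mem h.+1 w)%:Z =
     ((count_mem h w)%:Z - (count_mem h.+1 w)%:Z) + 1 by lia.
  by rewrite phiS /slice /=; field.
have [->|jh1] := eqVneq j h.+1.
  rewrite /= add1n add0n linear0 /= ?zeroME.
  have -> : (count_mem h w)%:Z - (count_mem h.+1 w).+1%:Z =
     ((count_mem h w)%:Z - (count_mem h.+1 w)%:Z) - 1 by lia.
  by rewrite phiN1 /slice /=; field.
rewrite !linear0 /= ?zeroME !add0n.
by rewrite /slice; ring.
Qed.

Lemma eop_fop lam h x : wt lam x ->
  eop h (fop h x) = v ^+ 2 *: fop h (eop h x) + phi (lam h - lam h.+1) *: x.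
Proof.
move=> wx; apply/funext => w; rewrite eop_fop_w !(addME, sclME).
congr (_ + _).
have [->|/wx c] := eqVneq (x w) 0; first by rewrite !mulr0.
by rewrite !c.
Qed.

Lemma neqS (h : nat) : (h == h.+1) = false.
Proof. by apply/eqP; elim: h => // h IH []. Qed.
Lemma neqSS (h : nat) : (h == h.+2) = false.
Proof. by elim: h. Qed.
Definition neqE := (eqSS, neqS, neqSS, fun h => etrans (eq_sym h.+1 h) (neqS h),
  fun h => etrans (eq_sym h.+2 h) (neqSS h), eqxx).

Definition adj g h := (g == h.+1) || (h == g.+1).

(** In the usual normalization E_g and F_h commute; the factor v^-1 is left by the K's absorbed into
    [eop] and [fop]. *)
Lemma eop_fop_adj g h x : adj g h -> eop g (fop h x) = v^-1 *: fop h (eop g x).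
Proof.
move=> gh; apply/funext => w; rewrite sclME.
elim: w x => [|j w IH] x; first by rewrite /= /eop /fop /= mulr0.
rewrite eop_cons slice_fop fop_cons (fop_cons _ (eop g x)) slice_eop eop_cons.
rewrite !linearD !linearZ /= !(addME, sclME) /= IH.
rewrite /twist.
case/orP: gh => /eqP ->.
- have [->|jh] := eqVneq j h.
    by rewrite ?neqE ?linear0 /= ?zeroME /slice; field.
  have [->|jh1] := eqVneq j h.+1.
    by rewrite ?neqE ?linear0 /= ?zeroME /slice; field.
  have [->|jh2] := eqVneq j h.+2.
    by rewrite ?linear0 /= ?zeroME /slice; field.
  by rewrite ?linear0 /= ?zeroME /slice; field.
- have [->|jg] := eqVneq j g.
    by rewrite ?neqE ?linear0 /= ?zeroME /slice; field.
  have [->|jg1] := eqVneq j g.+1.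
    by rewrite ?neqE ?linear0 /= ?zeroME /slice; field.
  have [->|jg2] := eqVneq j g.+2.
    rewrite ?neqE ?linear0 /= ?zeroME /slice.
    rewrite ?add0r ?mul1r mulrDr !mulrA.
    by rewrite mulVf // mulfV // !mul1r; congr (_ + _).
  by rewrite ?linear0 /= ?zeroME /slice; field.
Qed.

End Tensor.

Arguments eop {k} v h : simpl never.
Arguments fop {k} v h : simpl never.

(** * Singular vectors *)

Lemma sum_delta (V : nmodType) N a (X : V) :
  \sum_(s < N) (if s == a :> nat then X else 0) = if (a < N)%N then X else 0.
Proof.
case: ltnP => aN; last first.
  by rewrite big1 // => s _; case: eqP => // sa; have := ltn_ord s; lia.
by rewrite (bigD1 (Ordinal aN)) //= eqxx big1 ?addr0 // => s; rewrite -val_eqE /= => /negPf ->.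
Qed.

Section Lowering.
Variables (k : fieldType) (v : k).
Local Notation M := (seq nat -> k^o).
Implicit Types (x y m u : M) (w : seq nat) (lam : nat -> int).
Local Notation eop := (eop v).
Local Notation fop := (fop v).
Local Notation phi := (phi v).

Definition supp n r x := forall w, x w != 0 -> size w = r /\ all (ltn^~ n) w.

Lemma eq_wt lam mu x : lam =1 mu -> wt lam x -> wt mu x.
Proof. by move=> e wx w xw j; rewrite (wx w xw) e. Qed.

Lemma wt_lin lam (c : k) x y : wt lam x -> wt lam y -> wt lam (c *: x + y).
Proof.
move=> wx wy w; rewrite addME sclME.
have [->|xw _] := eqVneq (x w) 0; last exact: wx.
by rewrite mulr0 add0r; apply: wy.
Qed.

Lemma wt0 lam : wt lam (0 : M).
Proof. by move=> w; rewrite zeroME eqxx. Qed.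

Lemma wtZ lam (c : k) x : wt lam x -> wt lam (c *: x).
Proof. by move=> wx; rewrite -[_ *: _]addr0; apply: wt_lin => //; apply: wt0. Qed.

Lemma wt_sum lam (I : Type) (s : seq I) (P : pred I) (F : I -> M) :
  (forall i, P i -> wt lam (F i)) -> wt lam (\sum_(i <- s | P i) F i).
Proof.
move=> H; elim/big_ind: _ => [|x y wx wy|] //; first exact: wt0.
by rewrite -[x]scale1r; apply: wt_lin.
Qed.

Lemma supp_lin n r (c : k) x y : supp n r x -> supp n r y -> supp n r (c *: x + y).
Proof.
move=> sx sy w; rewrite addME sclME.
have [->|xw _] := eqVneq (x w) 0; last exact: sx.
by rewrite mulr0 add0r; apply: sy.
Qed.

Lemma supp0 n r : supp n r (0 : M).
Proof. by move=> w; rewrite zeroME eqxx. Qed.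

Lemma suppZ n r (c : k) x : supp n r x -> supp n r (c *: x).
Proof. by move=> sx; rewrite -[_ *: _]addr0; apply: supp_lin => //; apply: supp0. Qed.

Lemma suppD n r x y : supp n r x -> supp n r y -> supp n r (x + y).
Proof. by move=> sx sy; rewrite -[x]scale1r; apply: supp_lin. Qed.

Lemma supp_sum n r (I : Type) (s : seq I) (P : pred I) (F : I -> M) :
  (forall i, P i -> supp n r (F i)) -> supp n r (\sum_(i <- s | P i) F i).
Proof. by move=> H; elim/big_ind: _ => [|x y|] //; [exact: supp0|exact: suppD]. Qed.

Lemma supp_hop n r h a b x : (a < n)%N -> supp n r x -> supp n r (hop v h a b x).
Proof.
move=> an sx w /hop_supp[w' [/sx[sw aw] <- cw]]; split => //.
apply/allP => j jw; have := cw j; rewrite -has_pred1 has_count in jw.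
have [<- //|_] := eqVneq a j.
case: (posnP (count_mem j w')) => [->|]; first by lia.
by rewrite -has_count has_pred1 => /(allP aw).
Qed.

Lemma supp_eop n r h x : (h.+1 < n)%N -> supp n r x -> supp n r (eop h x).
Proof. by move=> hn; apply: supp_hop; apply: ltnW. Qed.
Lemma supp_fop n r h x : (h.+1 < n)%N -> supp n r x -> supp n r (fop h x).
Proof. by move=> hn; apply: supp_hop. Qed.

Lemma wt_fop lam h x : wt lam x ->
  wt (fun i => lam i - (i == h)%:Z + (i == h.+1)%:Z) (fop h x).
Proof. by move=> wx w /hop_supp[w' [/wx c _ cw]] j; have := cw j; have := c j; lia. Qed.

Lemma wt_eop lam h x : wt lam x ->
  wt (fun i => lam i + (i == h)%:Z - (i == h.+1)%:Z) (eop h x).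
Proof. by move=> wx w /hop_supp[w' [/wx c _ cw]] j; have := cw j; have := c j; lia. Qed.

Lemma tens_nz j x w : tens j x w != 0 -> exists2 w', w = j :: w' & x w' != 0.
Proof.
case: w => [|i w] /=; first by rewrite eqxx.
by have [-> xw|_] := eqVneq i j; [exists w|rewrite eqxx].
Qed.

Lemma supp_tens n r j x : (j < n)%N -> supp n r x -> supp n r.+1 (tens j x).
Proof. by move=> jn sx w /tens_nz[w' -> /sx[<- /= ->]]; rewrite jn. Qed.

Lemma wt_tens lam j x : wt lam x -> wt (fun i => lam i + (i == j)%:Z) (tens j x).
Proof. by move=> wx w /tens_nz[w' -> /wx c] i; have := c i => /=; lia. Qed.

Lemma hop_tens h a b j x : hop v h a b (tens j x) =
  (if j == b then tens a x else 0) + twist v h j *: tens j (hop v h a b x).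
Proof.
apply/funext => -[|i w]; rewrite addME sclME /=.
  by case: eqP => _ /=; rewrite ?zeroME mulr0 addr0.
rewrite (_ : slice (tens j x) i = if i == j then x else 0); last first.
  by apply/funext => w'; rewrite /slice /=; case: eqP.
rewrite (eq_sym b); have [->|ij] := eqVneq i j.
  by case: (j == b) => /=; rewrite ?zeroME //; case: eqP.
by rewrite linear0 zeroME !mulr0; case: (j == b) => /=; rewrite ?zeroME //; case: eqP.
Qed.

Lemma eop_tens h j x : eop h (tens j x) =
  (if j == h.+1 then tens h x else 0) + twist v h j *: tens j (eop h x).
Proof. exact: hop_tens. Qed.
Lemma fop_tens h j x : fop h (tens j x) =
  (if j == h then tens h.+1 x else 0) + twist v h j *: tens j (fop h x).
Proof. exact: hop_tens. Qed.

(* The root vector lowering j to j + s + 1, an iterated v-commutator of F's. *)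
Fixpoint gop j s x : M := if s is s'.+1 then
    fop (j + s)%N (gop j s' x) - v^-1 *: gop j s' (fop (j + s)%N x)
  else fop j x.

Lemma gop_is_linear j s : linear (gop j s).
Proof.
elim: s => [|s IH] c x y /=; first by rewrite linearP.
rewrite linearP !IH linearP /= !scalerDr scalerN !scalerA (mulrC v^-1).
by rewrite opprD addrACA.
Qed.
HB.instance Definition _ j s :=
  GRing.isLinear.Build k M M _ (gop j s) (gop_is_linear j s).

Lemma eopZ h (c : k) x : eop h (c *: x) = c *: eop h x.
Proof. exact: linearZ. Qed.
Lemma fopZ h (c : k) x : fop h (c *: x) = c *: fop h x.
Proof. exact: linearZ. Qed.
Lemma gopZ j s (c : k) x : gop j s (c *: x) = c *: gop j s x.
Proof. exact: linearZ. Qed.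
Lemma tensZ j (c : k) x : tens j (c *: x) = c *: tens j x.
Proof. exact: linearZ. Qed.
Lemma tensB j x y : tens j (x - y) = tens j x - tens j y.
Proof. exact: linearB. Qed.
Lemma tensD j x y : tens j (x + y) = tens j x + tens j y.
Proof. exact: linearD. Qed.
Lemma fopB h x y : fop h (x - y) = fop h x - fop h y.
Proof. exact: linearB. Qed.
Lemma fopD h x y : fop h (x + y) = fop h x + fop h y.
Proof. exact: linearD. Qed.
Lemma gopD j s x y : gop j s (x + y) = gop j s x + gop j s y.
Proof. exact: linearD. Qed.
Lemma oppME x w : (- x) w = - x w.
Proof. by []. Qed.
Lemma eopB h x y : eop h (x - y) = eop h x - eop h y.
Proof. exact: linearB. Qed.

Lemma wt_gop lam j s x : wt lam x ->
  wt (fun i => lam i - (i == j)%:Z + (i == (j + s).+1%N)%:Z) (gop j s x).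
Proof.
elim: s lam x => [|s IH] lam x wx /=; first by rewrite addn0; apply: wt_fop.
rewrite addrC -scaleNr; apply: wt_lin.
  by apply: eq_wt (IH _ _ (wt_fop (h := (j + s.+1)%N) wx)) => i /=; rewrite !addnS; lia.
by apply: eq_wt (wt_fop (IH _ _ wx)) => i /=; rewrite !addnS; lia.
Qed.

Lemma supp_gop n r j s x : ((j + s).+1 < n)%N -> supp n r x -> supp n r (gop j s x).
Proof.
elim: s x => [|s IH] x js sx /=; first by apply: supp_fop => //; rewrite addn0 in js.
rewrite addrC -scaleNr; apply: supp_lin.
  by apply: IH; [lia|apply: supp_fop].
by apply: supp_fop => //; apply: IH => //; lia.
Qed.

Hypothesis v_neq0 : v != 0.
Hypothesis v2 : v ^+ 2 != 1.

Lemma eop_gop_far h j s x : ((j + s).+1 < h)%N || (h.+1 < j)%N ->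
  eop h (gop j s x) = gop j s (eop h x).
Proof.
elim: s x => [|s IH] x hj /=; first by rewrite eop_fop_far // /far; lia.
rewrite eopB eopZ !IH; try lia.
by rewrite !eop_fop_far ?IH // /far; lia.
Qed.

Lemma fop_gop_far h j s x : ((j + s).+1 < h)%N ->
  fop h (gop j s x) = gop j s (fop h x).
Proof.
elim: s x => [|s IH] x hj /=; first by rewrite fop_fop_far // /far; lia.
rewrite fopB fopZ !IH; try lia.
by rewrite !(@fop_fop_far _ _ h) ?IH // /far; lia.
Qed.

(** This lemma and the next four move E_h past the root vector from j to j+s+1. Next to either end
    it passes up to a factor v^-1, strictly inside it passes unchanged, and at the last or first
    simple root an additional term appears, in which the root vector is shortened. *)
Lemma eop_gop_top j s x :
  eop (j + s).+1%N (gop j s x) = v^-1 *: gop j s (eop (j + s).+1%N x).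
Proof.
case: s => [|s] /=.
  by rewrite addn0 eop_fop_adj // /adj eqxx.
rewrite eopB eopZ eop_fop_adj ?/adj ?eqxx // eop_gop_far ?addnS; try lia.
rewrite eop_gop_far; last lia.
by rewrite eop_fop_adj ?/adj ?eqxx // gopZ scalerBr.
Qed.

Lemma eop_gop_bot h s x :
  eop h (gop h.+1 s x) = v^-1 *: gop h.+1 s (eop h x).
Proof.
elim: s x => [|s IH] x /=; first by rewrite eop_fop_adj // /adj eqxx orbT.
rewrite eopB eopZ eop_fop_far ?IH; last by rewrite /far; lia.
rewrite eop_fop_far; last by rewrite /far; lia.
by rewrite fopZ scalerBr.
Qed.

Lemma eop_gop_last lam j s x : wt lam x ->
  eop (j + s).+1%N (gop j s.+1 x) =
    v *: gop j s.+1 (eop (j + s).+1%N x) + gop j s x.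
Proof.
move=> wx /=; rewrite addnS eopB eopZ.
have wg := wt_gop (j := j) (s := s) wx.
rewrite (eop_fop v_neq0 v2 _ wg) !eop_gop_top (eop_fop v_neq0 v2 _ wx).
rewrite gopD !(fopZ, gopZ) /=.
have -> : lam (j + s).+1%N - ((j + s).+1%N == j)%:Z + ((j + s).+1%N == (j + s).+1%N)%:Z
   - (lam (j + s).+2%N - ((j + s).+2%N == j)%:Z + ((j + s).+2%N == (j + s).+1%N)%:Z)
   = (lam (j + s).+1%N - lam (j + s).+2%N) + 1 by lia.
rewrite phiS //; apply/funext => w; rewrite !(addME, sclME, oppME).
by field.
Qed.

(** In the base case each half of the v-commutator leaves a shortened root vector [gop j a]; these
    cancel because F_{j+a+2} is far from [gop j a]. Larger b only adds F's that commute with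
    E_{j+a+1}. *)
Lemma eop_gop_mid lam j a b x : wt lam x ->
  eop (j + a).+1%N (gop j (a + b).+2 x) = gop j (a + b).+2 (eop (j + a).+1%N x).
Proof.
elim: b lam x => [|b IH] lam x wx.
  have wf := wt_fop (h := (j + a).+2) wx.
  rewrite addn0 -[gop j a.+2 x]/(fop (j + a.+2)%N (gop j a.+1 x)
     - v^-1 *: gop j a.+1 (fop (j + a.+2)%N x)) !addnS.
  rewrite -[gop j a.+2 _]/(fop (j + a.+2)%N (gop j a.+1 (eop (j + a).+1%N x))
     - v^-1 *: gop j a.+1 (fop (j + a.+2)%N (eop (j + a).+1%N x))) !addnS.
  rewrite eopB eopZ eop_fop_adj ?/adj ?eqxx ?orbT //.
  rewrite (eop_gop_last _ _ wx) (eop_gop_last _ _ wf) fopD fopZ (fop_gop_far (j := j) (s := a)) //.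
  rewrite eop_fop_adj ?/adj ?eqxx ?orbT // gopZ.
  by apply/funext => w; rewrite !(addME, sclME, oppME); field.
have wf := wt_fop (h := (j + (a + b).+3)%N) wx.
rewrite addnS -[gop j _ x]/(fop (j + (a + b).+3)%N (gop j (a + b).+2 x)
     - v^-1 *: gop j (a + b).+2 (fop (j + (a + b).+3)%N x)).
rewrite eopB eopZ (IH _ _ wf) eop_fop_far ?(IH _ _ wx); last by rewrite /far; lia.
by rewrite eop_fop_far; last by rewrite /far; lia.
Qed.

(** The power of v is the difference phi(a+1) - phi(a) given by [phiS']: the torus term of E_j F_j
    is met on both sides of F_{j+1}, which raises a = lam_j - lam_{j+1} by one. *)
Lemma eop_gop_first lam j s x : wt lam x ->
  eop j (gop j s.+1 x) = v *: gop j s.+1 (eop j x)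
    - (v^-1 * v ^ (- ((lam j - lam j.+1) * 2%:Z))) *: gop j.+1 s x.
Proof.
elim: s lam x => [|s IH] lam x wx.
  have wf := wt_fop (h := j.+1) wx.
  rewrite /= addn1 eopB eopZ eop_fop_adj ?/adj ?eqxx ?orbT //.
  rewrite (eop_fop v_neq0 v2 _ wx) (eop_fop v_neq0 v2 _ wf).
  rewrite eop_fop_adj ?/adj ?eqxx ?orbT // fopD !fopZ /=.
  rewrite (_ : phi (lam j - _ + _ - _) = phi (lam j - lam j.+1 + 1)); last first.
    by congr phi; lia.
  rewrite phiS' //; apply/funext => w; rewrite !(addME, sclME, oppME).
  by field.
have IH1 := IH _ _ wx; have IH2 := IH _ _ (wt_fop (h := (j + s.+2)%N) wx).
rewrite -[gop j s.+2 x]/(fop (j + s.+2)%N (gop j s.+1 x)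
     - v^-1 *: gop j s.+1 (fop (j + s.+2)%N x)).
rewrite -[gop j s.+2 _]/(fop (j + s.+2)%N (gop j s.+1 (eop j x))
     - v^-1 *: gop j s.+1 (fop (j + s.+2)%N (eop j x))).
rewrite -[gop j.+1 s.+1 x]/(fop (j.+1 + s.+1)%N (gop j.+1 s x)
     - v^-1 *: gop j.+1 s (fop (j.+1 + s.+1)%N x)).
rewrite eopB eopZ IH2 eop_fop_far ?IH1 ?eop_fop_far; try by rewrite /far; lia.
have -> : (j.+1 + s.+1 = j + s.+2)%N by lia.
rewrite (_ : lam j - _ + _ - _ = lam j - lam j.+1); last by lia.
rewrite fopB !fopZ.
by apply/funext => w; rewrite !(addME, sclME, oppME); ring.
Qed.

Definition sing n x := forall h, (h.+1 < n)%N -> eop h x = 0.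

(* (lam + rho, eps_j - eps_i) - 1, giving the denominators in [lowering]. *)
Definition chi lam i (j : nat) : int := lam j - lam i + (i%:Z - 1 - j%:Z).

(* The [m j] are the coefficients of the singular vector \sum_j e_j (x) m_j of
   weight lam + eps_i that starts from m_i = u; the last equation determines m_j
   from the later ones when [phi (chi lam i j)] is invertible. *)
Lemma lowering n r lam i u d : (i < n)%N -> wt lam u -> supp n r u -> sing n u ->
  (forall j, (j < i)%N -> phi (chi lam i j) != 0) -> (d <= i)%N ->
  exists m : nat -> M, [/\ m i = u,
   forall j, (i - d <= j <= i)%N ->
     wt (fun a => lam a + (a == i)%:Z - (a == j)%:Z) (m j) /\ supp n r (m j),
   forall j h, (i - d <= j <= i)%N -> (h.+1 < n)%N -> h != j \/ j = i ->
     eop h (m j) = 0,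
   forall j, (i - d <= j < i)%N -> eop j (m j) = - v *: m j.+1 &
   forall j, (i - d <= j < i)%N -> (- v^-1 * phi (chi lam i j)) *: m j =
     \sum_(s < i - j) gop j s (m (j + s).+1%N)].
Proof.
move=> iltn wu su singu nz; elim: d => [|d IH] di.
  exists (fun=> u); split => // [j|j h|j|j].
  - rewrite subn0 -eqn_leq => /eqP <-; split => //.
    by apply: eq_wt wu => a /=; lia.
  - by move=> _ hn _; apply: singu.
  - by rewrite subn0; lia.
  - by rewrite subn0; lia.
have [m [mi m_wt m_e0 m_e m_sum]] := IH (ltnW di).
set j0 := (i - d.+1)%N.
have j0i : (j0 < i)%N by rewrite /j0; lia.
have ed : (i - d = j0.+1)%N by rewrite /j0; lia.
rewrite ed in m_wt m_e0 m_e m_sum.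
pose y := \sum_(s < i - j0) gop j0 s (m (j0 + s).+1%N).
pose m' j := if j == j0 then (- v / phi (chi lam i j0)) *: y else m j.
have m'E j : (j0 < j)%N -> m' j = m j by rewrite /m'; case: eqP => // ->; lia.
have wy : wt (fun a => lam a + (a == i)%:Z - (a == j0)%:Z) y.
  apply: wt_sum => s _; have := ltn_ord s => si.
  have [w_ _] := m_wt (j0 + s).+1 ltac:(lia).
  by apply: eq_wt (wt_gop (j := j0) (s := s) w_) => a /=; lia.
have sy : supp n r y.
  apply: supp_sum => s _; have := ltn_ord s => si.
  by apply: supp_gop; [lia|have [] := m_wt (j0 + s).+1 ltac:(lia)].
have eys h : eop h y = \sum_(s < i - j0) eop h (gop j0 s (m (j0 + s).+1%N)).
  exact: linear_sum.
have ey h : (h.+1 < n)%N -> h != j0 -> eop h y = 0.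
  move=> hn hj; rewrite eys; case: (ltngtP h j0) hj => // hj _.
    apply: big1 => s _; have := ltn_ord s => si.
    have e0 : eop h (m (j0 + s).+1%N) = 0 by apply: m_e0 => //; [lia|left; lia].
    have [hj1|hj1] := ltnP h.+1 j0.
      by rewrite eop_gop_far ?e0 ?linear0 //; lia.
    move: (nat_of_ord s) e0 => s' e0.
    have e1 : j0 = h.+1 by lia.
    by rewrite e1 in e0 *; rewrite eop_gop_bot e0 linear0 scaler0.
  have [a ha] : exists a, h = (j0 + a).+1 by exists (h - j0).-1; lia.
  (* Two terms can survive: s = a+1, where E_h shortens the root vector and gives X, and s = a,
     where E_h m_h = -v m_{h+1} gives -X. If h >= i neither contributes. *)
  pose X : M := gop j0 a (m h.+1).
  transitivity (\sum_(s < i - j0) ((if s == a.+1 :> nat then X else 0)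
      - (if s == a :> nat then (if (h < i)%N then X else 0) else 0))).
    apply: eq_bigr => s _; have := ltn_ord s => si.
    have [sa|sa|sa] := ltngtP s a.
    - rewrite (_ : (s == a.+1 :> nat) = false) ?subr0; last lia.
      rewrite eop_gop_far; last lia.
      by rewrite m_e0 ?linear0 //; [lia|left; lia].
    - have [w_ _] := m_wt (j0 + s).+1 ltac:(lia).
      have [sa1|sa1] := eqVneq (s : nat) a.+1; last first.
        rewrite subr0 (_ : nat_of_ord s = (a + (s - a.+2)).+2)%N; last lia.
        rewrite (_ : nat_of_ord s = (a + (s - a.+2)).+2)%N in w_; last lia.
        rewrite ha (eop_gop_mid _ _ _ w_) -ha m_e0 ?linear0 //; [lia|left; lia].
      rewrite subr0 sa1 ha addnS in w_ *.
      rewrite (eop_gop_last _ _ w_) /X ha m_e0 ?linear0 ?scaler0 ?add0r //; lia.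
    - rewrite sa (_ : (a == a.+1) = false) ?sub0r; last lia.
      rewrite ha eop_gop_top -ha; case: ltngtP => hi.
      + rewrite m_e; last lia.
        by rewrite gopZ scalerA mulrN mulVf // scaleN1r.
      + by move: si; rewrite sa; lia.
      + have -> : eop h (m h) = 0 by apply: m_e0 => //; [lia|right].
        by rewrite linear0 scaler0 oppr0.
  rewrite sumrB !sum_delta; repeat case: ifP => ?;
    rewrite ?subrr //; lia.
(* The term s = 0 gives the torus term of E F on m_{j0+1}; the other terms reassemble, by the
   relation already known for m_{j0+1}, into a multiple of m_{j0+1}; [phiD] adds the two
   coefficients. *)
have ey0 : eop j0 y = phi (chi lam i j0) *: m j0.+1.
  rewrite eys (_ : (i - j0 = (i - j0.+1).+1)%N); last by lia.
  rewrite big_ord_recl /= addn0.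
  have [w_ _] := m_wt j0.+1 ltac:(lia).
  rewrite (eop_fop v_neq0 v2 _ w_) (m_e0 _ j0) ?linear0 ?scaler0 ?add0r; try lia.
  rewrite (eq_bigr (fun s : 'I__ => - (v^-1 * v ^ (- ((lam j0 - lam j0.+1) * 2%:Z)))
      *: gop j0.+1 s (m (j0.+1 + s).+1%N))); last first.
    move=> s _; have := ltn_ord s => si.
    rewrite [bump _ _]/(bump 0 s) /bump /= add1n.
    have [w1 _] := m_wt (j0 + s.+1).+1 ltac:(lia).
    rewrite (eop_gop_first _ _ w1) m_e0 ?linear0 ?scaler0 ?sub0r ?scaleNr; try lia.
    rewrite addnS addSn; congr (- (_ * _ ^ (- (_ * _)) *: _)).
    by lia.
  rewrite -scaler_sumr; have [j1i|j1i] := ltnP j0.+1 i.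
    rewrite -m_sum ?ltnSn // scalerA -scalerDl; congr (_ *: _).
    have -> : chi lam i j0 = (lam j0 - lam j0.+1 + 1) + chi lam i j0.+1.
      by rewrite /chi; lia.
    rewrite [phi (_ + chi _ _ _)]phiD // (_ : - ((lam j0 - lam j0.+1 + 1) * 2%:Z) =
      - ((lam j0 - lam j0.+1) * 2%:Z) - 2%:Z) ?expfzDr //; last by lia.
    rewrite -[v ^ - 2%:Z]exprnN.
    rewrite (_ : lam j0 + _ - _ - _ = lam j0 - lam j0.+1 + 1); last lia.
    by field.
  have -> : (i - j0.+1 = 0)%N by lia.
  rewrite big_ord0 scaler0 addr0; congr (phi _ *: _).
  have : lam j0.+1 = lam i by congr lam; lia.
  by rewrite /chi; lia.
exists m'; split.
- by rewrite m'E.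
- move=> j jj; have [->|jj0] := eqVneq j j0; last by rewrite m'E; [apply: m_wt; lia|lia].
  by rewrite /m' eqxx; split; [apply: wtZ|apply: suppZ].
- move=> j h jj hn hj; have [e|jj0] := eqVneq j j0; last first.
    by rewrite m'E; [apply: m_e0 => //; lia|lia].
  rewrite /m' e eqxx eopZ ey ?scaler0 //; rewrite -e.
  by case: hj => // ?; lia.
- move=> j jj; rewrite (m'E j.+1); last by lia.
  have [e|jj0] := eqVneq j j0; last first.
    by rewrite m'E; [apply: m_e; lia|lia].
  by rewrite /m' e eqxx eopZ ey0 scalerA mulfVK // nz.
- move=> j jj; have [e|jj0] := eqVneq j j0; last first.
    rewrite m'E; last lia.
    by rewrite m_sum; [apply: eq_bigr => s _; rewrite m'E //; lia|lia].
  rewrite e [in LHS]/m' eqxx scalerA (_ : _ * _ = 1) ?scale1r; last first.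
    by have := nz _ j0i => ?; field; apply/andP.
  by apply: eq_bigr => s _; rewrite m'E //; lia.
Qed.

End Lowering.

(** * Decomposition of small tensor powers *)

Section Decomposition.
Variables (k : fieldType) (v : k).
Local Notation M := (seq nat -> k^o).
Implicit Types (x y m u : M) (w : seq nat) (lam : nat -> int).
Local Notation eop := (eop v).
Local Notation fop := (fop v).
Local Notation phi := (phi v).
Local Notation gop := (gop v).
Local Notation sing := (sing v).
Variable n : nat.

Definition dominant lam := forall i j, (i <= j < n)%N -> lam j <= lam i.

(** Dominance is part of the data because at a root of unity a singular vector need not have
    dominant weight in general; [chi_bound] relies on it to control the denominators of
    [lowering]. *)
Inductive singF r : M -> Prop :=
  | singF_sing lam u : wt lam u -> dominant lam -> supp n r u -> sing n u -> singF r u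
  | singF_fop h y : (h.+1 < n)%N -> supp n r y -> singF r (fop h y)
  | singF_add x y : singF r x -> singF r y -> singF r (x + y).

Inductive imF r : M -> Prop :=
  | imF_0 : imF r 0
  | imF_fop h y : (h.+1 < n)%N -> supp n r y -> imF r (fop h y)
  | imF_add x y : imF r x -> imF r y -> imF r (x + y).

Lemma singF_0 r : singF r 0.
Proof.
apply: (@singF_sing r (fun=> 0)); [exact: wt0|by []|exact: supp0|].
by move=> h _; rewrite linear0.
Qed.

Lemma imF_singF r x : imF r x -> singF r x.
Proof.
elim=> [|h y hn sy|y z _ Sy _ Sz]; [exact: singF_0|exact: singF_fop|exact: singF_add].
Qed.

Lemma singF_Z r (c : k) x : singF r x -> singF r (c *: x).
Proof.
elim=> [lam u wu dl su hu|h y hn sy|y z _ Sy _ Sz].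
- apply: (@singF_sing r lam) => //; [exact: wtZ|exact: suppZ|].
  by move=> h hn; rewrite eopZ hu ?scaler0.
- by rewrite -fopZ; apply: singF_fop => //; apply: suppZ.
- by rewrite scalerDr; apply: singF_add.
Qed.

Lemma imF_Z r (c : k) x : imF r x -> imF r (c *: x).
Proof.
elim=> [|h y hn sy|y z _ Sy _ Sz].
- by rewrite scaler0; apply: imF_0.
- by rewrite -fopZ; apply: imF_fop => //; apply: suppZ.
- by rewrite scalerDr; apply: imF_add.
Qed.

Lemma imF_sum r (I : Type) (s : seq I) (P : pred I) (F : I -> M) :
  (forall i, P i -> imF r (F i)) -> imF r (\sum_(i <- s | P i) F i).
Proof. by move=> H; elim/big_ind: _ => [|x y|] //; [exact: imF_0|exact: imF_add]. Qed.

Lemma singF_sum r (I : Type) (s : seq I) (P : pred I) (F : I -> M) :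
  (forall i, P i -> singF r (F i)) -> singF r (\sum_(i <- s | P i) F i).
Proof. by move=> H; elim/big_ind: _ => [|x y|] //; [exact: singF_0|exact: singF_add]. Qed.

(* The form for which words of length r are orthonormal. *)
Fixpoint bil r x y : k := if r is r'.+1 then
    \sum_(j < n) bil r' (slice x j) (slice y j)
  else x [::] * y [::].

Lemma bilS r x y : bil r.+1 x y = \sum_(j < n) bil r (slice x j) (slice y j).
Proof. by []. Qed.

Lemma bilC r x y : bil r x y = bil r y x.
Proof.
elim: r x y => [|r IH] x y /=; first exact: mulrC.
by apply: eq_bigr => j _; apply: IH.
Qed.

Lemma bil_lin r (c : k) x y z : bil r (c *: x + y) z = c * bil r x z + bil r y z.
Proof.
elim: r x y z => [|r IH] x y z /=; first by rewrite addME sclME; ring.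
rewrite mulr_sumr -big_split; apply: eq_bigr => j _ /=.
by rewrite sliceD sliceZ IH.
Qed.

Lemma bilD r x y z : bil r (x + y) z = bil r x z + bil r y z.
Proof. by rewrite -[x]scale1r bil_lin mul1r scale1r. Qed.
Lemma bil0 r z : bil r 0 z = 0.
Proof. by have := bil_lin r (-1) 0 0 z; rewrite scaler0 addr0 mulN1r addNr. Qed.
Lemma bilZ r (c : k) x z : bil r (c *: x) z = c * bil r x z.
Proof. by rewrite -[_ *: _]addr0 bil_lin bil0 addr0. Qed.

Lemma bilDr r x y z : bil r z (x + y) = bil r z x + bil r z y.
Proof. by rewrite !(bilC _ z) bilD. Qed.
Lemma bil0r r z : bil r z 0 = 0.
Proof. by rewrite bilC bil0. Qed.
Lemma bilZr r (c : k) x z : bil r z (c *: x) = c * bil r z x.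
Proof. by rewrite !(bilC _ z) bilZ. Qed.

Lemma bil_adj r h x y : (h.+1 < n)%N -> bil r (eop h x) y = bil r x (fop h y).
Proof.
move=> hn; elim: r x y => [|r IH] x y; first by rewrite /= mul0r mulr0.
pose X := bil r (slice x h.+1) (slice y h).
transitivity (\sum_(j < n) (if j == h :> nat then X else 0)
    + \sum_(j < n) twist v h j * bil r (slice x j) (fop h (slice y j))).
  rewrite bilS -big_split; apply: eq_bigr => j _.
  by rewrite slice_eop bilD bilZ IH; case: eqP => [->|_]; rewrite ?bil0.
have -> : \sum_(j < n) (if j == h :> nat then X else 0) =
    \sum_(j < n) (if j == h.+1 :> nat then X else 0).
  by rewrite !sum_delta hn (ltnW hn).
rewrite -big_split bilS; apply: eq_bigr => j _.
by rewrite slice_fop bilDr bilZr; case: eqP => [->|_]; rewrite ?bil0r.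
Qed.

Lemma bil_nondeg r x : supp n r x ->
  (forall y, supp n r y -> bil r x y = 0) -> x = 0.
Proof.
move=> sx bx; apply/funext => w; rewrite zeroME; apply/eqP.
apply: contraT => xw; have [sw aw] := sx _ xw.
pose delta w : M := fun w' => (w' == w)%:R.
suff e : bil r x (delta w) = x w.
  have sd : supp n r (delta w).
    by move=> w'; rewrite /delta; have [->|] := eqVneq w' w; rewrite ?eqxx.
  by move: xw; rewrite -e bx ?eqxx.
clear sx bx xw; elim: w r x sw aw => [|j w IH] r x /= <-.
  by rewrite /= /delta eqxx mulr1.
case/andP=> jn aw; rewrite bilS (bigD1 (Ordinal jn)) //= big1 => [|i].
  have -> : slice (delta (j :: w)) j = delta w.
    by apply/funext => w'; rewrite /slice /delta eqseq_cons eqxx.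
  by rewrite IH ?addr0.
rewrite -val_eqE /= => ij.
suff -> : slice (delta (j :: w)) i = 0 by rewrite bil0r.
by apply/funext => w'; rewrite /slice /delta eqseq_cons (negPf ij).
Qed.

(** By adjointness x is orthogonal to the images of the F's, being singular, and to the singular
    vectors, being itself in the image of the F's. Together these exhaust the tensors, and the form
    is nondegenerate. *)
Lemma sing_imF0 r x : (forall z, supp n r z -> singF r z) ->
  sing n x -> supp n r x -> imF r x -> x = 0.
Proof.
move=> D hx sx ix; apply: bil_nondeg (sx) _ => z /D.
elim=> [lam u _ _ su hu|h y hn sy|y t _ Sy _ St]; last by rewrite bilDr Sy St addr0.
- elim: ix => [|h y hn sy|y t _ Sy _ St]; last by rewrite bilD Sy St addr0.
    exact: bil0.
  by rewrite bilC -bil_adj // hu ?bil0.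
- by rewrite -bil_adj // hx ?bil0.
Qed.

Hypothesis v_neq0 : v != 0.
Hypothesis v2 : v ^+ 2 != 1.

(** For s = 0 this is F_j (e_j (x) m) = e_{j+1} (x) m + v^-1 e_j (x) F_j m. Along a longer root
    vector the mixed term of each step is absorbed into the next image, so a single factor v remains
    whatever the length. *)
Lemma imF_tens_gop r j s m : ((j + s).+1 < n)%N -> supp n r m ->
  imF r.+1 (tens j (gop j s m) + v *: tens (j + s).+1 m).
Proof.
elim: s m => [|s IH] m js sm /=.
  rewrite addn0 in js *.
  have -> : tens j (fop j m) + v *: tens j.+1 m = v *: fop j (tens j m).
    rewrite fop_tens /twist eqxx scalerDr scalerA mulfV // scale1r.
    by rewrite addrC.
  by apply/imF_Z/imF_fop => //; apply: supp_tens => //; lia.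
rewrite addnS in js *; have jn : (j < n)%N by lia.
have sg : supp n r (gop j s m) by apply: supp_gop => //; lia.
have sf : supp n r (fop (j + s).+1%N m) by apply: supp_fop.
have -> : tens j (fop (j + s).+1%N (gop j s m) - v^-1 *: gop j s (fop (j + s).+1%N m)) =
  fop (j + s).+1%N (tens j (gop j s m)) - v^-1 *: (tens j (gop j s (fop (j + s).+1%N m))
   + v *: tens (j + s).+1%N (fop (j + s).+1%N m)) + tens (j + s).+1%N (fop (j + s).+1%N m).
  rewrite fop_tens /twist (_ : (j == _) = false); last lia.
  rewrite (_ : (j == _) = false) ?add0r ?scale1r; last lia.
  rewrite tensB tensZ scalerDr scalerA mulVf // scale1r opprD.
  by rewrite !addrA subrK.
rewrite -addrA; apply: imF_add.
  apply: imF_add; first by apply: imF_fop => //; apply: supp_tens.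
  by rewrite -scaleNr; apply: imF_Z; apply: IH => //; lia.
have -> : tens (j + s).+1%N (fop (j + s).+1%N m) + v *: tens (j + s).+2%N m =
    v *: fop (j + s).+1%N (tens (j + s).+1%N m).
  rewrite fop_tens /twist eqxx scalerDr scalerA mulfV // scale1r.
  by rewrite addrC.
by apply/imF_Z/imF_fop => //; apply: supp_tens => //; lia.
Qed.

(** The first nonvanishing condition makes the singular vector \sum_j e_j (x) m_j exist; the second
    makes it a nonzero multiple of e_i (x) u modulo images of F's. The constant c is the product
    over j < i of v^2 phi(chi+1) / phi(chi). *)
Lemma lowering_sing r lam i u : (i < n)%N -> wt lam u -> supp n r u -> sing n u ->
  (forall j, (j < i)%N -> phi (chi lam i j) != 0) ->
  (forall j, (j < i)%N -> phi (chi lam i j + 1) != 0) ->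
  exists x (c : k), [/\ wt (fun a => lam a + (a == i)%:Z) x, supp n r.+1 x, sing n x,
    c != 0 & imF r.+1 (x - c *: tens i u)].
Proof.
move=> iltn wu su hu nz nz1.
have [m [mi m_wt m_e0 m_e m_sum]] := lowering v_neq0 v2 iltn wu su hu nz (leqnn i).
rewrite subnn /= in m_wt m_e0 m_e m_sum.
have [c c0 cI] : exists2 c : k, c != 0 &
   imF r.+1 (\sum_(s < i.+1) tens s (m s) - c *: tens i u).
  suff H d : (d <= i)%N -> exists2 c : k, c != 0 &
     imF r.+1 (\sum_(s < d.+1) tens (i - d + s)%N (m (i - d + s)%N) - c *: tens i u).
    by have [c c0] := H i (leqnn i); rewrite subnn => cI; exists c.
  elim: d => [_|d IH di].
    exists 1; rewrite ?oner_eq0 // subn0 big_ord1 addn0 mi scale1r subrr.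
    exact: imF_0.
  have [c c0 cI] := IH (ltnW di).
  set j0 := (i - d.+1)%N; have j0i : (j0 < i)%N by rewrite /j0; lia.
  have p0 := nz _ j0i; have p1 := nz1 _ j0i.
  have eS : \sum_(s < d.+1) tens (i - d + s)%N (m (i - d + s)%N) =
    \sum_(s < d.+1) tens (j0 + s).+1 (m (j0 + s).+1).
    by apply: eq_bigr => s _; rewrite (_ : (i - d + s = (j0 + s).+1)%N) // /j0; lia.
  rewrite eS in cI; set S := \sum_(s < d.+1) _ in cI.
  have -> : \sum_(s < d.+2) tens (j0 + s)%N (m (j0 + s)%N) = tens j0 (m j0) + S.
    rewrite big_ord_recl addn0; congr (_ + _); apply: eq_bigr => s _.
    by rewrite lift0 addnS.
  pose b := phi (chi lam i j0).
  (* Replacing m_{j0} by its expression through the later m's and applying [imF_tens_gop] turns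
     e_{j0} (x) m_{j0} into (v^2 / b) S modulo images of F's; adding S gives the factor 1 + v^2 / b
     = v^2 phi(chi+1) / b. *)
  exists ((1 + v ^+ 2 / b) * c).
    rewrite mulf_neq0 //; apply: contra p1 => /eqP e.
    rewrite phiS // -/b; apply/eqP.
    have -> : 1 + v ^- 2 * b = (1 + v ^+ 2 / b) * b / v ^+ 2.
      by field; rewrite v_neq0 p0.
    by rewrite e !mul0r.
  have em : tens j0 (m j0) =
      (- v / b) *: \sum_(s < d.+1) tens j0 (gop j0 s (m (j0 + s).+1)).
    rewrite -linear_sum /= (_ : d.+1 = i - j0)%N ?/j0; last by lia.
    rewrite -m_sum // -tensZ scalerA -/b (_ : _ * _ = 1) ?scale1r //.
    by field; rewrite p0 v_neq0.
  pose T s := tens j0 (gop j0 s (m (j0 + s).+1)) + v *: tens (j0 + s).+1 (m (j0 + s).+1).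
  have -> : tens j0 (m j0) + S - ((1 + v ^+ 2 / b) * c) *: tens i u =
     (- v / b) *: (\sum_(s < d.+1) T s)
     + (1 + v ^+ 2 / b) *: (S - c *: tens i u).
    rewrite /T big_split /= -scaler_sumr -/S em.
    move: (\sum_(s < d.+1) _) => Y; apply/funext => w.
    by rewrite !(addME, oppME, sclME); field.
  apply: imF_add; apply: imF_Z => //; apply: imF_sum => s _.
  have := ltn_ord s => sd.
  by apply: imF_tens_gop; [rewrite /j0; lia|have [] := m_wt (j0 + s).+1 ltac:(rewrite /j0; lia)].
exists (\sum_(s < i.+1) tens s (m s)), c; split => //.
- apply: wt_sum => s _; have := ltn_ord s => si.
  have [w_ _] := m_wt s ltac:(lia).
  by apply: eq_wt (wt_tens (j := s) w_) => a /=; lia.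
- apply: supp_sum => s _; have := ltn_ord s => si.
  by apply: supp_tens; [lia|have [] := m_wt s ltac:(lia)].
- move=> h hn; rewrite (linear_sum (eop h)) /=.
  have [hi|ih] := ltnP h i; last first.
    apply: big1 => s _; have := ltn_ord s => si.
    rewrite eop_tens (_ : (s == h.+1 :> nat) = false) ?add0r; last lia.
    by rewrite m_e0 ?linear0 ?scaler0 //; lia.
  pose X := tens h (m h.+1).
  transitivity (\sum_(s < i.+1) ((if s == h.+1 :> nat then X else 0)
      - (if s == h :> nat then X else 0))).
    apply: eq_bigr => s _; have := ltn_ord s => si; rewrite eop_tens /twist.
    have [->|sh1] := eqVneq (nat_of_ord s) h.+1.
      rewrite !neqE subr0 (m_e0 h.+1 h) ?linear0 ?scaler0 ?addr0 //; lia.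
    have [->|sh] := eqVneq (nat_of_ord s) h.
      by rewrite m_e // tensZ scalerA mulrN mulVf // scaleN1r.
    by rewrite m_e0 ?linear0 ?scaler0 ?subrr ?addr0 //; lia.
  by rewrite sumrB !sum_delta !ltnS (ltnW hi) hi subrr.
Qed.

Lemma sum_count_le w a b : (\sum_(a <= s < b) count_mem s w <= size w)%N.
Proof.
elim: w => [|j w IH] /=; first by rewrite big1.
rewrite big_split /= -addn1 addnC leq_add //.
rewrite (eq_bigr (fun s => if s == j then 1%N else 0%N)); last first.
  by move=> s _; rewrite eq_sym; case: eqP.
rewrite -big_mkcond sum1_count.
by have := count_uniq_mem j (iota_uniq a (b - a)); rewrite /index_iota => ->; case: (_ \in _).
Qed.

(** The weight of u is the content of a word of length r. By dominance each of the letters t+1, ...,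
    i-1 occurs in it, as lam_{i-1} > lam_i >= 0; hence lam_t + (i-1-t) <= r. Positivity comes from
    lam_t >= lam_{i-1} > lam_i. *)
Lemma chi_bound r lam i u t : wt lam u -> dominant lam -> supp n r u -> u != 0 ->
  (i < n)%N -> (0 < i)%N -> lam i < lam i.-1 -> (t < i)%N ->
  exists2 b : nat, chi lam i t = b%:Z & (0 < b <= r)%N.
Proof.
move=> wu dl su u0 iltn i0 li ti.
have [w uw] : exists w, u w != 0.
  apply: contrapT => H; case/eqP: u0; apply/funext => w; apply/eqP.
  by apply: contrapT => /negP uw; apply: H; exists w.
have [sw _] := su _ uw; have cw := wu _ uw.
have h1 := sum_count_le w t i; rewrite sw in h1.
have h2 : (count_mem t w + (i.-1 - t) <= \sum_(t <= s < i) count_mem s w)%N.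
  rewrite big_ltn // leq_add2l.
  apply: leq_trans (_ : (\sum_(t.+1 <= s < i) 1 <= _)%N).
    by rewrite sum_nat_const_nat muln1; lia.
  rewrite big_nat_cond [X in (_ <= X)%N]big_nat_cond; apply: leq_sum => s.
  rewrite andbT => /andP[ts si]; have := dl s i.-1 ltac:(lia).
  by have := cw s; have := cw i; lia.
have := dl t i.-1 ltac:(lia); have := cw t; have := cw i => ci ct dti.
exists (`|chi lam i t|)%N; rewrite /chi; lia.
Qed.

Variable l : nat.
Hypothesis phi_neq0 : forall b : nat, (0 < b < l)%N -> phi b%:Z != 0.

(* Induction on r: for m singular of dominant weight lam, e_j (x) m is congruent to
   a multiple of a singular vector modulo images of F's if lam + eps_j is dominant,
   and lies in the image of F_{j-1} otherwise, as then F_{j-1} m is singular, hence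
   0; for m = F_h y one moves F_h across, at the cost of increasing j. *)
Lemma singF_full r : (r < l)%N -> forall x, supp n r x -> singF r x.
Proof.
elim: r => [|r IH] rl x sx.
  have w0 w : x w != 0 -> w = [::] by move=> /sx[/size0nil].
  apply: (@singF_sing 0 (fun=> 0)) => //; first by move=> w /w0 -> j.
  move=> h hn; apply/funext => w; rewrite zeroME; apply/eqP.
  case: w => [//|j w]; apply: contraT => /hop_supp[w' [/sx[sw' _] sw _]].
  by rewrite sw' in sw.
have D := IH (ltnW rl).
have -> : x = \sum_(j < n) tens j (slice x j).
  apply/funext => w; rewrite (_ : (\sum_(j < n) _) w = \sum_(j < n) tens j (slice x j) w).
    case: w => [|i w] /=; first by rewrite big1 //; apply/eqP; apply: contraT => /sx[].
    have [/sx[_ /= /andP[iln _]]|xw] := boolP (x (i :: w) != 0).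
      rewrite (bigD1 (Ordinal iln)) //= eqxx big1 ?addr0 // => j.
      by rewrite -val_eqE /= eq_sym => /negPf ->.
    by rewrite big1 => [|j _]; [apply/eqP; rewrite -[_ == _]negbK|
       case: eqP => // <-; apply/eqP; rewrite -[_ == _]negbK].
  by elim/big_ind2: _ => // y a z b; rewrite addME => -> ->.
have sc j : supp n r (slice x j) by move=> w /sx[[<-] /= /andP[]].
apply: singF_sum => j _; have := ltn_ord j; move: (nat_of_ord j) (sc j) => {}j.
move: (slice x j) => m sm jn {x sx sc}.
(* The front letter is treated by descending induction, because moving F_{j'} across e_{j'} produces
   e_{j'+1}; for the last letter the assumption is vacuous. *)
have aux j' m' : (j' < n)%N ->
    (forall m, (j'.+1 < n)%N -> supp n r m -> singF r.+1 (tens j'.+1 m)) ->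
    supp n r m' -> singF r.+1 (tens j' m'); last first.
  have [d jd] : exists d, (j + d = n.-1)%N by exists (n.-1 - j)%N; lia.
  elim: d j m jd jn sm => [|d IHd] j m jd jn sm; apply: aux => // y j1n sy.
    by lia.
  by apply: IHd => //; lia.
move=> {m sm jn} jn IHj sm; elim: {m' sm}(D _ sm).
- move=> lam u wu dl su hu; have [->|u0] := eqVneq u 0.
    by rewrite linear0; apply: singF_0.
  have [j0|j0] := posnP j'.
    rewrite j0 in jn IHj *; apply: (@singF_sing _ (fun a => lam a + (a == 0)%:Z)).
    + exact: wt_tens.
    + by move=> a b ab; have := dl _ _ ab; lia.
    + exact: supp_tens.
    + by move=> h hn; rewrite eop_tens hu // linear0 scaler0 addr0.
  have := dl j'.-1 j' ltac:(lia); rewrite le_eqVlt => /orP[/eqP lj|lj].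
    have s0 : fop j'.-1 u = 0.
      have j1 : (j'.-1.+1 < n)%N by lia.
      apply: (@sing_imF0 r) => //; [|exact: supp_fop|exact: imF_fop].
      move=> h hn; have [->|hj] := eqVneq h j'.-1.
        rewrite (eop_fop v_neq0 v2 _ wu) hu // linear0 scaler0 add0r.
        by rewrite prednK // lj subrr phi0 scale0r.
      have [a|a] := boolP (adj h j'.-1).
        by rewrite eop_fop_adj // hu // linear0 scaler0.
      rewrite eop_fop_far ?hu ?linear0 //.
      by move: a; rewrite /adj /far hj negb_or.
    apply: imF_singF.
    have -> : tens j' u = fop j'.-1 (tens j'.-1 u).
      by rewrite fop_tens eqxx s0 linear0 scaler0 addr0 prednK.
    by apply: imF_fop; [lia|apply: supp_tens => //; lia].
  have b t := chi_bound wu dl su u0 jn j0 lj (t := t).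
  have [||x [c [wx sx hx c0 cI]]] := lowering_sing jn wu su hu.
  + by move=> t /b[c -> c0]; apply: phi_neq0; lia.
  + move=> t /b[c -> c0]; rewrite (_ : c%:Z + 1 = c.+1%:Z); last lia.
    by apply: phi_neq0; lia.
  have -> : tens j' u = c^-1 *: x + (- c^-1) *: (x - c *: tens j' u).
    by apply/funext => w; rewrite !(addME, oppME, sclME); field.
  apply: singF_add; last by apply/singF_Z/imF_singF.
  apply: singF_Z; apply: (singF_sing wx) => //.
  move=> a e ae; have := dl a e ae; have [ej|] := eqVneq e j'; last by lia.
  rewrite ej in ae *.
  have [->|aj] := eqVneq a j'; first by lia.
  have := dl a j'.-1; rewrite /= => h; case: (ltnP a j') => aj1; last by lia.
  by have := h ltac:(lia); lia.
- move=> h y hn sy; have [jh|jh] := eqVneq j' h.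
    subst j'; have -> : tens h (fop h y) =
      v *: fop h (tens h y) - v *: tens h.+1 y.
      rewrite fop_tens /twist eqxx; apply/funext => w.
      by rewrite !(addME, oppME, sclME); field.
    apply: singF_add; last by rewrite -scaleNr; apply: singF_Z; apply: IHj.
    by apply/singF_Z/singF_fop => //; apply: supp_tens.
  apply: imF_singF; have -> : tens j' (fop h y) = (twist v h j')^-1 *: fop h (tens j' y).
    rewrite fop_tens (negPf jh) add0r scalerA mulVf ?scale1r // /twist.
    by do 2?case: ifP => _; rewrite ?invr_eq0 ?oner_eq0.
  by apply/imF_Z/imF_fop => //; apply: supp_tens.
- by move=> y z _ Sy _ Sz; rewrite tensD; apply: singF_add.
Qed.

End Decomposition.

(** * Simplicity of the modules generated by singular vectors *)

Section Words.
Variables (k : fieldType) (v : k).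
Local Notation M := (seq nat -> k^o).
Implicit Types (x y u : M) (w W : seq nat) (lam : nat -> int).
Local Notation eop := (eop v).
Local Notation fop := (fop v).
Local Notation sing := (sing v).
Variable n : nat.

Definition kop j x : M := fun w => v ^+ count_mem j w * x w.
Definition kop' j x : M := fun w => v ^- count_mem j w * x w.

Lemma kopE j x w : kop j x w = v ^+ count_mem j w * x w.
Proof. by []. Qed.
Lemma kop'E j x w : kop' j x w = v ^- count_mem j w * x w.
Proof. by []. Qed.

Lemma hop_sumn h a b x w : hop v h a b x w != 0 ->
  exists2 w', x w' != 0 & (sumn w' + a = sumn w + b)%N.
Proof.
elim: w x => [|j w IH] x /=; first by rewrite eqxx.
have [ja|_] := eqVneq j a; last first.
  rewrite add0r mulf_eq0 negb_or => /andP[_ /IH[w' xw' sw']].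
  by exists (j :: w') => //=; lia.
have [->|xb _] := eqVneq (x (b :: w)) 0; last by exists (b :: w) => //=; lia.
rewrite add0r mulf_eq0 negb_or => /andP[_ /IH[w' xw' sw']].
by exists (j :: w') => //=; lia.
Qed.

Definition word W := all (fun h => (h.+1 < n)%N) W.
Definition fword W x := foldr fop x W.
Definition eword W x := foldl (fun y h => eop h y) x W.

Lemma supp_fword r W x : word W -> supp n r x -> supp n r (fword W x).
Proof. by elim: W => //= h W IH /andP[hn /IH sx] /sx; apply: supp_fop. Qed.

Lemma sumn_supp r x w : supp n r x -> x w != 0 -> (sumn w <= n * r)%N.
Proof.
move=> sx /sx[<- ]; elim: w {sx} => //= j w IH /andP[jn /IH]; rewrite mulnS; lia.
Qed.

(** Each F raises the sum of the letters of a word by one, and each E lowers it by one, whereas this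
    sum lies between 0 and n r. *)
Lemma fword_eq0 r W x : word W -> supp n r x -> (n * r < size W)%N -> fword W x = 0.
Proof.
move=> hW sx sW; apply/funext => w; apply/eqP; apply: contraT => xw.
have := sumn_supp (supp_fword hW sx) xw.
suff : (size W <= sumn w)%N by lia.
elim: W w {hW sx sW} xw => //= h W IH w /hop_sumn[w' /IH]; lia.
Qed.

Lemma eword_eq0 r W x : word W -> supp n r x -> (n * r < size W)%N -> eword W x = 0.
Proof.
move=> hW sx sW; apply/funext => w; apply/eqP; apply: contraT => xw.
suff [w' xw' sw'] : exists2 w', x w' != 0 & sumn w' = (sumn w + size W)%N.
  by have := sumn_supp sx xw'; lia.
elim: W x {hW sx sW} xw => [|h W IH] x /= xw; first by exists w; rewrite ?addn0.
by have [w' /hop_sumn[w'' xw'' h1] h2] := IH _ xw; exists w'' => //; lia.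
Qed.

Inductive cyclicF u : M -> Prop :=
  | cyclicF_word W : word W -> cyclicF u (fword W u)
  | cyclicF_0 : cyclicF u 0
  | cyclicF_add x y : cyclicF u x -> cyclicF u y -> cyclicF u (x + y)
  | cyclicF_scale (c : k) x : cyclicF u x -> cyclicF u (c *: x).

Lemma cyclicF_fop u h x : (h.+1 < n)%N -> cyclicF u x -> cyclicF u (fop h x).
Proof.
move=> hn; elim=> [W hW||y z _ Fy _ Fz|c y _ Fy].
- by apply: (@cyclicF_word u (h :: W)); rewrite /= hn.
- by rewrite linear0; apply: cyclicF_0.
- by rewrite fopD; apply: cyclicF_add.
- by rewrite fopZ; apply: cyclicF_scale.
Qed.

Lemma wt_fword lam W u : wt lam u -> exists mu, wt mu (fword W u).
Proof.
move=> wu; elim: W => [|h W [mu IH]] /=; first by exists lam.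
by eexists; apply: wt_fop IH.
Qed.

Lemma wt_kop lam j x : wt lam x -> exists c : k, kop j x = c *: x.
Proof.
move=> wx; exists (v ^ (lam j)); apply/funext => w; rewrite sclME /kop.
have [->|/wx c] := eqVneq (x w) 0; first by rewrite !mulr0.
by rewrite -c.
Qed.

Lemma wt_kop' lam j x : wt lam x -> exists c : k, kop' j x = c *: x.
Proof.
move=> wx; exists (v ^ (- lam j)); apply/funext => w; rewrite sclME /kop'.
have [->|/wx c] := eqVneq (x w) 0; first by rewrite !mulr0.
by rewrite -c -exprnN.
Qed.

Lemma kop_lin j (c : k) x y : kop j (c *: x + y) = c *: kop j x + kop j y.
Proof. by apply/funext => w; rewrite /kop !(addME, sclME) /kop; ring. Qed.
Lemma kop'_lin j (c : k) x y : kop' j (c *: x + y) = c *: kop' j x + kop' j y.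
Proof. by apply/funext => w; rewrite /kop' !(addME, sclME) /kop'; ring. Qed.

Lemma cyclicF_diag u (g : M -> M) : (forall c x y, g (c *: x + y) = c *: g x + g y) ->
  (forall W, word W -> exists c : k, g (fword W u) = c *: fword W u) ->
  forall x, cyclicF u x -> cyclicF u (g x).
Proof.
move=> gl gw; have g0 : g 0 = 0.
  by have := gl (-1) 0 0; rewrite scaler0 addr0 scaleN1r addNr.
move=> x; elim=> [W hW||y z _ Fy _ Fz|c y _ Fy].
- by have [c ->] := gw W hW; apply/cyclicF_scale/cyclicF_word.
- by rewrite g0; apply: cyclicF_0.
- by rewrite -[y]scale1r gl scale1r; apply: cyclicF_add.
- by rewrite -[_ *: _]addr0 gl g0 addr0; apply: cyclicF_scale.
Qed.

Lemma cyclicF_kop lam u j x : wt lam u -> cyclicF u x -> cyclicF u (kop j x).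
Proof.
move=> wu; apply: cyclicF_diag; first exact: kop_lin.
by move=> W _; have [mu] := wt_fword W wu; apply: wt_kop.
Qed.
Lemma cyclicF_kop' lam u j x : wt lam u -> cyclicF u x -> cyclicF u (kop' j x).
Proof.
move=> wu; apply: cyclicF_diag; first exact: kop'_lin.
by move=> W _; have [mu] := wt_fword W wu; apply: wt_kop'.
Qed.

Inductive Fsing r : M -> Prop :=
  | Fsing_sing lam u : wt lam u -> dominant n lam -> supp n r u -> sing n u -> Fsing r u
  | Fsing_fop h y : (h.+1 < n)%N -> Fsing r y -> Fsing r (fop h y)
  | Fsing_add x y : Fsing r x -> Fsing r y -> Fsing r (x + y).

Lemma Fsing_0 r : Fsing r 0.
Proof.
apply: (@Fsing_sing r (fun=> 0)); [exact: wt0|by []|exact: supp0|].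
by move=> h _; rewrite linear0.
Qed.

Lemma Fsing_fword r W x : word W -> Fsing r x -> Fsing r (fword W x).
Proof. by elim: W => //= h W IH /andP[hn /IH Ux] /Ux; apply: Fsing_fop. Qed.

Lemma fwordD W x y : fword W (x + y) = fword W x + fword W y.
Proof. by elim: W => //= h W ->; apply: fopD. Qed.

(** In [singF] the operator F_h is applied to an arbitrary vector. Decomposing that vector again
    only lengthens the word W of F's in front, and long words vanish; t bounds the number of F's
    still to be added. *)
Lemma singF_Fsing r : (forall x, supp n r x -> singF v n r x) -> forall x, supp n r x -> Fsing r x.
Proof.
move=> D x sx.
suff H t W : (n * r < size W + t)%N -> word W -> forall y, supp n r y ->
    Fsing r (fword W y).
  by apply: (H (n * r).+1 [::]).
elim: t W => [|t IH] W sW hW y sy.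
  by rewrite addn0 in sW; rewrite (fword_eq0 hW sy sW); apply: Fsing_0.
elim: (D y sy) => {y sy} [lam u wu dl su hu|h y hn sy|y z _ Uy _ Uz].
- by apply: Fsing_fword => //; apply: (Fsing_sing wu).
- have -> : fword W (fop h y) = fword (rcons W h) y.
    by rewrite /fword foldr_rcons.
  by apply: IH => //; [rewrite size_rcons; lia|rewrite /word all_rcons hn].
- by rewrite fwordD; apply: Fsing_add.
Qed.

Hypothesis v_neq0 : v != 0.
Hypothesis v2 : v ^+ 2 != 1.

(** E is pushed through the F's until it reaches u, which it kills; so the span of the F-words on u
    is already a submodule. *)
Lemma cyclicF_eop lam u g x : wt lam u -> sing n u -> (g.+1 < n)%N ->
  cyclicF u x -> cyclicF u (eop g x).
Proof.
move=> wu hu gn; elim=> [W hW||y z _ Fy _ Fz|c y _ Fy].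
- elim: W hW => [|h W IH] /=; first by rewrite hu // => _; apply: cyclicF_0.
  case/andP=> hn hW; have {}IH := IH hW.
  have [gh|gh] := eqVneq g h.
    subst g; have [mu wy] := wt_fword W wu.
    rewrite (eop_fop v_neq0 v2 _ wy); apply: cyclicF_add.
      by apply/cyclicF_scale/cyclicF_fop.
    by apply/cyclicF_scale/cyclicF_word.
  have [a|a] := boolP (adj g h).
    by rewrite eop_fop_adj //; apply/cyclicF_scale/cyclicF_fop.
  rewrite eop_fop_far; first exact: cyclicF_fop.
  by move: a; rewrite /adj /far gh negb_or.
- by rewrite linear0; apply: cyclicF_0.
- by rewrite (linearD (eop g)); apply: cyclicF_add.
- by rewrite eopZ; apply: cyclicF_scale.
Qed.

Lemma cyclicF_supp r u x : supp n r u -> cyclicF u x -> supp n r x.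
Proof.
move=> su; elim=> [W hW||y z _ Fy _ Fz|c y _ Fy].
- exact: supp_fword.
- exact: supp0.
- exact: suppD.
- exact: suppZ.
Qed.

(** Apply any E_h that does not kill the vector, as long as there is one; this stops since long
    words of E's vanish. *)
Lemma exists_sing r x : supp n r x -> x != 0 ->
  exists W, [/\ word W, eword W x != 0 & sing n (eword W x)].
Proof.
move=> sx x0.
suff H t y : (forall W, word W -> size W = t -> eword W y = 0) -> y != 0 ->
    exists W, [/\ word W, eword W y != 0 & sing n (eword W y)].
  by apply: (H (n * r).+1) => // W hW sW; apply: (eword_eq0 hW sx); rewrite sW.
elim: t y => [|t IH] y Hy y0; first by have := Hy [::] isT erefl => /= e; rewrite e eqxx in y0.
have [hy|] := pselect (sing n y); first by exists [::].
case/existsNP=>[h /not_implyP[hn /eqP ey]].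
have Hy' W : word W -> size W = t -> eword W (eop h y) = 0.
  by move=> hW sW; apply: (Hy (h :: W)); rewrite /= ?hn // sW.
by have [W [hW W0 WS]] := IH _ Hy' ey; exists (h :: W); rewrite /= hn.
Qed.

(** Raising x as far as possible gives a singular y. Modulo images of F's only the empty word
    contributes to y, so y - c u is singular and in the image of the F's, hence 0. Every nonzero x
    thus leads back to u, which is the simplicity of the module. *)
Lemma cyclicF_simple r lam u x : (forall z, supp n r z -> singF v n r z) ->
  wt lam u -> supp n r u -> sing n u -> cyclicF u x -> x != 0 ->
  exists W (c : k), [/\ word W, c != 0 & eword W x = c *: u].
Proof.
move=> D wu su hu Fx x0.
have [W [hW y0 hy]] := exists_sing (cyclicF_supp su Fx) x0.
have Fy : cyclicF u (eword W x).
  elim: W x {y0 hy x0} hW Fx => //= h W IH x /andP[hn hW] Fx.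
  by apply: IH => //; apply: cyclicF_eop wu hu _ Fx.
have sy := cyclicF_supp su Fy.
suff [c Ic] : exists c : k, imF v n r (eword W x - c *: u).
  have e : eword W x - c *: u = 0.
    apply: (sing_imF0 D _ _ Ic) => [h hn|].
      by rewrite eopB eopZ hu // scaler0 subr0 hy.
    by rewrite -scaleNr addrC; apply: supp_lin.
  move/eqP: e; rewrite subr_eq0 => /eqP e; exists W, c; split => //.
  by apply: contraNneq y0 => c0; rewrite e c0 scale0r.
elim: Fy => [[|h W'] hW'||y z _ [c Fy] _ [d Fz]|c y _ [d Fy]].
- by exists 1; rewrite scale1r subrr; apply: imF_0.
- exists 0; rewrite scale0r subr0; case/andP: hW' => hn hW'.
  by apply: imF_fop => //; apply: supp_fword.
- by exists 0; rewrite scale0r subr0; apply: imF_0.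
- by exists (c + d); rewrite scalerDl opprD addrACA; apply: imF_add.
- by exists (c * d); rewrite -scalerA -scalerBr; apply: imF_Z.
Qed.

End Words.

(** * q-symmetric tensors and the non-split filtration *)

Section DividedPowers.
Variables (k : fieldType) (v : k).
Local Notation M := (seq nat -> k^o).
Implicit Types (x y : M) (w : seq nat) (g : seq nat -> k).
Local Notation eop := (eop v).
Local Notation fop := (fop v).
Local Notation kop := (kop v).
Local Notation kop' := (kop' v).
Hypothesis v_neq0 : v != 0.
Hypothesis v2 : v ^+ 2 != 1.

Definition qnum (m : nat) : k := (v ^+ m - v ^- m) / (v - v^-1).

Lemma qnum_den : v - v^-1 != 0.
Proof.
rewrite subr_eq0; apply: contra v2 => /eqP e.
by rewrite expr2 {2}e mulfV.
Qed.

Lemma qnum_den' : v * v - 1 != 0.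
Proof. by rewrite -expr2 subr_eq0. Qed.

Lemma qnum0 : qnum 0 = 0.
Proof. by rewrite /qnum !expr0 invr1 subrr mul0r. Qed.

Lemma qnumS m : qnum m.+1 = v ^- m + v * qnum m.
Proof.
rewrite /qnum !exprS; have := expf_neq0 m v_neq0; move: (v ^+ m) => y y0.
by field; rewrite v_neq0 qnum_den' y0.
Qed.

Lemma qnumS' m : qnum m.+1 = v ^+ m + v^-1 * qnum m.
Proof.
rewrite /qnum !exprS; have := expf_neq0 m v_neq0; move: (v ^+ m) => y y0.
by field; rewrite v_neq0 qnum_den' y0.
Qed.

Lemma qnum_eq0 m : (qnum m == 0) = ((v ^+ 2) ^+ m == 1).
Proof.
rewrite /qnum mulf_eq0 invr_eq0 (negPf qnum_den) orbF subr_eq0 -exprM mul2n -addnn exprD.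
have y0 := expf_neq0 m v_neq0.
by rewrite -(inj_eq (mulfI y0)) mulfV.
Qed.

Definition count_gt j w := count (ltn j) w.
Arguments count_gt : simpl never.
Lemma count_gt_cons j i w : count_gt j (i :: w) = ((j < i) + count_gt j w)%N.
Proof. by []. Qed.
(* v^-d for d the number of pairs of positions at which w is increasing. *)
Fixpoint invwt w : k := if w is j :: w' then v ^- count_gt j w' * invwt w' else 1.

Lemma invwt_neq0 w : invwt w != 0.
Proof. by elim: w => [|j w IH] /=; rewrite ?oner_neq0 // mulf_neq0 // invr_neq0 // expf_neq0. Qed.

Lemma perm_swap (a b : nat) w : perm_eq (a :: b :: w) (b :: a :: w).
Proof. exact: (permEl (perm_catCA [:: a] [:: b] w)). Qed.

Lemma perm_rem (a : nat) w w' : perm_eq w w' -> perm_eq (rem a w) (rem a w').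
Proof.
move=> ww; have [aw|aw] := boolP (a \in w); last first.
  by rewrite !rem_id // -(perm_mem ww).
rewrite -(perm_cons a) -(permPl (perm_to_rem aw)) (permPl ww).
by apply: perm_to_rem; rewrite -(perm_mem ww).
Qed.

Definition psym g := forall w w', perm_eq w w' -> g w = g w'.
(** For g satisfying [psym] these are the q-symmetric tensors: the content of a word fixes its
    coefficient up to the power of v recorded by [invwt]. *)
Definition symvec g : M := fun w => g w * invwt w.

Lemma slice_symvec g j : slice (symvec g) j = symvec (fun w => g (j :: w) * v ^- count_gt j w).
Proof. by apply/funext => w; rewrite /slice /symvec /= mulrA. Qed.

Lemma psym_cons g j : psym g -> psym (fun w => g (j :: w) * v ^- count_gt j w).
Proof.
move=> pg w w' ww; rewrite (pg _ (j :: w')) ?perm_cons //.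
by rewrite /count_gt (permP ww).
Qed.

Lemma count_gt_rem j c w : c \in w -> count_gt j w = ((j < c) + count_gt j (rem c w))%N.
Proof. by move=> cw; rewrite /count_gt (permP (perm_to_rem cw)). Qed.

(** Each occurrence of h+1 in w contributes a power of v, and these powers add up to the quantum
    integer of the multiplicity ([qnumS] at each step). This is the action on divided powers, the
    coefficient being governed by the new multiplicity. *)
Lemma fop_symvec g h : psym g -> fop h (symvec g) =
  symvec (fun w => qnum (count_mem h.+1 w) * g (h :: rem h.+1 w)).
Proof.
move=> pg; apply/funext => w; rewrite /symvec.
elim: w g pg => [|j w IH] g pg; first by rewrite (_ : fop h (symvec g) [::] = 0) //= qnum0 !mul0r.
rewrite fop_cons slice_symvec (IH _ (psym_cons j pg)) {IH} /= /twist.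
have [->|jh1] := eqVneq j h.+1.
  rewrite !neqE add1n qnumS.
  have eg : count_gt h w = (count_mem h.+1 w + count_gt h.+1 w)%N.
    by rewrite /count_gt; elim: w => //= i w ->; lia.
  rewrite /symvec /= eg exprD; have [hw|hw] := boolP (h.+1 \in w); last first.
    rewrite (count_memPn hw) qnum0 !mul0r !mulr0 addr0 expr0 mul1r invr1 addr0.
    by rewrite mul1r mulrA.
  rewrite (pg (h.+1 :: h :: rem h.+1 w) (h :: w)); last first.
    by apply: perm_trans (perm_swap _ _ _) _; rewrite perm_cons perm_sym perm_to_rem.
  rewrite (_ : count_gt h.+1 (h :: rem _ _) = count_gt h.+1 w); last first.
    by rewrite (count_gt_rem _ hw) /count_gt /= ltnn; lia.
  have := expf_neq0 (count_mem h.+1 w) v_neq0.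
  have := expf_neq0 (count_gt h.+1 w) v_neq0.
  move: (v ^+ _) (v ^+ _) => a b a0 b0.
  by field; rewrite a0 b0.
rewrite add0r add0n; have [hw|hw] := boolP (h.+1 \in w); last first.
  by rewrite (count_memPn hw) qnum0 !mul0r !mulr0.
rewrite (pg (j :: h :: _) (h :: j :: rem h.+1 w)); last first.
  exact: perm_swap.
have gj := count_gt_rem j hw; rewrite count_gt_cons.
have := expf_neq0 (count_gt j (rem h.+1 w)) v_neq0; rewrite gj !exprD.
have [->|jh] := eqVneq j h.
  by rewrite ltnn ltnSn expr0 expr1; move: (v ^+ _) => a a0; field; rewrite a0 v_neq0.
rewrite (_ : (j < h)%N = (j < h.+1)%N); last by lia.
by case: (j < _)%N; rewrite ?expr0 ?expr1; move: (v ^+ _) => a a0; field; rewrite ?a0 ?v_neq0.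
Qed.

Lemma eop_symvec g h : psym g -> eop h (symvec g) =
  symvec (fun w => v ^+ count_mem h.+1 w * v ^- count_mem h w * v * qnum (count_mem h w)
      * g (h.+1 :: rem h w)).
Proof.
move=> pg; apply/funext => w; rewrite /symvec.
elim: w g pg => [|j w IH] g pg.
  by rewrite (_ : eop h (symvec g) [::] = 0) //= qnum0 !(mul0r, mulr0).
rewrite eop_cons slice_symvec (IH _ (psym_cons j pg)) {IH} /= /twist.
have [->|jh] := eqVneq j h.
  rewrite !neqE add1n add0n qnumS' exprS.
  have eg : count_gt h w = (count_mem h.+1 w + count_gt h.+1 w)%N.
    by rewrite /count_gt; elim: w => //= i w ->; lia.
  rewrite /symvec /= eg exprD.
  have := expf_neq0 (count_mem h.+1 w) v_neq0.
  have := expf_neq0 (count_gt h.+1 w) v_neq0.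
  have := expf_neq0 (count_mem h w) v_neq0.
  have [hw|hw] := boolP (h \in w); last first.
    rewrite (count_memPn hw) qnum0 !(mulr0, mul0r) !addr0 expr0 mulr1 => _.
    move: (v ^+ count_mem _ _) (v ^+ count_gt _ _) => a b b0 a0.
    by field; rewrite a0 b0 v_neq0.
  rewrite (pg (h :: h.+1 :: rem h w) (h.+1 :: w)); last first.
    by apply: perm_trans (perm_swap _ _ _) _; rewrite perm_cons perm_sym perm_to_rem.
  rewrite (_ : count_gt h (h.+1 :: rem _ _) = (count_gt h w).+1); last first.
    by rewrite (count_gt_rem _ hw) /count_gt /= ltnSn ltnn; lia.
  rewrite eg exprS exprD.
  move: (v ^+ count_mem h w) (v ^+ count_gt _ _) (v ^+ count_mem _ _) => a b c a0 b0 c0.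
  by field; rewrite a0 b0 c0 v_neq0.
rewrite add0r add0n; have [hw|hw] := boolP (h \in w); last first.
  by rewrite (count_memPn hw) qnum0 !(mulr0, mul0r).
rewrite (pg (j :: h.+1 :: _) (h.+1 :: j :: rem h w)); last first.
  exact: perm_swap.
have gj := count_gt_rem j hw; rewrite count_gt_cons.
have := expf_neq0 (count_gt j (rem h w)) v_neq0; rewrite gj !exprD.
have := expf_neq0 (count_mem h w) v_neq0.
have [->|jh1] := eqVneq j h.+1.
  rewrite ltnn (_ : (h.+1 < h)%N = false) ?expr0 ?expr1; last lia.
  move: (v ^+ _) (v ^+ _) (v ^+ _) => a b c a0 b0.
  by field; rewrite a0 b0.
rewrite (_ : (j < h.+1)%N = (j < h)%N) ?expr0; last by lia.
case: (j < h)%N; rewrite ?expr0 ?expr1.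
  by move: (v ^+ _) (v ^+ _) (v ^+ _) => a b c a0 b0; field; rewrite ?a0 ?b0 ?v_neq0.
by move: (v ^+ _) (v ^+ _) (v ^+ _) => a b c a0 b0; field; rewrite ?a0 ?b0 ?v_neq0.
Qed.

Variables (n l : nat).
Hypothesis l_gt1 : (1 < l)%N.
Hypothesis qnum_l : forall a, (qnum a == 0) = (l %| a)%N.

Definition floor_sum w := (\sum_(i < n) count_mem (i : nat) w %/ l)%N.

Lemma floor_sum_perm w w' : perm_eq w w' -> floor_sum w = floor_sum w'.
Proof. by move=> ww; apply: eq_bigr => i _; rewrite (permP ww). Qed.

Lemma count_swap a b i w : a \in w ->
  (count_mem i (b :: rem a w) + (a == i) = count_mem i w + (b == i))%N.
Proof. by move=> aw; rewrite [in RHS](permP (perm_to_rem aw)) /=; lia. Qed.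

Lemma divn_pred c : ~~ (l %| c)%N -> (c %/ l <= c.-1 %/ l)%N.
Proof.
move=> lc; rewrite leq_divRL; last lia.
have := leq_trunc_div c l; rewrite leq_eqVlt => /orP[/eqP e|]; last lia.
by rewrite -e dvdn_mull in lc.
Qed.

(** Here w is the outcome and [b :: rem a w] the source of an operator replacing b by a; the
    condition on l is what a nonzero coefficient at w provides. *)
Lemma floor_sum_swap_i a b i w : a \in w -> ~~ (l %| count_mem a w)%N ->
  (count_mem i w %/ l <= count_mem i (b :: rem a w) %/ l)%N.
Proof.
move=> aw la; have c := count_swap b i aw; have [e|ia] := eqVneq i a.
  rewrite e in c *; apply: leq_trans (divn_pred la) (leq_div2r _ _).
  by move: c; rewrite eqxx; case: (b == a); lia.
by apply: leq_div2r; move: c; rewrite (eq_sym a) (negPf ia); lia.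
Qed.

Lemma floor_sum_swap a b w : a \in w -> ~~ (l %| count_mem a w)%N ->
  (floor_sum w <= floor_sum (b :: rem a w))%N.
Proof. by move=> aw la; apply: leq_sum => i _; apply: floor_sum_swap_i. Qed.

(* E_h and F_h increase some multiplicity by one, with a coefficient divisible by
   the quantum integer of its new value; when this coefficient is nonzero, that
   value is not a multiple of l, so the sum of the floors does not increase. *)
Definition low r s x := exists g, [/\ psym g,
  forall w, g w != 0 -> [/\ size w = r, all (ltn^~ n) w & (floor_sum w < s)%N] & x = symvec g].

Lemma low_lin r s (c : k) x y : low r s x -> low r s y -> low r s (c *: x + y).
Proof.
move=> [g [pg gs ->]] [g' [pg' gs' ->]]; exists (fun w => c * g w + g' w); split.
- by move=> w w' ww; rewrite (pg _ _ ww) (pg' _ _ ww).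
- move=> w; have [->|/gs //] := eqVneq (g w) 0.
  by rewrite mulr0 add0r => /gs'.
- by apply/funext => w; rewrite addME sclME /symvec; ring.
Qed.

Lemma low_0 r s : low r s 0.
Proof.
exists (fun=> 0); split => // [w|]; first by rewrite eqxx.
by apply/funext => w; rewrite /symvec mul0r.
Qed.

Lemma low_mul r s (f : seq nat -> k) x :
  psym f -> low r s x -> low r s (fun w => f w * x w).
Proof.
move=> pf [g [pg gs ->]]; exists (fun w => f w * g w); split.
- by move=> w w' ww; rewrite (pg _ _ ww) (pf _ _ ww).
- by move=> w; rewrite mulf_eq0 negb_or => /andP[_ /gs].
- by apply/funext => w; rewrite /symvec mulrA.
Qed.

Lemma psym_count (f : nat -> k) j : psym (fun w => f (count_mem j w)).
Proof. by move=> w w' ww; rewrite (permP ww). Qed.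

Lemma low_kop r s j x : low r s x -> low r s (kop j x).
Proof. exact/low_mul/(psym_count (fun c => v ^+ c)). Qed.
Lemma low_kop' r s j x : low r s x -> low r s (kop' j x).
Proof. exact/low_mul/(psym_count (fun c => v ^- c)). Qed.

(** Common treatment of E_h and F_h: f is their coefficient on q-symmetric tensors, and its
    vanishing where l divides the new multiplicity of a keeps the level from rising. *)
Lemma low_swap r s a b (f : seq nat -> k) x g : (a < n)%N ->
  psym g -> (forall w, g w != 0 -> [/\ size w = r, all (ltn^~ n) w & (floor_sum w < s)%N]) ->
  psym f -> (forall w, f w != 0 -> ~~ (l %| count_mem a w)%N) ->
  x = symvec (fun w => f w * g (b :: rem a w)) -> low r s x.
Proof.
move=> an pg gs pf f0 ->; eexists; split; last by [].
- move=> w w' ww; rewrite (pf _ _ ww); congr (_ * _); apply: pg.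
  by rewrite perm_cons; apply: perm_rem.
- move=> w; rewrite mulf_eq0 negb_or => /andP[/f0 la /gs[sw aw fw]].
  have aiw : a \in w by apply: contraT => /count_memPn e; rewrite e dvdn0 in la.
  split.
  + by move: sw; rewrite /= size_rem // prednK //; case: (w) aiw.
  + rewrite (perm_all _ (perm_to_rem aiw)) /= an.
    by move: aw => /= /andP[].
  + exact: leq_ltn_trans (floor_sum_swap _ aiw la) fw.
Qed.

Lemma low_fop r s h x : (h.+1 < n)%N -> low r s x -> low r s (fop h x).
Proof.
move=> hn [g [pg gs ->]].
apply: (low_swap (f := fun w => qnum (count_mem h.+1 w)) hn pg gs); last exact: fop_symvec.
  exact: psym_count.
by move=> w; rewrite qnum_l.
Qed.

Lemma low_eop r s h x : (h.+1 < n)%N -> low r s x -> low r s (eop h x).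
Proof.
move=> hn [g [pg gs ->]].
apply: (low_swap (f := fun w => v ^+ count_mem h.+1 w * v ^- count_mem h w * v
   * qnum (count_mem h w)) (ltnW hn) pg gs); last exact: eop_symvec.
  by move=> w w' ww; rewrite !(permP ww).
by move=> w; apply: contraNN; rewrite -qnum_l => /eqP ->; rewrite mulr0.
Qed.

Lemma nonsplit r : (1 < n)%N -> (l <= r)%N ->
  (2 < n)%N || ~~ (l %| (r - l).+1)%N ->
  exists s x wa, [/\ supp n r x, low r s (fop 0%N x), fop 0%N x wa != 0 &
    forall y, low r s y -> fop 0%N y wa = 0].
Proof.
(* The content has l letters 0, so that F_0 makes its floor drop. The other r - l letters are 2 if n
   > 2, and then the multiplicity of 1 created by F_0 is 1; if n = 2 they must be 1, and the new
   multiplicity is r - l + 1, whence the divisibility hypothesis. *)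
move=> n1 lr hn; pose c := if (2 < n)%N then 2%N else 1%N.
have cn : (c < n)%N by rewrite /c; case: ifP.
pose w1 := nseq l.-1 0%N ++ nseq (r - l) c.
pose wb := 0%N :: w1.
have c1 : ~~ (l %| (count_mem 1%N wb).+1)%N.
  rewrite /wb /= add0n count_cat !count_nseq /= mul0n add0n /c.
  by case: ifP hn => _ /=; rewrite ?mul0n ?mul1n // dvdn1; lia.
have c0 : count_mem 0%N wb = l.
  rewrite /wb /= count_cat !count_nseq /= mul1n (_ : (c == 0%N) = false) ?mul0n; first lia.
  by rewrite /c; case: ifP.
have wbn : all (ltn^~ n) wb.
  by rewrite /= all_cat !all_nseq /= cn (ltnW n1) !orbT.
have wbr : size wb = r by rewrite /= size_cat !size_nseq; lia.
pose g w : k := (perm_eq w wb)%:R.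
have pg : psym g by move=> w w' /permPl ww; rewrite /g ww.
have gE w : g w != 0 -> perm_eq w wb by rewrite /g; case: perm_eq; rewrite ?eqxx.
exists (floor_sum wb), (symvec g), (1%N :: w1); split.
- move=> w; rewrite /symvec mulf_eq0 negb_or => /andP[/gE ww _].
  by rewrite (perm_size ww) (perm_all _ ww).
- rewrite fop_symvec //; eexists; split; last by [].
    move=> w w' ww; rewrite (permP ww); congr (_ * _); apply: pg.
    by rewrite perm_cons; apply: perm_rem.
  move=> w; rewrite mulf_eq0 negb_or qnum_l => /andP[la /gE ww].
  have aw : 1%N \in w by apply: contraT => /count_memPn e; rewrite e dvdn0 in la.
  split.
  + by rewrite -wbr -(perm_size ww) /= size_rem // prednK //; case: (w) aw.
  + rewrite (perm_all _ (perm_to_rem aw)) /= n1.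
    by move: wbn; rewrite -(perm_all _ ww) /= => /andP[].
  (* The summand of the letter 0 drops from l %/ l = 1 to (l - 1) %/ l = 0, and no other summand
     grows. *)
  + rewrite -(floor_sum_perm ww) /floor_sum (bigD1 (Ordinal (ltnW n1))) //=.
    rewrite [X in (_ < X)%N](bigD1 (Ordinal (ltnW n1))) //= -addSn.
    apply: leq_add; last by apply: leq_sum => i _; apply: floor_sum_swap_i.
    have := count_swap 0%N 0%N aw; rewrite /= => e.
    have := permP ww (pred1 0%N); rewrite c0 /= => e'.
    rewrite e' divnn; move: e; rewrite addn0 e' addn1 => e.
    by rewrite divn_small; lia.
- rewrite fop_symvec // /symvec mulf_eq0 negb_or invwt_neq0 andbT mulf_neq0 //.
    rewrite qnum_l; move: c1; rewrite /wb /= add0n add1n.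
    by [].
  by rewrite /g /= perm_refl oner_neq0.
(* The value of F_0 y at wa is a multiple of the coefficient of y at the content wb, which has level
   exactly s and so is absent from y. *)
- move=> y [g' [pg' gs' ->]]; rewrite fop_symvec // /symvec /=.
  have [->|/gs'[_ _]] := eqVneq (g' wb) 0; first by rewrite mulr0 mul0r.
  by rewrite ltnn.
Qed.

(* Left multiplication by the quantum determinant. *)
Definition qwedge x : M := v *: tens 0%N (tens 1%N x) - tens 1%N (tens 0%N x).

Lemma qwedge_lin (c : k) x y : qwedge (c *: x + y) = c *: qwedge x + qwedge y.
Proof.
rewrite /qwedge !(tensD, tensZ); apply/funext => w.
by rewrite !(addME, sclME, oppME); ring.
Qed.

Lemma qwedgeZ (c : k) x : qwedge (c *: x) = c *: qwedge x.
Proof.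
by apply/funext => w; rewrite /qwedge !tensZ !(addME, sclME, oppME); ring.
Qed.

Lemma qwedgeE x w : qwedge x [:: 0%N, 1%N & w] = v * x w.
Proof. by rewrite /qwedge !(addME, sclME, oppME) /= subr0. Qed.

(** E_0 and F_0 both kill v e_0 (x) e_1 - e_1 (x) e_0, and the twist acts on it by v^-1 v = 1, so
    they pass to the remaining factors. *)
Lemma qwedge_eop x : eop 0%N (qwedge x) = qwedge (eop 0%N x).
Proof.
rewrite /qwedge eopB eopZ !eop_tens /= /twist /=.
rewrite !(tensZ, tensD) !linear0 ?addr0 ?add0r.
by apply/funext => w; rewrite !(addME, sclME, oppME); field.
Qed.

Lemma qwedge_fop x : fop 0%N (qwedge x) = qwedge (fop 0%N x).
Proof.
rewrite /qwedge fopB fopZ !fop_tens /= /twist /=.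
rewrite !(tensZ, tensD) !linear0 ?addr0 ?add0r.
by apply/funext => w; rewrite !(addME, sclME, oppME); field.
Qed.

Lemma qwedge_kop j x : (j < 2)%N -> kop j (qwedge x) = v *: qwedge (kop j x).
Proof.
move=> j2; apply/funext => -[|a [|b w]];
  rewrite kopE /qwedge !(addME, sclME, oppME) /= ?kopE; try by repeat case: eqP => _ /=; ring.
by case: j j2 => [|[|]] //= _; case: a => [|[|a]]; case: b => [|[|b]] //=;
  rewrite ?add1n ?add0n ?exprS; ring.
Qed.

Lemma qwedge_kop' j x : (j < 2)%N -> kop' j (qwedge x) = v^-1 *: qwedge (kop' j x).
Proof.
move=> j2; apply/funext => -[|a [|b w]];
  rewrite kop'E /qwedge !(addME, sclME, oppME) /= ?kop'E; try by repeat case: eqP => _ /=; ring.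
case: j j2 => [|[|]] //= _; case: a => [|[|a]]; case: b => [|[|b]] //=;
  rewrite ?add1n ?add0n ?exprS; set c := v ^+ _;
  have c0 : c != 0 := expf_neq0 _ v_neq0; field; by rewrite ?c0 ?v_neq0.
Qed.

End DividedPowers.

(** * The relations at v^2 = -1 in odd degree *)

Section Clifford.
Variables (k : fieldType) (v : k).
Local Notation M := (seq nat -> k^o).
Implicit Types (x : M) (w : seq nat).
Local Notation eop := (eop v).
Local Notation fop := (fop v).
Hypothesis v_neq0 : v != 0.
Hypothesis v2 : v ^+ 2 != 1.
Hypothesis vN1 : v ^+ 2 = -1.

(** No position can be moved twice. Two distinct positions are moved in both orders, and the two
    twists add up to v + v^-1 = 0. *)
Lemma hop_hop0 h x a b : a != b -> (a == h) && (b == h.+1) || (a == h.+1) && (b == h) ->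
  hop v h a b (hop v h a b x) = 0.
Proof.
move=> ab hab; apply/funext => w; rewrite zeroME; elim: w x => // j w IH x.
rewrite [LHS]/= slice_hop linearD linearZ /= !(addME, sclME) IH mulr0 addr0.
have [->|ja] := eqVneq j a; last by rewrite linear0 mulr0 add0r.
rewrite eq_sym (negPf ab) add0r -/(hop v h a b (slice x b) w) -mulrDl.
suff -> : twist v h b + twist v h a = 0 by rewrite mul0r.
have vv : v^-1 + v = 0.
  by apply: (mulfI v_neq0); rewrite mulr0 mulrDr mulfV // -expr2 vN1 subrr.
by case/orP: hab => /andP[/eqP -> /eqP ->]; rewrite /twist !neqE // addrC.
Qed.

Lemma eop_eop0 h x : eop h (eop h x) = 0.
Proof. by apply: hop_hop0; rewrite ?neqE. Qed.
Lemma fop_fop0 h x : fop h (fop h x) = 0.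
Proof. by apply: hop_hop0; rewrite ?neqE ?orbT. Qed.

(** An odd power of v^2 is -1, so numerator and denominator of [phi] both equal 2, which is nonzero
    because -1 = v^2 differs from 1. *)
Lemma phi_odd (a b : nat) : odd (a + b) -> phi v (a%:Z - b%:Z) = 1.
Proof.
move=> oab; rewrite /phi.
have -> : v ^ (- ((a%:Z - b%:Z) * 2%:Z)) = -1.
  rewrite mulrC -mulrN -exprz_exp (_ : v ^ 2%:Z = -1) //.
  rewrite opprB expfzDr ?oppr_eq0 ?oner_eq0 //.
  rewrite -[_ ^ b%:Z]/((-1) ^+ b) -exprnN -[X in _ * X]exprVn invrN invr1 -exprD.
  by rewrite addnC -signr_odd oab expr1.
rewrite vN1 invrN invr1 divff // opprK.
by move: v2; rewrite vN1 eq_sym -subr_eq0 opprK.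
Qed.

Lemma clifford r x : odd r -> supp 2 r x -> eop 0%N (fop 0%N x) = x - fop 0%N (eop 0%N x).
Proof.
move=> ro sx; apply/funext => w; rewrite (eop_fop_w v_neq0 v2) addME oppME.
have [->|/sx[sw aw]] := eqVneq (x w) 0.
  by rewrite mulr0 addr0 vN1 mulN1r add0r.
rewrite phi_odd ?mul1r ?vN1 ?mulN1r 1?addrC //.
rewrite (_ : (_ + _)%N = r) // -sw; elim: w aw {sw} => //= j w IH /andP[j2 /IH <-].
by case: j j2 => [|[|]] //= _; lia.
Qed.

End Clifford.

(** * Semisimplicity criteria *)

Section Criterion.
Variables (A : pzRingType) (S : set A).
Hypotheses (S1 : S 1) (SN1 : S (-1)) (SD : forall x y, S x -> S y -> S (x + y))
  (SM : forall x y, S x -> S y -> S (x * y)).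

(** The element u may lie outside S: simple modules S u and submodules are taken in the ambient ring
    A, where columns of matrices are available as generators. *)
Inductive simple_sum : A -> Prop :=
  | simple_sum0 : simple_sum 0
  | simple_sumD x y : simple_sum x -> simple_sum y -> simple_sum (x + y)
  | simple_sumM s u : S s ->
      (forall t, S t -> t * u != 0 -> exists2 t', S t' & t' * (t * u) = u) ->
      simple_sum (s * u).

Definition submod (I : set A) := [/\ I 0, forall x y, I x -> I y -> I (x + y)
  & forall a x, S a -> I x -> I (a * x)].

Lemma submodN I x : submod I -> I x -> I (- x).
Proof. by case=> _ _ IM Ix; rewrite -mulN1r; apply: IM. Qed.

(* Each simple summand either meets I + J, hence lies in it, or can be added to J. *)
Lemma complement_extend I J x : submod I -> submod J ->
  (forall y, I y -> J y -> y = 0) -> simple_sum x ->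
  exists J', [/\ submod J', (J `<=` J')%classic, forall y, I y -> J' y -> y = 0
    & exists y z, [/\ I y, J' z & x = y + z]].
Proof.
move=> mI + + sx; elim: sx J => {x} [|x y _ IHx _ IHy|s u Ss su] J mJ IJ.
- exists J; split => //; exists 0, 0; rewrite addr0.
  by case: mI mJ => ? _ _ [? _ _].
- have [J1 [mJ1 JJ1 IJ1 [x1 [x2 [Ix1 Jx2 ->]]]]] := IHx J mJ IJ.
  have [J2 [mJ2 JJ2 IJ2 [y1 [y2 [Iy1 Jy2 ->]]]]] := IHy J1 mJ1 IJ1.
  exists J2; split => //; first exact: subset_trans JJ1 JJ2.
  exists (x1 + y1), (x2 + y2); rewrite addrACA; split => //.
    by case: mI => _ + _; apply.
  by case: mJ2 => _ + _; apply => //; apply: JJ2.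
have [[I0 ID IM] [J0 JD JM]] := (mI, mJ).
have [[t [St tu0 [y [z [Iy Jz e]]]]]|nt] :=
  pselect (exists t, [/\ S t, t * u != 0 & exists y z, [/\ I y, J z & t * u = y + z]]).
  have [t' St' tu] := su t St tu0.
  exists J; split => //; exists (s * (t' * y)), (s * (t' * z)); split; try by auto.
  by rewrite -!mulrDr -e tu.
exists [set w | exists z t, [/\ J z, S t & w = z + t * u]]%classic; split.
- split.
  + by exists 0, 0; rewrite mul0r addr0; split => //; rewrite -(addNr 1); apply: SD.
  + move=> _ _ [z [t [Jz St ->]]] [z' [t' [Jz' St' ->]]].
    by exists (z + z'), (t + t'); rewrite mulrDl addrACA; split; auto.
  + move=> a _ Sa [z [t [Jz St ->]]].
    by exists (a * z), (a * t); rewrite mulrDr mulrA; split; auto.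
- move=> z Jz; exists z, 0; rewrite mul0r addr0; split => //.
  by rewrite -(addNr 1); apply: SD.
- move=> y Iy [z [t [Jz St e]]].
  have [tu|tu] := eqVneq (t * u) 0.
    by apply: IJ => //; rewrite e tu addr0.
  case: nt; exists t; split => //; exists y, (- z); split => //.
    exact: submodN.
  by rewrite e addrAC subrr add0r.
- exists 0, (s * u); rewrite add0r; split => //.
  by exists 0, s; rewrite add0r.
Qed.

(** Only 1 needs to be split: 1 = y + z gives x = x y + x z. The complement is built in A and then
    cut down to S; x z is in S because x and x y are. *)
Lemma semisimple_simple_sum : simple_sum 1 -> semisimple S.
Proof.
move=> s1 I [IS I0 ID IM].
have mI : submod I by [].
have m0 : submod [set 0]%classic.
  by split=> // [_ _ -> ->|a _ _ ->] /=; rewrite ?addr0 ?mulr0.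
have [|J [[J0 JD JM] _ IJ [y [z [Iy Jz e]]]]] := complement_extend mI m0 _ s1.
  by move=> y _.
exists (J `&` S)%classic; split.
- split=> [x []//||x t [Jx Sx] [Jt St]|a x Sa [Jx Sx]].
  + by split => //; apply: IS.
  + by split; auto.
  + by split; auto.
- apply/seteqP; split=> [x [Ix [Jx _]]|x -> /=]; first exact: IJ.
  by split => //; split => //; apply: IS.
- move=> x Sx; exists (x * y), (x * z); split; first exact: IM.
    split; first exact: JM.
    have -> : x * z = x + (-1) * (x * y).
      by rewrite mulN1r -{2}[x]mulr1 e mulrDr addrAC subrr add0r.
    by apply: SD => //; apply: SM => //; apply: SM => //; apply: IS.
  by rewrite -mulrDr -e mulr1.
Qed.

End Criterion.

(** * Semisimplicity of a matrix algebra through column vectors *)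

Section MatrixCriterion.
Variables (k : fieldType) (N : nat) (S : set 'M[k]_N).
Hypotheses (S1 : S 1) (SZ : forall c x, S x -> S (c *: x))
  (SD : forall x y, S x -> S y -> S (x + y)) (SM : forall x y, S x -> S y -> S (x * y)).

Let SN1 : S (-1).
Proof. by rewrite -scaleN1r; apply: SZ. Qed.

Definition simple_vec (u : 'cV[k]_N) := forall t, S t -> t *m u != 0 ->
  exists2 t', S t' & t' *m (t *m u) = u.

Inductive simple_span : 'cV[k]_N -> Prop :=
  | simple_span0 : simple_span 0
  | simple_spanD x y : simple_span x -> simple_span y -> simple_span (x + y)
  | simple_spanM s u : S s -> simple_vec u -> simple_span (s *m u).

Lemma simple_spanS s x : S s -> simple_span x -> simple_span (s *m x).
Proof.
move=> Ss; elim=> [|y z _ Sy _ Sz|t u St su].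
- by rewrite mulmx0; apply: simple_span0.
- by rewrite mulmxDr; apply: simple_spanD.
- by rewrite mulmxA; apply: simple_spanM => //; apply: SM.
Qed.

(** Right multiplication by a row is an S-linear map from columns to matrices, so it sends a sum of
    simple submodules to a sum of simple submodules; the identity matrix is a sum of columns times
    rows. *)
Lemma semisimple_span : (forall x, simple_span x) -> semisimple S.
Proof.
move=> H; apply: semisimple_simple_sum => //.
have aux x (p : 'rV[k]_N) : simple_span x -> simple_sum S (x *m p).
  elim=> [|y z _ Sy _ Sz|t u St su].
  - by rewrite mul0mx; apply: simple_sum0.
  - by rewrite mulmxDl; apply: simple_sumD.
  - rewrite -mulmxA; apply: simple_sumM => // t' St' t'u.
    have [|t'' St'' e] := su t' St'.
      by apply: contraNneq t'u => e; rewrite -mulmxE mulmxA e mul0mx.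
    by exists t'' => //; rewrite -!mulmxE !mulmxA -(mulmxA t'') e.
have -> : 1 = \sum_i (col i (1%:M : 'M[k]_N)) *m (delta_mx 0 i : 'rV[k]_N).
  apply/matrixP => a b; rewrite summxE (bigD1 b) //= big1 => [|i ib].
    by rewrite addr0 [RHS]mxE big_ord1 !mxE !eqxx mulr1.
  by rewrite mxE big_ord1 !mxE eqxx (eq_sym b) (negPf ib) /= mulr0.
elim/big_ind: _ => [|x y|i _]; [exact: simple_sum0|exact: simple_sumD|].
exact: aux.
Qed.

(* If 1 = y + z is the decomposition along I = [set s | L (s *m m)] and a
   complement J, then x0 z lies in I and J, so x0 = x0 y; but y m is in L, which x0
   cannot send to x0 m. *)
Lemma not_semisimple (L : 'cV[k]_N -> Prop) (m : 'cV[k]_N) (x0 : 'M[k]_N) (j : 'I_N) :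
  L 0 -> (forall x y, L x -> L y -> L (x + y)) -> (forall s x, S s -> L x -> L (s *m x)) ->
  S x0 -> L (x0 *m m) -> (x0 *m m) j 0 != 0 ->
  (forall y, L y -> (x0 *m y) j 0 = 0) -> ~ semisimple S.
Proof.
move=> L0 LD LS Sx0 Lx0 nz0 z0 ss.
pose I : set 'M[k]_N := [set s | S s /\ L (s *m m)]%classic.
have [|J [[_ _ JD JM] IJ dec]] := ss I.
  split=> [s []//||s t [Ss Ls] [St Lt]|a s Sa [Ss Ls]].
  - by split; [rewrite -(addNr 1); apply: SD|rewrite mul0mx].
  - by split; [apply: SD|rewrite mulmxDl; apply: LD].
  - by split; [apply: SM|rewrite -mulmxE -mulmxA; apply: LS].
have [y [z [[Sy Ly] Jz e]]] := dec 1 S1.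
have xz : x0 * z = 0.
  suff : [set 0]%classic (x0 * z) by [].
  rewrite -IJ; split; last exact: JM.
  have -> : x0 * z = x0 + (-1) * (x0 * y).
    by rewrite mulN1r -{2}[x0]mulr1 e mulrDr addrAC subrr add0r.
  split; first by auto.
  rewrite mulmxDl; apply: LD => //; rewrite -!mulmxE -!mulmxA.
  by apply: (LS) => //; apply: (LS).
have xy : x0 = x0 *m y by rewrite mulmxE -[LHS]mulr1 e mulrDr xz addr0.
by move: nz0; rewrite xy -mulmxA z0 ?eqxx.
Qed.

End MatrixCriterion.

(** * Semisimplicity of an algebra acting on words through E, F and K *)

Section WordModel.
Variables (k : fieldType) (v : k) (n r : nat).
Local Notation M := (seq nat -> k^o).
Implicit Types (x y : M) (w : seq nat).
Local Notation N := (words n r).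
Hypothesis v_neq0 : v != 0.
Hypothesis v2 : v ^+ 2 != 1.
Hypothesis n_gt1 : (1 < n)%N.

Definition letters (a : 'I_N) : seq nat := [seq val i | i <- (enum_val a : r.-tuple 'I_n)].
(* The rescaling by [invwt] turns the matrices of the q-Schur algebra into the
   operators above, see [rootop_invwt]. *)
Definition vec x : 'cV[k]_N := \col_a (invwt v (letters a) * x (letters a)).

Lemma letters_supp a : size (letters a) = r /\ all (ltn^~ n) (letters a).
Proof.
rewrite size_map size_tuple; split => //.
by rewrite all_map; apply/allP => i _ /=.
Qed.

Lemma letters_surj w : size w = r -> all (ltn^~ n) w -> exists a, letters a = w.
Proof.
move=> sw aw.
have st : size (pmap (insub : nat -> option 'I_n) w) == r.
  by rewrite size_pmap_sub -sw -(all_count (ltn^~ n)).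
exists (enum_rank (Tuple st)); rewrite /letters enum_rankK /=.
elim: (w) aw => //= j w' IH /andP[jn /IH].
by rewrite insubT /= => ->.
Qed.

Lemma vec_lin (c : k) x y : vec (c *: x + y) = c *: vec x + vec y.
Proof. by apply/matrixP => a b; rewrite !mxE addME sclME; ring. Qed.
Lemma vec0 : vec 0 = 0.
Proof. by apply/matrixP => a b; rewrite !mxE zeroME mulr0. Qed.
Lemma vecD x y : vec (x + y) = vec x + vec y.
Proof. by rewrite -[x]scale1r vec_lin !scale1r. Qed.
Lemma vecZ (c : k) x : vec (c *: x) = c *: vec x.
Proof. by rewrite -[_ *: x]addr0 vec_lin vec0 addr0. Qed.

Definition word_delta w : M := fun w' => (w' == w)%:R.

Lemma word_delta_supp a : supp n r (word_delta (letters a)).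
Proof.
move=> w; rewrite /word_delta; have [->|] := eqVneq w (letters a); rewrite ?eqxx // => _.
exact: letters_supp.
Qed.

Lemma word_delta_wt w : wt (fun j => (count_mem j w)%:Z) (word_delta w).
Proof. by move=> w'; rewrite /word_delta; have [->|] := eqVneq w' w; rewrite ?eqxx. Qed.

Lemma vec_expand (c : 'cV[k]_N) :
  c = \sum_a (c a 0 / invwt v (letters a)) *: vec (word_delta (letters a)).
Proof.
apply/colP => a; rewrite summxE (bigD1 a) //= big1 => [|b ba].
  by rewrite addr0 !mxE /word_delta eqxx mulr1 mulfVK // invwt_neq0.
rewrite !mxE /word_delta (_ : (letters a == letters b) = false) ?mulr0 //.
apply: contra_neqF ba => /eqP /inj_map e.
by apply: enum_val_inj; apply/val_inj/esym/e/val_inj.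
Qed.

Lemma vec_surj (c : 'cV[k]_N) : exists2 x, supp n r x & vec x = c.
Proof.
exists (\sum_a (c a 0 / invwt v (letters a)) *: word_delta (letters a)).
  by apply: supp_sum => a _; apply/suppZ/word_delta_supp.
rewrite [RHS]vec_expand; elim/big_ind2: _ => [|x a y b <- <-|a _].
- exact: vec0.
- exact: vecD.
- exact: vecZ.
Qed.

Variable S : set 'M[k]_N.
Hypotheses (S1 : S 1) (SZ : forall c s, S s -> S (c *: s))
  (SD : forall s t, S s -> S t -> S (s + t)) (SM : forall s t, S s -> S t -> S (s * t)).
Hypothesis S_eop : forall h, (h.+1 < n)%N ->
  exists2 s, S s & forall x, s *m vec x = vec (eop v h x).
Hypothesis S_fop : forall h, (h.+1 < n)%N ->
  exists2 s, S s & forall x, s *m vec x = vec (fop v h x).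
(** Generation of S by E, F and K enters only through the subspaces it stabilizes. P may involve
    words of any length, since [vec] reads those of length r. *)
Hypothesis S_ind : forall P : M -> Prop,
  P 0 -> (forall (c : k) x y, P x -> P y -> P (c *: x + y)) ->
  (forall h x, (h.+1 < n)%N -> P x -> P (eop v h x)) ->
  (forall h x, (h.+1 < n)%N -> P x -> P (fop v h x)) ->
  (forall j x, (j < n)%N -> P x -> P (kop v j x)) ->
  (forall j x, (j < n)%N -> P x -> P (kop' v j x)) ->
  forall s x, S s -> P x -> exists2 y, P y & s *m vec x = vec y.

Lemma S_eword W : word n W -> exists2 s, S s & forall x, s *m vec x = vec (eword v W x).
Proof.
elim: W => [|h W IH] /=; first by exists 1 => // x; rewrite mul1mx.
case/andP=> hn /IH[s Ss sE]; have [t St tE] := S_eop hn.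
by exists (s *m t); [apply: SM|move=> x; rewrite -mulmxA tE sE].
Qed.

Lemma semisimple_small l :
  (forall b : nat, (0 < b < l)%N -> phi v b%:Z != 0) -> (r < l)%N -> semisimple S.
Proof.
move=> phin rl; apply: semisimple_span => // c.
have D x : supp n r x -> singF v n r x by apply: singF_full phin _ rl x.
have [x sx <-] := vec_surj c.
elim: (singF_Fsing D sx) => {x sx c} [lam u wu _ su hu|h y hn _ Sy|x y _ Sx _ Sy].
- rewrite -[vec u]mul1mx; apply: simple_spanM => // t St tu.
  have [y Fy e] : exists2 y, cyclicF v n u y & t *m vec u = vec y.
    apply: S_ind St (cyclicF_word v u (W := [::]) isT) => [|c' x y Fx Fy|h x|h x|j x _|j x _].
    + exact: cyclicF_0.
    + by apply/cyclicF_add/Fy/cyclicF_scale.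
    + exact: cyclicF_eop wu hu.
    + exact: cyclicF_fop.
    + exact: cyclicF_kop wu.
    + exact: cyclicF_kop' wu.
  rewrite e in tu *; have y0 : y != 0 by apply: contraNneq tu => ->; rewrite vec0.
  have [W [c [hW c0 We]]] := cyclicF_simple v_neq0 v2 D wu su hu Fy y0.
  have [s Ss sE] := S_eword hW.
  exists (c^-1 *: s); first exact: SZ.
  by rewrite -scalemxAl sE We vecZ scalerA mulVf // scale1r.
- by have [s Ss sE] := S_fop hn; rewrite -sE; apply: simple_spanS.
- by rewrite vecD; apply: simple_spanD.
Qed.

(** A nonzero a x + b F x is sent to b x by E when b is nonzero, and is a multiple of x otherwise;
    either way x is recovered. *)
Lemma simple_vec_pair (x : M) (E F : M -> M) :
  (exists2 s, S s & forall x, s *m vec x = vec (E x)) ->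
  (forall (c : k) x y, E (c *: x + y) = c *: E x + E y) ->
  (forall s, S s -> exists a b : k, s *m vec x = vec (a *: x + b *: F x)) ->
  E x = 0 -> E (F x) = x -> simple_vec S (vec x).
Proof.
move=> [s Ss sE] El Sx Ex EFx t St.
have E0 : E 0 = 0 by have := El (-1) 0 0; rewrite scaler0 addr0 scaleN1r addNr.
have EZ (c : k) y : E (c *: y) = c *: E y by rewrite -[_ *: y]addr0 El E0 !addr0.
have [a [b ->]] := Sx t St => nz.
have [b0|b0] := eqVneq b 0; last first.
  exists (b^-1 *: s); first exact: SZ.
  rewrite -scalemxAl sE El Ex scaler0 add0r EZ EFx vecZ scalerA mulVf //.
  by rewrite scale1r.
rewrite b0 scale0r addr0 in nz *.
have a0 : a != 0 by apply: contraNneq nz => ->; rewrite scale0r vec0.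
exists (a^-1 *: (1%:M : 'M[k]_N)); first exact: SZ.
by rewrite -scalemxAl mul1mx vecZ scalerA mulVf // scale1r.
Qed.

Lemma semisimple_odd : n = 2%N -> odd r -> v ^+ 2 = -1 -> semisimple S.
Proof.
move=> n2 ro vN1; apply: semisimple_span => // c.
have n01 : (1 < n)%N by rewrite n2.
have [s Ss sE] := S_eop n01; have [t St tE] := S_fop n01.
have cliff y : supp n r y -> eop v 0%N (fop v 0%N y) = y - fop v 0%N (eop v 0%N y).
  by rewrite n2; apply: clifford.
have e0 y : eop v 0%N (eop v 0%N y) = 0 by apply: eop_eop0.
have f0 y : fop v 0%N (fop v 0%N y) = 0 by apply: fop_fop0.
have ee y : supp n r y -> eop v 0%N (fop v 0%N (eop v 0%N y)) = eop v 0%N y.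
  by move=> sy; rewrite cliff ?e0 ?linear0 ?addr0 //; apply: supp_eop.
have fef y : supp n r y -> fop v 0%N (eop v 0%N (fop v 0%N y)) = fop v 0%N y.
  move=> sy; have := cliff _ (supp_fop (v := v) (h := 0%N) n01 sy); rewrite f0 linear0.
  by move/esym/eqP; rewrite subr_eq0 => /eqP.
(* Two weight vectors that E and F send to multiples of each other span a submodule, as the K's act
   on each by a scalar. *)
have pair lam mu x y (c1 c2 c3 c4 : k) : wt lam x -> wt mu y ->
    eop v 0%N x = c1 *: y -> fop v 0%N x = c2 *: y ->
    eop v 0%N y = c3 *: x -> fop v 0%N y = c4 *: x ->
    forall g, S g -> exists a b : k, g *m vec x = vec (a *: x + b *: y).
  move=> wx wy ex fx ey fy g Sg.
  have [z [a [b ->]] e] : exists2 z, (exists a b : k, z = a *: x + b *: y) &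
      g *m vec x = vec z; last by exists a, b.
  apply: S_ind Sg _.
  - by exists 0, 0; rewrite !scale0r addr0.
  - move=> d _ _ [a1 [b1 ->]] [a2 [b2 ->]]; exists (d * a1 + a2), (d * b1 + b2).
    by rewrite !scalerDl scalerDr !scalerA addrACA.
  - move=> h _ hn [a1 [b1 ->]]; have -> : h = 0%N by lia.
    exists (b1 * c3), (a1 * c1).
    by rewrite linearD /= !eopZ ex ey !scalerA addrC.
  - move=> h _ hn [a1 [b1 ->]]; have -> : h = 0%N by lia.
    exists (b1 * c4), (a1 * c2).
    by rewrite fopD !fopZ fx fy !scalerA addrC.
  - move=> j _ _ [a1 [b1 ->]]; have [d1 k1] := wt_kop v j wx.
    have [d2 k2] := wt_kop v j wy; exists (a1 * d1), (b1 * d2).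
    rewrite kop_lin k1 scalerA; congr (_ + _).
    by rewrite -[_ *: y]addr0 kop_lin k2 (_ : kop v j 0 = 0) ?addr0 ?scalerA //;
      apply/funext => w; rewrite /kop mulr0.
  - move=> j _ _ [a1 [b1 ->]]; have [d1 k1] := wt_kop' v j wx.
    have [d2 k2] := wt_kop' v j wy; exists (a1 * d1), (b1 * d2).
    rewrite kop'_lin k1 scalerA; congr (_ + _).
    by rewrite -[_ *: y]addr0 kop'_lin k2 (_ : kop' v j 0 = 0) ?addr0 ?scalerA //;
      apply/funext => w; rewrite /kop' mulr0.
  - by exists 1, 0; rewrite scale1r scale0r addr0.
rewrite (vec_expand c); elim/big_ind: _ => [|x y|a _]; [exact: simple_span0|exact: simple_spanD|].
rewrite -[vec _]mul1mx scalemxAl; apply: simple_spanS => //; first exact: SZ.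
pose y := word_delta (letters a); have sy : supp n r y := @word_delta_supp a.
have wy : wt _ y := @word_delta_wt (letters a).
have -> : vec y = t *m vec (eop v 0%N y) + s *m vec (fop v 0%N y).
  by rewrite sE tE -vecD cliff // addrC subrK.
have we := wt_eop (v := v) (h := 0%N) wy; have wf := wt_fop (v := v) (h := 0%N) wy.
apply: simple_spanD; apply: simple_spanM => //.
- apply: (simple_vec_pair (E := eop v 0%N) (F := fop v 0%N)) => //.
  + by exists s.
  + by move=> d x z; rewrite linearP.
  + apply: (pair _ _ _ _ 0 1 1 0) we (wt_fop (h := 0%N) we) _ _ _ _.
    * by rewrite scale0r.
    * by rewrite scale1r.
    * by rewrite scale1r ee.
    * by rewrite scale0r.
  + by rewrite ee.
- apply: (simple_vec_pair (E := fop v 0%N) (F := eop v 0%N)) => //.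
  + by exists t.
  + by move=> d x z; rewrite linearP.
  + apply: (pair _ _ _ _ 1 0 0 1) wf (wt_eop (h := 0%N) wf) _ _ _ _.
    * by rewrite scale1r.
    * by rewrite scale0r.
    * by rewrite scale0r.
    * by rewrite scale1r fef.
  + by rewrite fef.
Qed.

Lemma not_semisimple_big l : (1 < l)%N ->
  (forall a, (qnum v a == 0) = (l %| a)%N) -> (l <= r)%N ->
  ~ [/\ l = 2%N, n = 2%N & odd r] -> ~ semisimple S.
Proof.
move=> l1 qil lr nexc.
have n01 : (1 < n)%N by [].
have [s Ss sE] := S_fop n01.
have [hn|] := boolP ((2 < n)%N || ~~ (l %| (r - l).+1)%N).
  have [d [x [wa [sx lx nz z0]]]] := nonsplit v_neq0 v2 l1 qil n01 lr hn.
  have [swa awa] := supp_fop n01 sx nz; have [a wda] := letters_surj swa awa.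
  pose L c := exists2 y, low v n l r d y & vec y = c.
  apply: (@not_semisimple k N S S1 SZ SD SM L (vec x) s a) => //.
  - by exists 0; [apply: low_0|apply: vec0].
  - move=> _ _ [y ly <-] [z lz <-]; exists (y + z); last exact: vecD.
    by rewrite -[y]scale1r; apply: low_lin.
  - move=> t _ St [y ly <-].
    have [z lz ->] : exists2 z, low v n l r d z & t *m vec y = vec z; last by exists z.
    apply: S_ind St ly => [|c y1 y2|h y1|h y1|j y1 _|j y1 _].
    + exact: low_0.
    + exact: low_lin.
    + exact: low_eop.
    + exact: low_fop.
    + exact: low_kop.
    + exact: low_kop'.
  - by rewrite sE; exists (fop v 0%N x).
  - by rewrite sE mxE wda mulf_neq0 // invwt_neq0.
  - by move=> _ [y ly <-]; rewrite sE mxE wda z0 // mulr0.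
rewrite negb_or -leqNgt negbK => /andP[n2 lr1].
(* Now n = 2 and l divides r - l + 1. If l were 2, then r would be odd, the excluded case. As l > 2
   divides neither 1 nor 2, r is at least l + 2, and l cannot also divide (r - 2) - l + 1. *)
have {}n2 : n = 2%N by lia.
have l2 : (2 < l)%N.
  rewrite ltn_neqAle l1 andbT; apply/eqP => l2; apply: nexc; split => //.
  by move: lr1 lr; rewrite -l2 dvdn2 /= negbK => lr1 lr; move: lr1; rewrite oddB // addbF.
have lr2 : (l <= r - 2)%N.
  have := dvdn_leq (ltn0Sn _) lr1.
  have : (r != l)%N by apply: contraTneq lr1 => ->; rewrite subnn dvdn1; lia.
  have : (r != l.+1)%N by apply: contraTneq lr1 => ->; rewrite subSnn gtnNdvd //; lia.
  by lia.
have hn : (2 < n)%N || ~~ (l %| (r - 2 - l).+1)%N.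
  rewrite n2 /=; apply: contraL lr1 => lr3.
  have -> : ((r - l).+1 = (r - 2 - l).+1 + 2)%N by lia.
  by rewrite dvdn_addr // gtnNdvd.
have [d [x [wa [sx lx nz z0]]]] := nonsplit v_neq0 v2 l1 qil n01 lr2 hn.
have [swa awa] := supp_fop n01 sx nz.
(* The prefix 0, 1 selects the summand v e_0 (x) e_1 of the determinant, so the coefficient there is
   v times the one at wa ([qwedgeE]). *)
have [a wda] : exists a, letters a = [:: 0%N, 1%N & wa].
  by apply: letters_surj; [rewrite /= swa; lia|rewrite /= awa n01 ltnW].
pose L c := exists2 y, low v n l (r - 2) d y & vec (qwedge v y) = c.
have dt0 : qwedge v 0 = 0 by rewrite -{1}[0](addNr 0) -scaleN1r qwedge_lin scaleN1r addNr.
apply: (@not_semisimple k N S S1 SZ SD SM L (vec (qwedge v x)) s a) => //.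
- by exists 0; [apply: low_0|rewrite dt0 vec0].
- move=> _ _ [y ly <-] [z lz <-]; exists (y + z).
    by rewrite -[y]scale1r; apply: low_lin.
  by rewrite -[y]scale1r qwedge_lin !scale1r vecD.
- move=> t _ St [y ly <-].
  pose P x := exists2 y, low v n l (r - 2) d y & x = qwedge v y.
  have [_ [z lz ->] ->] : exists2 z, P z & t *m vec (qwedge v y) = vec z; last by exists z.
  apply: S_ind St _ => [|c _ _ [y1 l1' ->] [y2 l2' ->]|h _ hn' [y1 ly1 ->]|h _ hn' [y1 ly1 ->]|
     j _ jn [y1 ly1 ->]|j _ jn [y1 ly1 ->]|].
  + by exists 0; [apply: low_0|rewrite dt0].
  + by exists (c *: y1 + y2); [apply: low_lin|rewrite qwedge_lin].
  + have h0 : h = 0%N by lia.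
    by exists (eop v h y1); [apply: low_eop|rewrite h0 qwedge_eop].
  + have h0 : h = 0%N by lia.
    by exists (fop v h y1); [apply: low_fop|rewrite h0 qwedge_fop].
  + exists (v *: kop v j y1); last by rewrite qwedgeZ qwedge_kop // -n2.
    by rewrite -[_ *: _]addr0; apply: low_lin; [apply: low_kop|apply: low_0].
  + exists (v^-1 *: kop' v j y1); last by rewrite qwedgeZ qwedge_kop' // -n2.
    by rewrite -[_ *: _]addr0; apply: low_lin; [apply: low_kop'|apply: low_0].
  + by exists y.
- by rewrite sE; exists (fop v 0%N x); rewrite ?qwedge_fop.
- rewrite sE mxE wda qwedge_fop // qwedgeE; apply: mulf_neq0; first exact: invwt_neq0.
  exact: mulf_neq0.
- by move=> _ [y ly <-]; rewrite sE mxE wda qwedge_fop // qwedgeE z0 // !mulr0.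
Qed.

End WordModel.

(** * The dual of the quantum matrix coalgebra *)

Section Evaluation.
Variables (R : comPzRingType) (X : Type) (rel : term R X -> term R X -> Prop).
Variables (B : pzRingType) (scal : {rmorphism R -> B}) (g : X -> B).
Hypothesis scalC : forall a b, scal a * b = b * scal a.

Fixpoint teval (t : term R X) : B :=
  match t with
  | Gen x => g x
  | Cst a => scal a
  | Add s t => teval s + teval t
  | Mul s t => teval s * teval t
  end.

Hypothesis teval_rel : forall s t, rel s t -> teval s = teval t.

Lemma teval_cong s t : cong rel s t -> teval s = teval t.
Proof.
elim=> {s t} //=.
- by move=> t s u _ -> _ ->.
- by move=> s s' t t' _ -> _ ->.
- by move=> s s' t t' _ -> _ ->.
- by move=> s t u; rewrite addrA.
- by move=> s t; rewrite addrC.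
- by move=> t; rewrite rmorph0 add0r.
- by move=> s t u; rewrite mulrA.
- by move=> t; rewrite rmorph1 mul1r.
- by move=> t; rewrite rmorph0 mul0r.
- by move=> s t u; rewrite mulrDl.
- by move=> s t u; rewrite mulrDr.
- by move=> a b; rewrite rmorphD.
- by move=> a b; rewrite rmorphM.
Qed.

Definition peval (x : presented rel) : B := teval (repr x).

Lemma pevalE t : peval (pclass rel t) = teval t.
Proof. exact/teval_cong/cong_repr. Qed.

Lemma pevalD x y : peval (x + y) = peval x + peval y.
Proof.
elim/pclassW: x => s; elim/pclassW: y => t.
by rewrite -[pclass rel s + _]/(padd _ _) paddE !pevalE.
Qed.

Lemma pevalM x y : peval (x * y) = peval x * peval y.
Proof.
elim/pclassW: x => s; elim/pclassW: y => t.
by rewrite -[pclass rel s * _]/(pmul _ _) pmulE !pevalE.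
Qed.

Lemma pevalZ a x : peval (a *: x) = scal a * peval x.
Proof.
by elim/pclassW: x => t; rewrite -[a *: _]/(pscale _ _) pscaleE !pevalE.
Qed.

Lemma peval1 : peval 1 = 1.
Proof. by rewrite -[1]/(pclass rel (Cst 1)) pevalE /= rmorph1. Qed.

Lemma peval_gen x : peval (pgen rel x) = g x.
Proof. exact: pevalE. Qed.

End Evaluation.

Section Presented.
Variables (R : comPzRingType) (X : Type) (rel : term R X -> term R X -> Prop).
Implicit Types x y : presented rel.

Lemma pscaleAl (a : R) x y : a *: (x * y) = (a *: x) * y.
Proof.
elim/pclassW: x => s; elim/pclassW: y => t.
rewrite -[pclass rel s * _]/(pmul _ _) pmulE -[a *: _]/(pscale _ _) pscaleE.
rewrite -[a *: _]/(pscale _ _) pscaleE -[RHS]/(pmul _ _) pmulE.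
exact/pclassP/cong_mulA.
Qed.

Lemma pscaleAr (a : R) x y : a *: (x * y) = x * (a *: y).
Proof.
elim/pclassW: x => s; elim/pclassW: y => t.
rewrite -[pclass rel s * _]/(pmul _ _) pmulE -[a *: _]/(pscale _ _) pscaleE.
rewrite -[a *: _]/(pscale _ _) pscaleE -[RHS]/(pmul _ _) pmulE.
apply/pclassP; apply: cong_trans (cong_mulA _ _ _ _) _.
apply: cong_trans (cong_mul (cong_cstC _ _ _) (cong_refl _ _)) _.
exact/cong_sym/cong_mulA.
Qed.

End Presented.

(** * Sorted words in the generators c_ij *)

Section Letters.
Variable n : nat.
Local Notation letter := ('I_n * 'I_n)%type.
Implicit Types (s : seq letter) (p : letter).

(** Column first, then row: the order of the factors in [cpow]. *)
Definition lex_le p p' := (p.2 < p'.2)%N || ((p.2 == p'.2) && (p.1 <= p'.1)%N).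

Lemma lex_le_trans : transitive lex_le.
Proof.
move=> [a b] [a' b'] [a'' b'']; rewrite /lex_le /= -!val_eqE /=; lia.
Qed.

Lemma lex_le_anti : antisymmetric lex_le.
Proof.
move=> [a b] [a' b']; rewrite /lex_le /= -!val_eqE /= => h.
by congr pair; apply/val_inj; move: h => /=; lia.
Qed.

Lemma sorted_rcons_last s p p' : sorted lex_le (rcons s p') -> lex_le p' p ->
  sorted lex_le (rcons (rcons s p') p).
Proof. by case: s => [|x s] /=; rewrite ?andbT // !rcons_path last_rcons => /andP[-> ->]. Qed.

Lemma sorted_rcons s p : sorted lex_le (rcons s p) -> sorted lex_le s /\ all (lex_le^~ p) s.
Proof.
move=> ss; split.
  by move: ss; rewrite -cats1 => /cat_sorted2[].
move: ss; rewrite sorted_pairwise; last exact: lex_le_trans.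
by rewrite pairwise_rcons => /andP[].
Qed.

Definition canon (B : 'M[nat]_n) : seq letter :=
  flatten [seq flatten [seq nseq (B i j) (i, j) | i <- enum 'I_n] | j <- enum 'I_n].

Lemma pairwise_flatten (I : eqType) (T : Type) (F : I -> seq T) (r : rel T) (r' : rel I)
    (L : seq I) :
  (forall x, pairwise r (F x)) -> pairwise r' L ->
  (forall x y, r' x y -> allrel r (F x) (F y)) -> pairwise r (flatten [seq F x | x <- L]).
Proof.
move=> rF + rr; elim: L => //= x L IH /andP[xL /IH pL].
rewrite pairwise_cat rF pL !andbT.
elim: L xL {IH pL} => [|y L IH] /=; first by rewrite allrel0r.
by case/andP=> xy /IH h; rewrite allrel_catr rr.
Qed.

Lemma pairwise_enum : pairwise (fun i j : 'I_n => i < j)%N (enum 'I_n).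
Proof.
have := iota_ltn_sorted 0 n; rewrite -val_enum_ord sorted_map => ss.
by rewrite -sorted_pairwise // => a b d; apply: ltn_trans.
Qed.

Lemma canon_sorted B : sorted lex_le (canon B).
Proof.
rewrite sorted_pairwise; last exact: lex_le_trans.
apply: pairwise_flatten pairwise_enum _ => [j|j j' jj].
  apply: pairwise_flatten pairwise_enum _ => [i|i i' ii].
    elim: (B i j) => //= m ->; rewrite andbT.
    by apply/allP => p /nseqP[-> _]; rewrite /lex_le eqxx leqnn orbT.
  by apply/allrelP => p p' /nseqP[-> _] /nseqP[-> _]; rewrite /lex_le /= eqxx /= (ltnW ii) orbT.
apply/allrelP => p p' /flattenP[_ /mapP[i _ ->]] /nseqP[-> _].
by move=> /flattenP[_ /mapP[i' _ ->]] /nseqP[-> _]; rewrite /lex_le /= jj.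
Qed.

Definition letter_count s : 'M[nat]_n := \matrix_(i, j) count_mem (i, j) s.

Lemma count_canon B i j : count_mem (i, j) (canon B) = B i j.
Proof.
rewrite /canon count_flatten sumnE big_map big_map big_enum /= (bigD1 j) //=.
rewrite count_flatten sumnE big_map big_map big_enum /= (bigD1 i) //=.
rewrite count_nseq /= eqxx mul1n big1 => [|i' ii]; last first.
  by rewrite count_nseq /= xpair_eqE (negPf ii).
rewrite big1 => [|j' jj]; first by rewrite !addn0.
rewrite count_flatten sumnE big_map big_map big1 // => i' _.
by rewrite count_nseq /= xpair_eqE (negPf jj) andbF.
Qed.

Lemma sorted_canon s : sorted lex_le s -> s = canon (letter_count s).
Proof.
move=> ss; apply: (sorted_eq lex_le_trans lex_le_anti ss (canon_sorted _)).
apply/allP => -[i j] _; apply/eqP.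
by rewrite count_canon mxE.
Qed.

End Letters.

Arguments lex_le {n} p p'.

(** * Sorted monomials span the quantum matrix algebra *)

Section Straightening.
Variables (R : fieldType) (v : R) (n : nat).
Hypothesis v_neq0 : v != 0.
Local Notation q := (v ^+ 2).
Local Notation letter := ('I_n * 'I_n)%type.
Local Notation Aq := (Aq v n).
Local Notation c i j := (cgen v i j).
Implicit Types (s : seq letter) (p : letter).

Lemma cgen_row (i j m : 'I_n) : c i j * c i m = c i m * c i j.
Proof.
rewrite -[LHS]/(pmul _ _) -[RHS]/(pmul _ _) !pmulE.
exact/pclassP/cong_rel/Aqrel_row.
Qed.

Lemma cgen_le (i j s t : 'I_n) : (s < i)%N -> (j <= t)%N ->
  c i j * c s t = q *: (c s t * c i j).
Proof.
move=> si jt; rewrite -[LHS]/(pmul _ _) -[c s t * _]/(pmul _ _) !pmulE.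
rewrite -[RHS]/(pscale _ _) pscaleE.
exact/pclassP/cong_rel/Aqrel_le.
Qed.

Lemma cgen_gt (i j s t : 'I_n) : (s < i)%N -> (t < j)%N ->
  c i j * c s t = (q - 1) *: (c s j * c i t) + c s t * c i j.
Proof.
move=> si tj; rewrite -[LHS]/(pmul _ _) -[c s t * _]/(pmul _ _).
rewrite -[c s j * _]/(pmul _ _) !pmulE.
rewrite -[(q - 1) *: _]/(pscale _ _) pscaleE -[RHS]/(padd _ _) paddE.
exact/pclassP/cong_rel/Aqrel_gt.
Qed.

Definition cprod s : Aq := \prod_(p <- s) c p.1 p.2.

(* The bound d on the second indices makes the insertion of a letter on the right
   terminate. *)
Inductive straight m d : Aq -> Prop :=
  | straight_word s : sorted lex_le s -> size s = m -> all (fun p => p.2 <= d)%N s ->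
      straight m d (cprod s)
  | straight_0 : straight m d 0
  | straight_add x y : straight m d x -> straight m d y -> straight m d (x + y)
  | straight_scale a x : straight m d x -> straight m d (a *: x).

Lemma cprod_rcons s p : cprod (rcons s p) = cprod s * c p.1 p.2.
Proof. by rewrite /cprod -cats1 big_cat big_seq1. Qed.

(** The letters to be passed lie in column j with a larger row index; they q-commute with c_ij, so
    only a scalar appears and no new monomial. *)
Lemma straight_insert_same s (i j : 'I_n) : sorted lex_le s ->
  all (fun p => p.2 <= j)%N s -> exists a s', [/\ cprod s * c i j = a *: cprod s',
    sorted lex_le s' & perm_eq s' ((i, j) :: s)].
Proof.
elim/last_ind: s => [|s p IH] ss sj.
  by exists 1, [:: (i, j)]; rewrite /cprod big_nil mul1r scale1r big_seq1.
have [ps|] := boolP (lex_le p (i, j)).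
  exists 1, (rcons (rcons s p) (i, j)); rewrite scale1r !cprod_rcons; split => //.
    exact: sorted_rcons_last.
  by rewrite perm_rcons.
have [ss' ps] := sorted_rcons ss.
move: sj; rewrite all_rcons => /andP[pj sj] npi.
have {}pj : p.2 = j.
  by apply/val_inj => /=; move: npi; rewrite /lex_le /= -val_eqE /=; lia.
have ip : (i < p.1)%N by move: npi; rewrite /lex_le /= pj eqxx; lia.
have [a [s' [e ss2 ps2]]] := IH ss' sj.
have sp : all (lex_le^~ p) s'.
  rewrite (perm_all _ ps2) /= ps andbT /lex_le /= pj eqxx; lia.
exists (q * a), (rcons s' p); split.
- rewrite !cprod_rcons -mulrA pj cgen_le // -pscaleAr mulrA e -pscaleAl scalerA.
  by rewrite -pj.
- by rewrite sorted_pairwise ?pairwise_rcons ?sp -?sorted_pairwise //; exact: lex_le_trans.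
- rewrite perm_rcons; apply: perm_trans (_ : perm_eq (p :: (i, j) :: s) _).
    by rewrite perm_cons.
  by rewrite -[rcons _ _]cats1 -cat_cons perm_sym perm_catC.
Qed.

Lemma straight_insert m (d : 'I_n) i x :
  straight m d x -> straight m.+1 d (x * c i d).
Proof.
elim=> [s ss sm sd||x1 y1 _ Sx _ Sy|a x1 _ Sx].
- have [a [s' [-> ss' ps']]] := straight_insert_same i ss sd.
  apply/straight_scale/straight_word => //.
    by rewrite (perm_size ps') /= sm.
  by rewrite (perm_all _ ps') /= leqnn.
- by rewrite mul0r; apply: straight_0.
- by rewrite mulrDl; apply: straight_add.
- by rewrite -pscaleAl; apply: straight_scale.
Qed.

Lemma straight_le m d d' x : (d <= d')%N -> straight m d x -> straight m d' x.
Proof.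
move=> dd; elim=> [s ss sm sd||x1 y1 _ Sx _ Sy|a x1 _ Sx].
- by apply: straight_word => //; apply: sub_all sd => p /leq_trans; apply.
- exact: straight_0.
- exact: straight_add.
- exact: straight_scale.
Qed.

(** The relations are rearranged so that the larger column j comes last in both terms, whatever the
    order of the rows; this uses that q is invertible. *)
Lemma cgen_swap (i j a b : 'I_n) : (b < j)%N ->
  exists e f, c i j * c a b = e *: (c a b * c i j) + f *: (c i b * c a j).
Proof.
move=> bj; case: (ltngtP i a) => ia.
- have := cgen_le ia (ltnW bj) => e.
  exists q^-1, 0; rewrite scale0r addr0 e scalerA mulVf ?scale1r //.
  by rewrite expf_neq0.
- exists 1, ((q - 1) / q); rewrite cgen_gt // scale1r addrC.
  have := cgen_le ia (ltnW bj) => ->.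
  by rewrite scalerA mulfVK // expf_neq0.
- have -> : i = a by apply/val_inj.
  by exists 1, 0; rewrite scale0r addr0 scale1r cgen_row.
Qed.

Lemma straight_mulr m (d : nat) i (j : 'I_n) x :
  straight m d x -> straight m.+1 (maxn d j) (x * c i j).
Proof.
elim=> [s ss sm sd||x1 y1 _ Sx _ Sy|a x1 _ Sx]; last first.
- by rewrite -pscaleAl; apply: straight_scale.
- by rewrite mulrDl; apply: straight_add.
- by rewrite mul0r; apply: straight_0.
elim/last_ind: s i m d sm ss sd => [|s p IH] i m d sm ss sd.
  have := straight_insert i (straight_word (m := m) (d := j) ss sm isT).
  by apply: straight_le; rewrite leq_maxr.
have [ss' ps] := sorted_rcons ss.
rewrite size_rcons in sm; case: m sm => // m [sm].
have [pj|jp] := leqP p.2 j.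
  apply: straight_le (leq_maxr d j) _; apply: straight_insert.
  apply: straight_word; rewrite ?size_rcons ?sm // all_rcons pj /=.
  by apply: sub_all ps => p'; rewrite /lex_le -val_eqE /=; lia.
move: sd; rewrite all_rcons => /andP[pd sd].
have sp : all (fun p' => p'.2 <= p.2)%N s.
  by apply: sub_all ps => p'; rewrite /lex_le -val_eqE /=; lia.
have [e [f ef]] := cgen_swap p.1 i jp.
(* The factor of column j is first absorbed by the shorter word s, whose columns then stay at most
   p.2; the factor of column p.2 can therefore be inserted at the end. *)
have aux a b : straight m.+2 (maxn d j) (cprod s * (c a j * c b p.2)).
  rewrite mulrA; apply: straight_le (_ : (p.2 <= maxn d j)%N) _.
    by rewrite leq_max pd.
  apply: straight_insert.
  have := IH a m _ sm ss' sp; apply: straight_le.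
  by rewrite geq_max leqnn ltnW.
rewrite cprod_rcons -mulrA ef mulrDr -!pscaleAr.
by apply: straight_add; apply: straight_scale.
Qed.

Lemma straight_cprod s : exists d, straight (size s) d (cprod s).
Proof.
elim/last_ind: s => [|s p [d IH]].
  by exists 0%N; apply: straight_word.
exists (maxn d p.2); rewrite size_rcons cprod_rcons.
exact: straight_mulr.
Qed.

Lemma cpow_canon (B : 'M[nat]_n) : cpow v B = cprod (canon B).
Proof.
have ie : enum 'I_n = index_enum _ by rewrite enumT /index_enum unlock.
rewrite /cpow /cprod /canon big_flatten big_map ie.
apply: eq_bigr => j _; rewrite big_flatten big_map.
by apply: eq_bigr => i _; rewrite big_nseq /= -Monoid.iteropE.
Qed.

End Straightening.

(** * Functionals on the degree r part and their tables *)

Section Functionals.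
Variables (R : fieldType) (v : R) (n r : nat).
Hypothesis v_neq0 : v != 0.
Local Notation q := (v ^+ 2).
Local Notation letter := ('I_n * 'I_n)%type.
Local Notation Aq := (Aq v n).
Local Notation word := (r.-tuple 'I_n).
Local Notation N := (words n r).
Implicit Types (s : seq letter) (p : letter).

Lemma Aqr_lin a (x y : Aq) : Aqr r x -> Aqr r y -> Aqr r (a *: x + y).
Proof.
move=> [c ->] [d ->]; exists (fun i j => a * c i j + d i j).
rewrite scaler_sumr -big_split; apply: eq_bigr => i _ /=.
rewrite scaler_sumr -big_split; apply: eq_bigr => j _ /=.
by rewrite scalerDl scalerA.
Qed.

Lemma Aqr_0 : Aqr r (0 : Aq).
Proof.
exists (fun _ _ => 0).
by rewrite big1 // => i _; rewrite big1 // => j _; rewrite scale0r.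
Qed.

Lemma Aqr_cmon (i j : word) : Aqr r (cmon v i j).
Proof.
exists (fun i' j' => ((i' == i) && (j' == j))%:R).
rewrite (bigD1 i) //= (bigD1 j) //= !eqxx scale1r big1 => [|j' jj]; last first.
  by rewrite ?eqxx (negPf jj) scale0r.
rewrite big1 ?addr0 // => i' ii; rewrite big1 // => j' _.
by rewrite (negPf ii) scale0r.
Qed.

Lemma cmon_zip (i j : word) : cmon v i j = cprod v (zip i j).
Proof.
rewrite /cmon /cprod; case: (posnP r) => r0.
  by move: i j; rewrite r0 => i j; rewrite big_ord0 (tuple0 i) (tuple0 j) /= big_nil.
have [i0 j0] : 'I_n * 'I_n by have := tnth i (Ordinal r0); have := tnth j (Ordinal r0).
rewrite (big_nth (i0, j0)) big_mkord size_zip !size_tuple minnn.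
apply: eq_bigr => a _; rewrite nth_zip ?size_tuple //=.
by rewrite -!tnth_nth.
Qed.

Lemma cprod_cmon s : size s = r -> exists i j : word, cprod v s = cmon v i j.
Proof.
move=> ss; have s1 : size (unzip1 s) == r by rewrite size_map ss.
have s2 : size (unzip2 s) == r by rewrite size_map ss.
by exists (Tuple s1), (Tuple s2); rewrite cmon_zip /= zip_unzip.
Qed.

Lemma Xi_letter_count s : size s = r -> Xi r (letter_count s).
Proof.
move=> <-; rewrite /Xi /= pair_big /=.
rewrite (eq_bigr (fun p : letter => count_mem p s)); last by case=> i j _; rewrite mxE.
elim: s => [|p s IH] /=; first by rewrite big1.
rewrite big_split /= IH (bigD1 p) //= eqxx big1 ?addn0 ?add1n // => p' pp.
by rewrite eq_sym (negPf pp).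
Qed.

Lemma straight_ext (f f' : Aq -> R) d x : functional r f -> functional r f' ->
  (forall B, Xi r B -> f (cpow v B) = f' (cpow v B)) ->
  straight (v := v) r d x -> Aqr r x /\ f x = f' x.
Proof.
move=> ff ff' ef.
have f0 : f 0 = 0.
  have := ff (-1) 0 0 Aqr_0 Aqr_0.
  by rewrite scaler0 addr0 mulN1r addNr.
have f0' : f' 0 = 0.
  have := ff' (-1) 0 0 Aqr_0 Aqr_0.
  by rewrite scaler0 addr0 mulN1r addNr.
elim=> [s ss sr _||{}x y _ [Ax ex] _ [Ay ey]|a {}x _ [Ax ex]].
- split; first by have [i [j ->]] := cprod_cmon sr; apply: Aqr_cmon.
  by rewrite (sorted_canon ss) -cpow_canon; apply/ef/Xi_letter_count.
- by rewrite f0 f0'; split => //; apply: Aqr_0.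
- rewrite -[x]scale1r ff // ff' // ex ey; split => //.
  exact: Aqr_lin.
- rewrite -[_ *: x]addr0 ff ?ff' ?ex ?f0 ?f0' //; try exact: Aqr_0.
  by split => //; apply: Aqr_lin => //; apply: Aqr_0.
Qed.

(** By straightening, every monomial in the generators of degree r is a combination of the
    [cpow v B]. *)
Lemma table_ext (f f' : Aq -> R) : functional r f -> functional r f' ->
  (forall B, Xi r B -> f (cpow v B) = f' (cpow v B)) -> table r f = table r f'.
Proof.
move=> ff ff' ef; apply/matrixP => a b; rewrite !mxE cmon_zip.
set s := zip _ _; have [d sd] := straight_cprod v_neq0 s.
have sr : size s = r by rewrite /s size_zip !size_tuple minnn.
by rewrite sr in sd; case: (straight_ext ff ff' ef sd).
Qed.

(** The choice made by [xget] is harmless: once some dual functional is exhibited, the chosen one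
    exists and, by [table_ext], has the same table. *)
Lemma xiE (f : Aq -> R) A : functional r f ->
  (forall B, Xi r B -> f (cpow v B) = (B == A)%:R) -> xi v r A = table r f.
Proof.
move=> ff fA; rewrite /xi; set P := [set _ | _]%classic.
have [f' [ff' -> fA']] : P (xget 0 P) by apply: xgetPex; exists (table r f), f.
by apply: table_ext => // B XB; rewrite fA // fA'.
Qed.

Section Pairing.
Variables (al be : 'I_n) (D1 D2 : 'I_n -> R).
(** These are the constraints put by the relations on the off-diagonal entry. The generators
    c_{be,be} and c_{al,be} lie in one column and q-commute, which fixes the ratio of D1 and D2 at
    be; other commutations ask for D1 = D2. Adjacency of al and be makes the (q-1) term of the third
    relation vanish. *)
Hypotheses (albe : (be == al.+1 :> nat) || (al == be.+1 :> nat))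
  (D12 : forall i, i != be -> D1 i = D2 i)
  (Dlt : (al < be)%N -> D1 be = q * D2 be) (Dgt : (be < al)%N -> D2 be = q * D1 be).

Local Notation P := {mpoly R[n]}.

Definition utri (a b c : P) : 'M[P]_2 :=
  \matrix_(i, j) (if i == 0 then (if j == 0 then a else b)
    else (if j == 0 then 0 else c)).

Lemma utriM a b c a' b' c' :
  utri a b c * utri a' b' c' = utri (a * a') (a * b' + b * c') (c * c').
Proof.
apply/matrixP => i j; rewrite -mulmxE !mxE !big_ord_recl big_ord0 !mxE /=.
by case: ifP => _; case: ifP => _; rewrite /=; ring.
Qed.

Lemma utriD a b c a' b' c' : utri a b c + utri a' b' c' = utri (a + a') (b + b') (c + c').
Proof.
apply/matrixP => i j; rewrite !mxE.
by case: ifP => _; case: ifP => _; rewrite ?addr0.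
Qed.

Definition scal : {rmorphism R -> 'M[P]_2} := (@scalar_mx P 2 \o @mpolyC n R)%FUN.

Lemma scalE a x y z : scal a * utri x y z = utri (a *: x) (a *: y) (a *: z).
Proof.
rewrite -mulmxE /scal /= mul_scalar_mx; apply/matrixP => i j; rewrite !mxE.
by case: ifP => _; case: ifP => _; rewrite ?mulr0 // mul_mpolyC.
Qed.

Lemma scalC a m : scal a * m = m * scal a.
Proof. by rewrite /scal /= -!mulmxE scalar_mxC. Qed.

(* A representation of A_q(n) by upper triangular matrices over polynomials.  Its
   diagonal and off-diagonal entries yield the functionals giving 0(j, r) and
   A(0, r) for a simple root vector A; the variables record the row content. *)
Definition cgen2 p : 'M[P]_2 := utri ((p.1 == p.2)%:R * D1 p.1 *: 'X_(p.1))
  ((p == (al, be))%:R *: 'X_(p.1)) ((p.1 == p.2)%:R * D2 p.1 *: 'X_(p.1)).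

Lemma scalar_mul_X (a b : R) (x y : P) : (a *: x) * (b *: y) = (a * b) *: (x * y).
Proof. by rewrite -scalerAl -scalerAr scalerA. Qed.

Lemma cgen2M p p' : cgen2 p * cgen2 p' =
  utri (((p.1 == p.2)%:R * D1 p.1 * ((p'.1 == p'.2)%:R * D1 p'.1)) *: ('X_(p.1) * 'X_(p'.1)))
     (((p.1 == p.2)%:R * D1 p.1 * (p' == (al, be))%:R
       + (p == (al, be))%:R * ((p'.1 == p'.2)%:R * D2 p'.1)) *: ('X_(p.1) * 'X_(p'.1)))
     (((p.1 == p.2)%:R * D2 p.1 * ((p'.1 == p'.2)%:R * D2 p'.1)) *: ('X_(p.1) * 'X_(p'.1))).
Proof. by rewrite utriM !scalar_mul_X -scalerDl. Qed.

Lemma cgen2_rel t1 t2 : Aqrel v t1 t2 -> teval scal cgen2 t1 = teval scal cgen2 t2.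
Proof.
have alNbe : al != be by rewrite -val_eqE /=; lia.
have nn (b1 b2 : bool) (x y : R) : (b1 -> b2 -> False) -> b1%:R * x * (b2%:R * y) = 0.
  by case: b1; case: b2 => h; rewrite ?(mul0r, mulr0) //; case: h.
have DE x : x <> be -> D1 x = D2 x by move/eqP; apply: D12.
case=> {t1 t2} [i j m|i j s t si jt|i j s t si tj] /=; rewrite !cgen2M /= ?scalE ?utriD.
- rewrite !xpair_eqE; congr (utri (_ *: _) (_ *: _) (_ *: _)); try by ring.
  have [->|] := eqVneq i al; last by rewrite !mulr0 !mul0r addr0.
  by rewrite D12 //=; ring.
- rewrite !scalerA ['X_s * _]mulrC; congr (utri (_ *: _) (_ *: _) (_ *: _)).
  + by rewrite !nn ?mulr0 // => /eqP e /eqP e'; subst; lia.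
  + rewrite !xpair_eqE mulrDr addrC; congr (_ + _).
      have [/andP[/eqP ei /eqP ej]|] := boolP ((i == al) && (j == be)); last first.
        by rewrite !(mul0r, mulr0).
      have [st|] := eqVneq s t; last by rewrite !(mul0r, mulr0).
      have sb : s = be by apply/val_inj => /=; subst; move: albe; lia.
      by rewrite !mul1r mulr1 sb Dgt //; subst; lia.
    have [/andP[/eqP es /eqP et]|] := boolP ((s == al) && (t == be)); last first.
      by rewrite !(mul0r, mulr0).
    have [ij|] := eqVneq i j; last by rewrite !(mul0r, mulr0).
    have ib : i = be by apply/val_inj => /=; subst; move: albe; lia.
    by rewrite !mul1r mulr1 ib Dlt //; subst; lia.
  + by rewrite !nn ?mulr0 // => /eqP e /eqP e'; subst; lia.
- rewrite !scalerA ['X_s * _]mulrC -!scalerDl; congr (utri (_ *: _) (_ *: _) (_ *: _)).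
  + rewrite [X in (q - 1) * X]nn ?mulr0 ?add0r; first by ring.
    by move=> /eqP e /eqP e'; subst; lia.
  + rewrite !xpair_eqE.
    rewrite (_ : (s == j)%:R * D1 s * _ = 0); last first.
      have [sj|] := eqVneq s j; last by rewrite !mul0r.
      case: andP => [[/eqP e /eqP e']|]; rewrite ?mulr0 //.
      by subst; move: albe; lia.
    rewrite (_ : _ * ((i == t)%:R * D2 i) = 0); last first.
      have [it|] := eqVneq i t; last by rewrite mul0r mulr0.
      case: andP => [[/eqP e /eqP e']|]; rewrite ?mul0r //.
      by subst; move: albe; lia.
    rewrite addr0 mulr0 add0r addrC; congr (_ + _).
      case: andP => [[/eqP ei /eqP ej]|]; last by rewrite mulr0 mul0r.
      have [st|] := eqVneq s t; last by rewrite !(mul0r, mulr0).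
      by rewrite DE ?mul1r ?mulr1 // => sb; subst; lia.
    case: andP => [[/eqP es /eqP et]|]; last by rewrite mulr0 mul0r.
    have [ij|] := eqVneq i j; last by rewrite !(mul0r, mulr0).
    by rewrite DE ?mul1r ?mulr1 // => sb; subst; lia.
  + rewrite [X in (q - 1) * X]nn ?mulr0 ?add0r; first by ring.
    by move=> /eqP e /eqP e'; subst; lia.
Qed.

Definition t11 s : R := \prod_(p <- s) ((p.1 == p.2)%:R * D1 p.1).
Definition t22 s : R := \prod_(p <- s) ((p.1 == p.2)%:R * D2 p.1).
(** Off-diagonal entry of a product of triangular matrices: one letter is (al, be), the letters to
    its left weigh D1 and those to its right D2. *)
Fixpoint t12 s : R := if s is p :: s' then
    (p.1 == p.2)%:R * D1 p.1 * t12 s' + (p == (al, be))%:R * t22 s'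
  else 0.

Definition rows s : 'X_{1..n} := [multinom count (fun p => p.1 == i) s | i < n].

Lemma rows_cons p s : 'X_[rows (p :: s)] = 'X_(p.1) * 'X_[rows s] :> P.
Proof.
by rewrite -mpolyXD; congr 'X_[_]; apply/mnmP => i; rewrite mnmDE mnm1E !mnmE.
Qed.

Let rep2 : Aq -> 'M[P]_2 := peval scal cgen2.

Lemma rep2_cprod s : rep2 (cprod v s) =
  utri (t11 s *: 'X_[rows s]) (t12 s *: 'X_[rows s]) (t22 s *: 'X_[rows s]).
Proof.
elim: s => [|p s IH].
  rewrite /cprod /t11 /t22 !big_nil /rep2 (peval1 scalC cgen2_rel).
  have -> : 'X_[rows [::]] = 1 :> P.
    by rewrite -mpolyX0; congr 'X_[_]; apply/mnmP => i; rewrite !mnmE.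
  apply/matrixP => i j; rewrite !mxE -val_eqE /=.
  case: i j => [[|[|//]] ?] [[|[|//]] ?] /=; by rewrite ?scale1r ?scale0r.
rewrite /rep2 in IH *; rewrite /cprod big_cons (pevalM scalC cgen2_rel) IH.
rewrite (peval_gen scalC cgen2_rel) utriM !scalar_mul_X -scalerDl -!rows_cons.
by rewrite /t11 /t22 !big_cons.
Qed.

Definition coef11 m (x : Aq) : R := (rep2 x 0 0)@_m.
Definition coef12 m (x : Aq) : R := (rep2 x 0 1)@_m.

Lemma functional_coef m a b : functional r (fun x : Aq => (rep2 x a b)@_m).
Proof.
move=> d x y _ _; rewrite /rep2 (pevalD scalC cgen2_rel) (pevalZ scalC cgen2_rel).
rewrite mxE mcoeffD; congr (_ + _).
by rewrite /scal /= -mulmxE mul_scalar_mx mxE mcoeffCM.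
Qed.

Lemma coef11_cprod m s : coef11 m (cprod v s) = t11 s * (rows s == m)%:R.
Proof. by rewrite /coef11 rep2_cprod mxE /= mcoeffZ mcoeffX. Qed.
Lemma coef12_cprod m s : coef12 m (cprod v s) = t12 s * (rows s == m)%:R.
Proof. by rewrite /coef12 rep2_cprod mxE /= mcoeffZ mcoeffX. Qed.

End Pairing.
End Functionals.

(** * The matrices A(0, r) for simple root vectors *)

Section RootVectors.
Variables (R : fieldType) (v : R) (n r : nat).
Hypothesis v_neq0 : v != 0.
Local Notation q := (v ^+ 2).
Local Notation letter := ('I_n * 'I_n)%type.
Local Notation word := (r.-tuple 'I_n).
Local Notation N := (words n r).
Implicit Types (s : seq letter) (p : letter).
Variables (al be : 'I_n).
Hypothesis albe : (be == al.+1 :> nat) || (al == be.+1 :> nat).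

(** At al, the value v^-1 reproduces the normalization v^(-d_A) of [A]. At be, the weight is 1 on
    the side of (al, be) where a sorted word puts the letters (be, be), and the required ratio then
    gives q on the other side. *)
Definition Dl (i : 'I_n) : R := if i == al then v^-1 else
  if i == be then (if (al < be)%N then q else 1) else 1.
Definition Dr (i : 'I_n) : R := if i == al then v^-1 else
  if i == be then (if (al < be)%N then 1 else q) else 1.

Let be_al : (be == al) = false.
Proof. by apply/negbTE; rewrite -val_eqE /=; lia. Qed.
Let al_be : (al == be) = false.
Proof. by rewrite eq_sym. Qed.

Lemma Dlr i : i != be -> Dl i = Dr i.
Proof. by move=> /negPf ib; rewrite /Dl /Dr ib. Qed.
Lemma Dl_lt : (al < be)%N -> Dl be = q * Dr be.
Proof. by move=> ab; rewrite /Dl /Dr be_al eqxx ab mulr1. Qed.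
Lemma Dr_gt : (be < al)%N -> Dr be = q * Dl be.
Proof. by move=> ab; rewrite /Dl /Dr be_al eqxx ltnNge (ltnW ab) mulr1. Qed.

Local Notation t22 := (t22 Dr).
Local Notation t12 := (t12 al be Dl Dr).

Definition diag s := all (fun p => p.1 == p.2) s.

Lemma t12_decomp s : t12 s != 0 ->
  exists s1 s2, [/\ s = s1 ++ (al, be) :: s2, diag s1 & diag s2].
Proof.
elim: s => [|p s IH] /=; first by rewrite eqxx.
have [->|pab] := eqVneq p (al, be).
  rewrite /= al_be !mul0r add0r mul1r => t0; exists [::], s; split => //.
  apply/allP => p' /(nthP p)[i si <-]; apply: contraNT t0 => dp.
  rewrite /t22 prodf_seq_eq0; apply/hasP; exists (nth p s i); first exact: mem_nth.
  by rewrite (negPf dp) mul0r eqxx.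
rewrite mul0r addr0 !mulf_eq0 !negb_or => /andP[/andP[dp _] /IH[s1 [s2 [-> d1 d2]]]].
exists (p :: s1), s2; split => //=; rewrite d1 andbT.
by apply: contraNT dp => /negPf ->.
Qed.

Lemma t12_cat s1 s2 : diag s1 -> diag s2 -> t12 (s1 ++ (al, be) :: s2) =
  (\prod_(p <- s1) Dl p.1) * (\prod_(p <- s2) Dr p.1).
Proof.
move=> d1 d2; elim: s1 d1 => [_|p s1 IH /= /andP[dp /IH ->]].
  rewrite /= al_be mul0r mul0r add0r eqxx mul1r big_nil mul1r /t22.
  by rewrite big_seq [RHS]big_seq; apply: eq_bigr => p /(allP d2) ->; rewrite mul1r.
rewrite big_cons dp mul1r mulrA; case: eqP => [e|_]; last by rewrite mul0r addr0.
by move: dp; rewrite e /= al_be.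
Qed.

Lemma count_diag_decomp s1 s2 i j : diag s1 -> diag s2 -> i != j ->
  count_mem (i, j) (s1 ++ (al, be) :: s2) = ((i, j) == (al, be)).
Proof.
move=> d1 d2 ij; have c0 s : diag s -> count_mem (i, j) s = 0%N.
  by move=> ds; apply/count_memPn; apply: contra ij => /(allP ds).
by rewrite count_cat /= !c0 // add0n addn0 eq_sym.
Qed.

Definition shape (d : 'I_n -> nat) := add_diag (delta_mx al be) d.

Lemma delta_nat i j : (delta_mx al be : 'M[nat]_n) i j = ((i, j) == (al, be)).
Proof. by rewrite mxE xpair_eqE; case: (_ && _). Qed.

Lemma shapeE d i j : shape d i j = (((i, j) == (al, be)) + (if i == j then d i else 0))%N.
Proof. by rewrite mxE delta_nat. Qed.

Lemma letter_count_decomp s1 s2 (s := s1 ++ (al, be) :: s2) : diag s1 -> diag s2 ->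
  letter_count s = shape (fun i => count_mem (i, i) s).
Proof.
move=> d1 d2; apply/matrixP => i j; rewrite shapeE mxE.
have [->|ij] := eqVneq i j; last by rewrite addn0 count_diag_decomp.
rewrite (_ : (_ == _) = false) // xpair_eqE; apply/negbTE.
by apply: contraFN al_be => /andP[/eqP <- /eqP <-].
Qed.

Lemma rows_decomp s1 s2 (s := s1 ++ (al, be) :: s2) : diag s1 -> diag s2 ->
  rows s = [multinom count_mem (i, i) s + (i == al) | i < n].
Proof.
move=> d1 d2; apply/mnmP => i; rewrite !mnmE /s !count_cat /=.
have c s' : diag s' -> count (fun p => p.1 == i) s' = count_mem (i, i) s'.
  move=> ds; apply: eq_in_count => -[a b] /(allP ds) /= /eqP ->.
  by rewrite xpair_eqE andbb.
rewrite !c // (_ : ((al, be) == (i, i)) = false).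
  by rewrite (eq_sym al i) add0n (addnC (i == al)) addnA.
by rewrite xpair_eqE; apply: contraFF al_be => /andP[/eqP -> /eqP ->].
Qed.

(** Sorting puts the letters (be, be) after (al, be) if al < be and before it otherwise, where they
    weigh 1; only the letters (al, al) contribute. *)
Lemma t12_sorted s1 s2 (s := s1 ++ (al, be) :: s2) : diag s1 -> diag s2 ->
  sorted lex_le s -> t12 s = v ^- count_mem (al, al) s.
Proof.
move=> d1 d2; rewrite sorted_pairwise; last exact: lex_le_trans.
rewrite pairwise_cat allrel_consr => /and3P[/andP[le1 _] _ /= /andP[le2 _]].
rewrite t12_cat // /s count_cat /= xpair_eqE eqxx be_al /= add0n.
pose G p : R := if p == (al, al) then v^-1 else 1.
have GE s' : \prod_(p <- s') G p = v ^- count_mem (al, al) s'.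
  elim: s' => [|p s' IH]; first by rewrite big_nil /= invr1.
  rewrite big_cons IH /G /=; case: eqP => _; rewrite ?add1n ?add0n ?mul1r //.
  by rewrite exprS invfM.
rewrite exprD invfM -!GE; congr (_ * _).
- rewrite big_seq [RHS]big_seq; apply: eq_bigr => -[a b] ps.
  have /eqP /= ab := allP d1 _ ps; have := allP le1 _ ps; rewrite -ab /lex_le /= => h.
  rewrite /G /Dl xpair_eqE andbb; case: eqVneq => // aal.
  have [ab1|//] := eqVneq a be; move: h; rewrite ab1 ltnn eqxx /=.
  by case: ltnP => //; lia.
- rewrite big_seq [RHS]big_seq; apply: eq_bigr => -[a b] ps.
  have /eqP /= ab := allP d2 _ ps; have := allP le2 _ ps; rewrite -ab /lex_le /= => h.
  rewrite /G /Dr xpair_eqE andbb; case: eqVneq => // aal.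
  have [ab1|//] := eqVneq a be; move: h; rewrite ab1 ltnn eqxx /=.
  by case: ltnP => //; lia.
Qed.

Lemma shape_decomp d : exists s1 s2,
  [/\ canon (shape d) = s1 ++ (al, be) :: s2, diag s1 & diag s2].
Proof.
have [s es] : exists s, s = canon (shape d) by eexists.
have cs i j : count_mem (i, j) s = shape d i j by rewrite es count_canon.
have abs : (al, be) \in s.
  by rewrite -has_pred1 has_count cs shapeE eqxx al_be.
rewrite -es; move: cs; case/splitPr: abs => s1 s2 cs; exists s1, s2; split => //.
all: apply/allP => -[a b] ps; apply: contraT => /= ab.
all: have := cs a b; rewrite shapeE (negPf ab) addn0 count_cat /=.
all: move: ps; rewrite -has_pred1 has_count (eq_sym (al, be)) => c0 /eqP.
all: by rewrite addnCA -[X in _ == X]addn0 eqn_add2l addn_eq0 (gtn_eqF c0) ?andbF.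
Qed.

Lemma shape_nz d (i j : 'I_n) : shape d i j != 0%N ->
  (j = i :> nat) \/ (i = al :> nat /\ j = be :> nat).
Proof.
rewrite shapeE; have [->|ij] := eqVneq i j; first by left.
by rewrite addn0 eqb0 negbK => /eqP[-> ->]; right.
Qed.

(** As al and be are adjacent, no two nonzero entries are in the relative position counted by the
    sum over two rows; within one row only the entries d_al and 1 of row al form a pair. *)
Lemma dA_shape d : dA (shape d) = (d al)%:Z.
Proof.
rewrite /dA [X in _ - X]big1 => [|i _]; last first.
  rewrite big1 // => j _; rewrite big1 // => s si; rewrite big1 // => t tj.
  suff -> : (shape d i j * shape d s t = 0)%N by [].
  apply/eqP; rewrite muln_eq0; apply: contraT; rewrite negb_or.
  move=> /andP[/shape_nz h1 /shape_nz h2].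
  by case: h1 => [e1|[e1 e2]]; case: h2 => [e3|[e3 e4]]; case/orP: albe => /eqP e; lia.
rewrite subr0 (bigD1 al) //= [X in _ + X]big1 ?addr0 => [|i ial]; last first.
  rewrite big1 // => j _; rewrite big1 // => t tj.
  suff -> : (shape d i j * shape d i t = 0)%N by [].
  apply/eqP; rewrite muln_eq0; apply: contraT; rewrite negb_or.
  move=> /andP[/shape_nz h1 /shape_nz h2].
  have : i <> al :> nat by move/val_inj => e; rewrite e eqxx in ial.
  by case: h1 => [e1|[e1 e2]]; case: h2 => [e3|[e3 e4]]; lia.
have sab : shape d al be = 1%N by rewrite shapeE eqxx al_be.
have saa : shape d al al = d al.
  by rewrite shapeE eqxx xpair_eqE eqxx al_be.
have s0 (j t : 'I_n) : (t < j)%N -> (j <> maxn al be :> nat) \/ (t <> minn al be :> nat) ->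
    (shape d al j * shape d al t)%N%:Z = 0.
  move=> tj h; suff -> : (shape d al j * shape d al t = 0)%N by [].
  apply/eqP; rewrite muln_eq0; apply: contraT; rewrite negb_or.
  move=> /andP[/shape_nz h1 /shape_nz h2].
  by case: h1 => [e1|[e1 e2]]; case: h2 => [e3|[e3 e4]]; lia.
have aux (a b : 'I_n) : a = maxn al be :> nat -> b = minn al be :> nat ->
    \sum_(j < n) \sum_(t < n | (t < j)%N) (shape d al j * shape d al t)%N%:Z =
    (shape d al a * shape d al b)%N%:Z.
  move=> ea eb; rewrite (bigD1 a) //= [X in _ + X]big1 ?addr0 => [|j ja]; last first.
    rewrite big1 // => t tj; apply: s0 => //; left; rewrite -ea.
    by move/val_inj => e; rewrite e eqxx in ja.
  rewrite (bigD1 b) /=; last by case/orP: albe => /eqP e; lia.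
  rewrite big1 ?addr0 // => t /andP[tj tb]; apply: s0 => //; right; rewrite -eb.
  by move/val_inj => e; rewrite e eqxx in tb.
case/orP: albe => /eqP e.
- by rewrite (aux be al) ?sab ?saa ?mul1n //; lia.
- by rewrite (aux al be) ?sab ?saa ?muln1 //; lia.
Qed.

Definition wgt (d : 'I_n -> nat) := [multinom (d i + (i == al))%N | i < n].

Local Notation coef := (coef12 (v := v) al be Dl Dr).

Lemma coef_functional m : functional r (coef m).
Proof.
exact: (functional_coef v_neq0 albe Dlr Dl_lt Dr_gt).
Qed.

Lemma coefE m s : coef m (cprod v s) = t12 s * (rows s == m)%:R.
Proof.
exact: (coef12_cprod v_neq0 albe Dlr Dl_lt Dr_gt).
Qed.

Lemma br_shape d : Xi r (shape d) -> br v r (shape d) = table r (coef (wgt d)).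
Proof.
move=> Xd; rewrite /br dA_shape.
(* By [t12_sorted] the functional takes the value v^(-d_al) on its own monomial; the factor making
   it dual is exactly cancelled by the normalization of [br]. *)
rewrite (@xiE _ _ _ _ v_neq0 (fun x => v ^+ d al * coef (wgt d) x)).
- apply/matrixP => a b; rewrite !mxE mulrA -exprnN mulVf ?mul1r //.
  by rewrite expf_neq0.
- move=> a x y Ax Ay /=; rewrite coef_functional //.
  by rewrite mulrDr !mulrA (mulrC a).
- move=> B XB; rewrite cpow_canon coefE.
  have [->|BA] := eqVneq B (shape d).
    have [s1 [s2 [es d1 d2]]] := shape_decomp d.
    have cs i : count_mem (i, i) (s1 ++ (al, be) :: s2) = d i.
      rewrite -es count_canon shapeE eqxx (_ : (_ == _) = false) // xpair_eqE.
      by apply: contraFF al_be => /andP[/eqP <- /eqP <-].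
    rewrite es t12_sorted // -?es ?canon_sorted // es.
    rewrite rows_decomp // cs (_ : _ == _) ?mulr1 ?mulfV ?expf_neq0 //.
    by apply/eqP/mnmP => i; rewrite !mnmE cs.
  have [->|t0] := eqVneq (t12 (canon B)) 0; first by rewrite mul0r mulr0.
  have [s1 [s2 [es d1 d2]]] := t12_decomp t0.
  rewrite (_ : (_ == _) = false) ?mulr0 //; apply: contra_neqF BA.
  rewrite es rows_decomp // => /eqP/mnmP h.
  have -> : B = letter_count (canon B).
    by apply/matrixP => i j; rewrite mxE count_canon.
  rewrite es letter_count_decomp //; apply/matrixP => i j; rewrite !shapeE; congr (_ + _)%N.
  case: eqP => // _; have := h i; rewrite !mnmE => /eqP.
  by rewrite eqn_add2r => /eqP.
Qed.

(** The words a and b determine the diagonal part, so at most one summand is nonzero at this entry: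
    the row contents separate the different D. *)
Lemma Ajr_shape a b : Ajr v r (delta_mx al be) (fun=> 0) a b =
  t12 (zip (enum_val a : word) (enum_val b : word)).
Proof.
set s := zip _ _.
have sr : size s = r by rewrite /s size_zip !size_tuple minnn.
rewrite /Ajr summxE.
transitivity (\sum_(d : {ffun 'I_n -> 'I_r.+1} |
    `[< Xi r (shape (fun i => d i)) >]) t12 s * (rows s == wgt (fun i => d i))%:R).
  apply: eq_bigr => d /asboolP Xd; rewrite big1 => [|i _]; last by rewrite mulr0.
  by rewrite expr0z scale1r -/(shape _) br_shape // mxE cmon_zip coefE.
have [->|t0] := eqVneq (t12 s) 0; first by rewrite big1 // => d _; rewrite mul0r.
have [s1 [s2 [es d1 d2]]] := t12_decomp t0.
have cr i : (count_mem (i, i) s < r.+1)%N by rewrite ltnS -sr count_size.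
pose d0 := [ffun i => Ordinal (cr i)].
have d0E : shape (fun i => d0 i) = letter_count s.
  rewrite es letter_count_decomp // -es; apply/matrixP => i j; rewrite !shapeE.
  by rewrite ffunE.
rewrite (bigD1 d0) /=; last by apply/asboolP; rewrite d0E; apply: Xi_letter_count.
rewrite big1 => [|d /andP[_ dd]]; last first.
  rewrite (_ : (_ == _) = false) ?mulr0 //; apply: contra_neqF dd.
  rewrite es rows_decomp // -es => /eqP/mnmP h; apply/ffunP => i.
  apply/val_inj; rewrite ffunE /=; have := h i; rewrite !mnmE => /eqP.
  by rewrite eqn_add2r => /eqP.
rewrite addr0 (_ : _ == _) ?mulr1 //.
by rewrite es rows_decomp // -es; apply/eqP/mnmP => i; rewrite !mnmE ffunE.
Qed.

End RootVectors.

(** * The matrices 0(j, r) *)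

Section Cartan.
Variables (R : fieldType) (v : R) (n r : nat).
Hypothesis v_neq0 : v != 0.
Hypothesis n_gt1 : (1 < n)%N.
Local Notation letter := ('I_n * 'I_n)%type.
Local Notation word := (r.-tuple 'I_n).
Implicit Types (s : seq letter) (p : letter).

Definition dshape (d : 'I_n -> nat) := add_diag (const_mx 0%N) d.

Lemma dshapeE d i j : dshape d i j = if i == j then d i else 0%N.
Proof. by rewrite mxE mxE add0n. Qed.

Lemma dA_dshape d : dA (dshape d) = 0.
Proof.
rewrite /dA [X in _ - X]big1 => [|i _]; last first.
  rewrite big1 // => j _; rewrite big1 // => s si; rewrite big1 // => t tj.
  rewrite !dshapeE; have [e|] := eqVneq i j; last by rewrite mul0n.
  have [e'|] := eqVneq s t; last by rewrite muln0.
  by subst; lia.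
rewrite subr0 big1 // => i _; rewrite big1 // => j _; rewrite big1 // => t tj.
rewrite !dshapeE; have [e|] := eqVneq i j; last by rewrite mul0n.
have [e'|] := eqVneq i t; last by rewrite muln0.
by subst; rewrite ltnn in tj.
Qed.

(** The triangular representation is used with D1 = 1, so that its first diagonal entry detects
    words of diagonal letters; the condition at be then forces D2 be = v^-2. *)
Let al : 'I_n := Ordinal (ltnW n_gt1).
Let be : 'I_n := Ordinal n_gt1.
Let D1 (i : 'I_n) : R := 1.
Let D2 (i : 'I_n) : R := if i == be then v ^- 2 else 1.

Let albe : (be == al.+1 :> nat) || (al == be.+1 :> nat).
Proof. by rewrite eqxx. Qed.
Let D12 (i : 'I_n) : i != be -> D1 i = D2 i.
Proof. by rewrite /D2 => /negPf ->. Qed.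
Let Dlt : (al < be)%N -> D1 be = v ^+ 2 * D2 be.
Proof. by rewrite /D1 /D2 eqxx mulfV // expf_neq0. Qed.
Let Dgt : (be < al)%N -> D2 be = v ^+ 2 * D1 be.
Proof. by []. Qed.

Local Notation coef := (coef11 (v := v) al be D1 D2).

Lemma t11E s : t11 D1 s = (diag s)%:R.
Proof.
rewrite /t11 /diag; elim: s => [|p s IH]; first by rewrite big_nil.
by rewrite big_cons IH /D1 mulr1 /=; case: eqP => _; rewrite ?mul1r ?mul0r.
Qed.

Lemma coef11E m s : coef m (cprod v s) = (diag s)%:R * (rows s == m)%:R.
Proof. by rewrite (coef11_cprod v_neq0 albe D12 Dlt Dgt) t11E. Qed.

Lemma coef11_functional m : functional r (coef m).
Proof. exact: (functional_coef v_neq0 albe D12 Dlt Dgt). Qed.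

Lemma rows_diag s : diag s -> rows s = [multinom count_mem (i, i) s | i < n].
Proof.
move=> ds; apply/mnmP => i; rewrite !mnmE.
apply: eq_in_count => -[a b] /(allP ds) /= /eqP ->.
by rewrite xpair_eqE andbb.
Qed.

Lemma letter_count_diag s : diag s -> letter_count s = dshape (fun i => count_mem (i, i) s).
Proof.
move=> ds; apply/matrixP => i j; rewrite mxE dshapeE.
have [->//|ij] := eqVneq i j.
by apply/count_memPn; apply: contra ij => /(allP ds).
Qed.

Lemma diag_canon d : diag (canon (dshape d)).
Proof.
apply/allP => -[i j] /=; rewrite -has_pred1 has_count count_canon dshapeE.
by case: eqP.
Qed.

Lemma br_dshape d : Xi r (dshape d) ->
  br v r (dshape d) = table r (coef [multinom d i | i < n]).
Proof.
move=> Xd; rewrite /br dA_dshape oppr0 expr0z scale1r.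
apply: (xiE v_neq0); first exact: coef11_functional.
move=> B XB; rewrite cpow_canon coef11E.
have [->|BA] := eqVneq B (dshape d).
  rewrite diag_canon mul1r rows_diag ?diag_canon // (_ : _ == _) //.
  by apply/eqP/mnmP => i; rewrite !mnmE count_canon dshapeE eqxx.
have [ds|] := boolP (diag (canon B)); last by rewrite mul0r.
rewrite (_ : (_ == _) = false) ?mulr0 //; apply: contra_neqF BA.
rewrite rows_diag // => /eqP/mnmP h.
have -> : B = letter_count (canon B) by apply/matrixP => i j; rewrite mxE count_canon.
rewrite letter_count_diag //; apply/matrixP => i j; rewrite !dshapeE.
by case: eqP => // _; have := h i; rewrite !mnmE.
Qed.

Lemma Ajr_diag (j : 'I_n -> int) a b : Ajr v r (const_mx 0%N) j a b =
  (a == b)%:R * v ^ (\sum_i (count_mem i (enum_val a : word))%:Z * j i).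
Proof.
set s := zip (enum_val a : word) (enum_val b : word).
have sr : size s = r by rewrite /s size_zip !size_tuple minnn.
have dab : diag s = (a == b).
  rewrite -(inj_eq enum_val_inj) -val_eqE /= /s.
  have : size (enum_val a : word) = size (enum_val b : word) by rewrite !size_tuple.
  move: (val (enum_val a : word)) (val (enum_val b : word)).
  elim=> [|i w IH] [|i' w'] //= [sw]; by rewrite eqseq_cons IH.
rewrite /Ajr summxE.
transitivity (\sum_(d : {ffun 'I_n -> 'I_r.+1} | `[< Xi r (dshape (fun i => d i)) >])
    v ^ (\sum_i (d i)%:Z * j i) * ((diag s)%:R * (rows s == [multinom (d i : nat) | i < n])%:R)).
  apply: eq_bigr => d /asboolP Xd.
  by rewrite mxE -/(dshape _) br_dshape // mxE cmon_zip coef11E.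
rewrite dab; case: (eqVneq a b) dab => [ab dab|_ _]; last first.
  by rewrite big1 ?mul0r // => d _; rewrite mul0r mulr0.
have cr i : (count_mem (i, i) s < r.+1)%N by rewrite ltnS -sr count_size.
pose d0 := [ffun i => Ordinal (cr i)].
have d0E : dshape (fun i => d0 i) = letter_count s.
  rewrite letter_count_diag //; apply/matrixP => i j'; rewrite !dshapeE.
  by rewrite ffunE.
rewrite (bigD1 d0) /=; last by apply/asboolP; rewrite d0E; apply: Xi_letter_count.
rewrite [X in _ + X]big1 => [|d /andP[_ dd]]; last first.
  rewrite (_ : (rows s == _) = false) ?mulr0 //; apply: contra_neqF dd.
  rewrite rows_diag // => /eqP/mnmP h; apply/ffunP => i.
  by apply/val_inj; rewrite ffunE /=; have := h i; rewrite !mnmE.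
rewrite addr0 (_ : rows s == _) ?mulr1 ?mul1r; last first.
  by rewrite rows_diag //; apply/eqP/mnmP => i; rewrite !mnmE ffunE.
congr (_ ^ _); apply: eq_bigr => i _; congr (Posz _ * _); rewrite ffunE /= /s -ab.
by elim: (val (enum_val a : word)) => //= i' w ->; rewrite xpair_eqE andbb.
Qed.

End Cartan.

(** * Specialization at a root of unity *)

Section FieldIdentities.
Variable K : fieldType.
Implicit Types a b x y : K.

Lemma addf_cross a b x y : x != 0 -> y != 0 -> (a / x + b / y) * (x * y) = a * y + b * x.
Proof. by move=> x0 y0; field; rewrite x0 y0. Qed.

Lemma mulf_cross a b x y : x != 0 -> y != 0 -> (a / x) * (b / y) * (x * y) = a * b.
Proof. by move=> x0 y0; field; rewrite x0 y0. Qed.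

End FieldIdentities.

Section Specialization.
Variables (k : fieldType) (eps : k).
Hypothesis eps_neq0 : eps != 0.

Lemma tofrac_inj : injective (@FracField.tofrac {poly rat}).
Proof. by move=> x y /eqP; rewrite tofrac_eq => /eqP. Qed.

Lemma ups_neq0 : ups != 0.
Proof. by rewrite /ups tofrac_eq0 polyX_eq0. Qed.

Lemma laurent_ups (P : {poly int}) m :
  laurent ups P m = FracField.tofrac (map_poly intr P) / ups ^+ m.
Proof.
rewrite /laurent; congr (_ / _).
have -> : map_poly intr P = map_poly (@FracField.tofrac {poly rat}) (map_poly intr P) :> {poly Qv}.
  by rewrite -map_poly_comp; apply: eq_map_poly => a /=; rewrite rmorph_int.
rewrite /ups horner_map; congr FracField.tofrac.
have -> : map_poly intr P = map_poly polyC (map_poly intr P) :> {poly {poly rat}}.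
  by rewrite -map_poly_comp; apply: eq_map_poly => a /=; rewrite rmorph_int.
exact: comp_polyXr.
Qed.

(** Specialization is kept as a relation, so that no representing Laurent polynomial has to be
    chosen; it is functional by [spec_unique]. *)
Definition spec (a : Qv) (b : k) :=
  exists P m, a = laurent ups P m /\ b = laurent eps P m.

(** Integer polynomials embed into the fractions, so equal fractions come from an identity over the
    integers, and this survives evaluation at eps in any characteristic. *)
Lemma spec_unique a b b' : spec a b -> spec a b' -> b = b'.
Proof.
move=> [P [m [-> ->]]] [P' [m' [e ->]]].
have {}e : P * 'X^m' = P' * 'X^m.
  apply: (map_inj_poly (intr_inj (R := rat))) => //.
  apply: tofrac_inj.
  rewrite !rmorphM /= !map_polyXn !rmorphXn /= -/ups.
  move: e; rewrite !laurent_ups => /eqP.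
  by rewrite eqr_div ?expf_neq0 ?ups_neq0 // => /eqP.
apply/eqP; rewrite /laurent eqr_div ?expf_neq0 //; apply/eqP.
have := congr1 (fun Q => (map_poly intr Q).[eps]) e.
by rewrite !rmorphM /= !map_polyXn !hornerM !hornerXn.
Qed.

Lemma spec_poly (P : {poly int}) m (a : Qv) (b : k) :
  a * ups ^+ m = (map_poly intr P).[ups] -> b * eps ^+ m = (map_poly intr P).[eps] ->
  spec a b.
Proof.
move=> ea eb; exists P, m; rewrite /laurent -ea -eb.
by rewrite !mulfK // expf_neq0 // ups_neq0.
Qed.

Lemma spec_int (z : int) : spec z%:~R z%:~R.
Proof.
by apply: (@spec_poly z%:P 0); rewrite map_polyC hornerC expr0 mulr1.
Qed.

Lemma spec_nat (m : nat) : spec m%:R m%:R.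
Proof. by have := spec_int m. Qed.

Lemma spec_var : spec ups eps.
Proof. by apply: (@spec_poly 'X 0); rewrite map_polyX hornerX expr0 mulr1. Qed.

Lemma spec_inv : spec ups^-1 eps^-1.
Proof.
apply: (@spec_poly 1 1); rewrite rmorph1 hornerC expr1 mulVf //.
exact: ups_neq0.
Qed.

Lemma specD a b a' b' : spec a b -> spec a' b' -> spec (a + a') (b + b').
Proof.
move=> [P [m [-> ->]]] [P' [m' [-> ->]]].
apply: (@spec_poly (P * 'X^m' + P' * 'X^m) (m + m')); rewrite /laurent exprD;
  rewrite rmorphD /= !rmorphM /= !map_polyXn hornerD !hornerM !hornerXn;
  by apply: addf_cross; rewrite expf_neq0 ?ups_neq0.
Qed.

Lemma specM a b a' b' : spec a b -> spec a' b' -> spec (a * a') (b * b').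
Proof.
move=> [P [m [-> ->]]] [P' [m' [-> ->]]].
apply: (@spec_poly (P * P') (m + m')); rewrite /laurent exprD;
  rewrite !rmorphM /= !hornerM;
  by apply: mulf_cross; rewrite expf_neq0 ?ups_neq0.
Qed.

Lemma specX a b m : spec a b -> spec (a ^+ m) (b ^+ m).
Proof.
move=> ab; elim: m => [|m IH]; first by rewrite !expr0; apply: (spec_nat 1).
by rewrite !exprS; apply: specM.
Qed.

Lemma specz (z : int) : spec (ups ^ z) (eps ^ z).
Proof.
case: z => m; first exact/specX/spec_var.
by rewrite !NegzE -!exprnN -!exprVn; apply/specX/spec_inv.
Qed.

Section Entries.
Variables (n : nat) (al be : 'I_n).
Implicit Types s : seq ('I_n * 'I_n).

Lemma spec_Dl i : spec (Dl ups al be i) (Dl eps al be i).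
Proof.
rewrite /Dl; do 3?case: ifP => _; first [exact: spec_inv|exact/specX/spec_var|exact: (spec_nat 1)].
Qed.

Lemma spec_Dr i : spec (Dr ups al be i) (Dr eps al be i).
Proof.
rewrite /Dr; do 3?case: ifP => _; first [exact: spec_inv|exact/specX/spec_var|exact: (spec_nat 1)].
Qed.

Lemma spec_t12 s : spec (t12 al be (Dl ups al be) (Dr ups al be) s)
  (t12 al be (Dl eps al be) (Dr eps al be) s).
Proof.
have t22s s' : spec (t22 (Dr ups al be) s') (t22 (Dr eps al be) s').
  rewrite /t22; elim: s' => [|p s' IH]; rewrite ?big_nil ?big_cons.
    exact: (spec_nat 1).
  by apply: specM => //; apply: specM; [apply: spec_nat|apply: spec_Dr].
elim: s => [|p s IH] /=; first exact: (spec_nat 0).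
apply: specD; apply: specM => //; last exact: spec_nat.
by apply: specM; [apply: spec_nat|apply: spec_Dl].
Qed.

End Entries.

Variables (n r : nat).
Hypothesis n_gt1 : (1 < n)%N.
Variables (zeta : U n -> 'M[Qv]_(words n r)) (zetaP : is_zeta zeta).
Variables (zetak : Uk n eps -> 'M[k]_(words n r)) (zetakP : is_zeta_base_change zeta zetak).
Local Notation word := (r.-tuple 'I_n).
Local Notation N := (words n r).

Definition rootmx (al be : 'I_n) : 'M[k]_N := \matrix_(a, b)
  t12 al be (Dl eps al be) (Dr eps al be) (zip (enum_val a : word) (enum_val b : word)).
Definition cartmx (j : 'I_n) (z : int) : 'M[k]_N :=
  \matrix_(a, b) ((a == b)%:R * eps ^ ((count_mem j (enum_val a : word))%:Z * z)).

(** The entries of E, F and K are given by the same formulas over the fractions and over k, so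
    relating them by [spec] determines the base-changed map. *)
Lemma zetak_spec (x : {x : U n | UZ x}) (A : 'M[k]_N) :
  (forall a b, spec (zeta (sval x) a b) (A a b)) -> zetak (base_change eps x) = A.
Proof.
case: zetakP => _ _ zk sA; apply/matrixP => a b.
exact: spec_unique (zk x a b) (sA a b).
Qed.

Lemma zetak_E (x : {x : U n | UZ x}) h : sval x = E h ->
  zetak (base_change eps x) = rootmx (lo h) (hi h).
Proof.
case: zetaP => _ _ zE _ _ ex; apply: zetak_spec => a b.
by rewrite ex zE Ajr_shape ?ups_neq0 ?eqxx // mxE; apply: spec_t12.
Qed.

Lemma zetak_F (x : {x : U n | UZ x}) h : sval x = F h ->
  zetak (base_change eps x) = rootmx (hi h) (lo h).
Proof.
case: zetaP => _ _ _ zF _ ex; apply: zetak_spec => a b.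
by rewrite ex zF Ajr_shape ?ups_neq0 ?eqxx ?orbT // mxE; apply: spec_t12.
Qed.

Lemma zeta_Kint (j : 'I_n) (z : int) a b : zeta (Kint j z) a b =
  (a == b)%:R * ups ^ ((count_mem j (enum_val a : word))%:Z * z).
Proof.
case: zetaP => _ _ _ _ zK.
(* The map zeta is given on full products of powers of the K's only, so a single power is completed
   by exponents 0. *)
have -> : Kint j z = \prod_i Kint i (if i == j then z else 0).
  rewrite (eq_bigr (fun i => if i == j then Kint j z else 1)); last first.
    by move=> i _; case: eqP => [->|].
  by rewrite -big_mkcond big_pred1_eq.
rewrite zK Ajr_diag // ?ups_neq0 //; congr (_ * _ ^ _).
rewrite (bigD1 j) //= eqxx big1 ?addr0 // => i /negPf ->.
by rewrite mulr0.
Qed.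

Lemma zetak_K (x : {x : U n | UZ x}) j z : sval x = Kint j z ->
  zetak (base_change eps x) = cartmx j z.
Proof.
move=> ex; apply: zetak_spec => a b; rewrite ex zeta_Kint mxE.
by apply: specM; [apply: spec_nat|apply: specz].
Qed.

Lemma qfact1 : qfact 1 = 1.
Proof.
rewrite /qfact big_nat1 /qint !expr1 divff // subr_eq0.
apply/eqP => e; have : ups * ups = 1 by rewrite {2}e mulfV // ups_neq0.
move/eqP; rewrite -expr2 /ups -rmorphXn -[1](rmorph1 (@FracField.tofrac {poly rat})).
rewrite (inj_eq tofrac_inj) => /eqP/(congr1 (fun p : {poly rat} => size p)).
by rewrite size_polyXn size_poly1.
Qed.

Lemma UZ_E h : UZ (E h : U n).
Proof.
apply: gen_subalg_gen; constructor 1; exists h, 1%N.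
by rewrite qfact1 invr1 scale1r expr1.
Qed.

Lemma UZ_F h : UZ (F h : U n).
Proof.
apply: gen_subalg_gen; constructor 2; exists h, 1%N.
by rewrite qfact1 invr1 scale1r expr1.
Qed.

Lemma UZ_K j : UZ (K j : U n).
Proof. by apply: gen_subalg_gen; constructor 3; exists j; left. Qed.
Lemma UZ_K' j : UZ (K' j : U n).
Proof. by apply: gen_subalg_gen; constructor 3; exists j; right. Qed.

Local Notation S := (little_qSchur zetak).

Lemma little_one : S 1.
Proof. by case: zetakP => [[z1 _ _ _] _ _]; exists 1; [apply: gen_subalg_one|]. Qed.

Lemma little_scale c s : S s -> S (c *: s).
Proof.
case: zetakP => [[_ _ _ zZ] _ _] [y Sy <-].
by exists (c *: y); [apply: gen_subalg_scale|rewrite zZ].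
Qed.

Lemma little_add s t : S s -> S t -> S (s + t).
Proof.
case: zetakP => [[_ zD _ _] _ _] [y Sy <-] [y' Sy' <-].
by exists (y + y'); [apply: gen_subalg_add|rewrite zD].
Qed.

Lemma little_mul s t : S s -> S t -> S (s * t).
Proof.
case: zetakP => [[_ _ zM _] _ _] [y Sy <-] [y' Sy' <-].
by exists (y * y'); [apply: gen_subalg_mul|rewrite zM].
Qed.

Lemma little_E h : S (rootmx (lo h) (hi h)).
Proof.
exists (base_change eps (exist _ _ (UZ_E h))); last exact: zetak_E.
by apply: gen_subalg_gen; eexists; [reflexivity|left; exists h; left].
Qed.

Lemma little_F h : S (rootmx (hi h) (lo h)).
Proof.
exists (base_change eps (exist _ _ (UZ_F h))); last exact: zetak_F.
by apply: gen_subalg_gen; eexists; [reflexivity|left; exists h; right].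
Qed.

Lemma little_K j : S (cartmx j 1).
Proof.
exists (base_change eps (exist _ _ (UZ_K j))); last by apply: zetak_K; rewrite /= expr1.
by apply: gen_subalg_gen; eexists; [reflexivity|right; exists j; left].
Qed.

Lemma little_K' j : S (cartmx j (-1)).
Proof.
exists (base_change eps (exist _ _ (UZ_K' j))); last by apply: zetak_K; rewrite /= expr1.
by apply: gen_subalg_gen; eexists; [reflexivity|right; exists j; right].
Qed.

Lemma little_ind (Q : 'M[k]_N -> Prop) : Q 1%:M -> (forall s t, Q s -> Q t -> Q (s + t)) ->
  (forall s t, Q s -> Q t -> Q (s *m t)) -> (forall c s, Q s -> Q (c *: s)) ->
  (forall h, Q (rootmx (lo h) (hi h))) -> (forall h, Q (rootmx (hi h) (lo h))) ->
  (forall j, Q (cartmx j 1)) -> (forall j, Q (cartmx j (-1))) ->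
  forall s, S s -> Q s.
Proof.
case: zetakP => [[z1 zD zM zZ] _ _] Q1 QD QM QZ QE QF QK QK' _ [y Sy <-].
elim: Sy => {y} [_ [x -> [[h [ex|ex]]|[j [ex|ex]]]]||x y _ Qx _ Qy|x y _ Qx _ Qy|c x _ _ Qx].
- by rewrite (zetak_E ex).
- by rewrite (zetak_F ex).
- by rewrite (@zetak_K x j 1) //= expr1.
- by rewrite (@zetak_K x j (-1)) //= expr1.
- by rewrite z1.
- by rewrite zD; apply: QD.
- by rewrite zM; apply: QM.
- by rewrite zZ; apply: QZ.
Qed.

End Specialization.

(** * The action of the generators on words *)

Section Action.
Variables (k : fieldType) (v : k) (n r : nat).
Hypothesis v_neq0 : v != 0.
Local Notation M := (seq nat -> k^o).
Local Notation N := (words n r).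
Implicit Types (w : seq 'I_n) (Y : seq 'I_n -> k) (x : M).
Local Notation nw := (map (@nat_of_ord n)).

Section Twist.
Variables al be : 'I_n.

(** Action of a row of the matrix [t12] on coefficients, arranged by recursion on the word so that
    it can be compared with [hop] (see [sum_t12]). *)
Fixpoint rootop Y w : k := if w is i :: w' then
    Dl v al be i * rootop (fun u => Y (i :: u)) w'
    + (i == al)%:R * ((\prod_(j <- w') Dr v al be j) * Y (be :: w'))
  else 0.

Lemma rootop_ext Y Y' w : Y =1 Y' -> rootop Y w = rootop Y' w.
Proof.
by elim: w Y Y' => //= i w IH Y Y' e; rewrite e (IH _ (fun u => Y' (i :: u))).
Qed.

Lemma big_tcons m (F : m.+1.-tuple 'I_n -> k) :
  \sum_t F t = \sum_i \sum_(t : m.-tuple 'I_n) F [tuple of i :: t].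
Proof.
rewrite pair_big /= (reindex (fun p : 'I_n * m.-tuple 'I_n => [tuple of p.1 :: p.2])) //=.
exists (fun t : m.+1.-tuple 'I_n => (thead t, [tuple of behead t])) => [[i t] _|t _] /=.
  by congr pair; apply/val_inj.
by rewrite -tuple_eta.
Qed.

Lemma t22_zip (m : nat) (t t' : m.-tuple 'I_n) : t22 (Dr v al be) (zip t t') =
  (t == t')%:R * \prod_(j <- t) Dr v al be j.
Proof.
rewrite -val_eqE /t22; case: t t' => [t /= /eqP <-] [t' /= /eqP].
elim: t t' => [|i t IH] [|i' t'] //=; first by rewrite !big_nil mulr1.
case=> /IH; rewrite !big_cons eqseq_cons => ->.
by case: eqP => _ /=; rewrite ?mul1r ?mul0r // mulrCA.
Qed.

Lemma sum_t12 m (t : m.-tuple 'I_n) Y :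
  \sum_(t' : m.-tuple 'I_n) t12 al be (Dl v al be) (Dr v al be) (zip t t') * Y t' =
  rootop Y t.
Proof.
elim: m t Y => [|m IH] t Y.
  by rewrite (tuple0 t) /= big1 // => t' _; rewrite (tuple0 t') /= mul0r.
rewrite (tuple_eta t) /= big_tcons /=.
set i := thead t; set u := behead t.
have -> : u = [tuple of behead t] :> seq _ by [].
rewrite -IH.
transitivity (\sum_(i' < n) ((i == i')%:R * (Dl v al be i *
    \sum_(t' : m.-tuple 'I_n) t12 al be (Dl v al be) (Dr v al be) (zip u t') * Y (i' :: t'))
  + ((i, i') == (al, be))%:R * ((\prod_(j <- u) Dr v al be j) * Y (i' :: u)))).
  apply: eq_bigr => i' _; rewrite !mulr_sumr.
  rewrite (eq_bigr (fun t' : m.-tuple 'I_n =>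
    (i == i')%:R * (Dl v al be i * (t12 al be (Dl v al be) (Dr v al be) (zip u t') * Y (i' :: t')))
    + ((i, i') == (al, be))%:R *
      (([tuple of behead t] == t')%:R * (\prod_(j <- u) Dr v al be j) * Y (i' :: t')))).
    rewrite big_split /=; congr (_ + _); rewrite -mulr_sumr; congr (_ * _).
    rewrite (bigD1 [tuple of behead t]) //= eqxx mul1r [X in _ + X]big1 ?addr0 // => t' /negPf tt.
    by rewrite eq_sym tt !mul0r.
  move=> t' _; rewrite -(t22_zip [tuple of behead t] t') /= -/u.
  by ring.
rewrite big_split /=; congr (_ + _).
  rewrite (bigD1 i) //= eqxx mul1r [X in _ + X]big1 ?addr0 // => i' /negPf ii.
  by rewrite eq_sym ii mul0r.
rewrite (bigD1 be) //= xpair_eqE eqxx andbT [X in _ + X]big1 ?addr0 // => i' /negPf ib.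
by rewrite xpair_eqE ib andbF mul0r.
Qed.

Lemma rootopZ (c : k) Y w : rootop (fun u => c * Y u) w = c * rootop Y w.
Proof.
elim: w Y => [|j w IH] Y /=; first by rewrite mulr0.
by rewrite (IH (fun u => Y (j :: u))); ring.
Qed.

(** Source and target words differ in one letter, so conjugating by a multiplicative weight costs
    only the ratio of its values at be and al. *)
Lemma rootop_weight (g : 'I_n -> k) Y w : (forall i, g i != 0) ->
  rootop (fun u => (\prod_(j <- u) g j) * Y u) w =
  g be / g al * (\prod_(j <- w) g j) * rootop Y w.
Proof.
move=> g0; elim: w Y => [|i w IH] Y /=; first by rewrite !mulr0.
rewrite (rootop_ext (Y' := fun u => (\prod_(j <- u) g j) * (g i * Y (i :: u)))); last first.
  by move=> u; rewrite big_cons; ring.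
rewrite IH !big_cons.
rewrite rootopZ.
have [->|_] := eqVneq i al; last by rewrite !mul0r !addr0; ring.
by have := g0 al; move: (g al) => ga ga0; field.
Qed.

Lemma prod_exp (P : pred nat) (c : k) w :
  \prod_(j <- w) (if P j then c else 1) = c ^+ count P (nw w).
Proof.
elim: w => [|j w IH]; first by rewrite big_nil.
by rewrite big_cons IH /=; case: ifP => _; rewrite ?mul1r // exprS.
Qed.

(** Conjugation by [invwt] converts the two-sided weights Dl, Dr into the one-sided twist of [hop],
    up to a diagonal factor rho. The first condition compares the letters before the moved position,
    the second those after it. *)
Lemma rootop_invwt (h : nat) (rho : seq nat -> k) w x :
  (forall (i : 'I_n) u, Dl v al be i * v ^+ (i < al) / v ^+ (i < be) * rho u =
     rho (nat_of_ord i :: u) * twist v h i) ->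
  (forall w, \prod_(j <- w) Dr v al be j * v ^- count_gt be (nw w) =
     v ^- count_gt al (nw w) * rho (nat_of_ord al :: nw w)) ->
  rootop (fun u => invwt v (nw u) * x (nw u)) w =
  invwt v (nw w) * (rho (nw w) * hop v h al be x (nw w)).
Proof.
move=> ra rb; elim: w x => [|i w IH] x /=; first by rewrite !mulr0.
(* The front letter i multiplies [invwt] by v^-1 for each larger letter of u, a multiplicative
   weight to which [rootop_weight] applies. *)
rewrite (rootop_ext (Y' := fun u => (\prod_(j <- u) (if (i < j)%N then v^-1 else 1))
   * (invwt v (nw u) * slice x i (nw u)))); last first.
  by move=> u /=; rewrite (prod_exp (ltn i)) exprVn mulrA.
rewrite rootop_weight => [|j]; last by case: ifP => _; rewrite ?invr_eq0 ?oner_eq0.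
rewrite (prod_exp (ltn i)) exprVn IH -/(count_gt i (nw w)).
have -> : (if (i < be)%N then v^-1 else 1) / (if (i < al)%N then v^-1 else 1) =
    v ^+ (i < al)%N / v ^+ (i < be)%N.
  case: (i < al)%N; case: (i < be)%N;
    by rewrite ?expr0 ?expr1 ?invr1 ?invrK ?mulr1 ?mul1r ?mulfV ?mulVf.
set A := invwt v (nw w); set B := hop _ _ _ _ _ _; set G := v ^- count_gt i _.
set C := (i == al)%:R * _.
transitivity ((Dl v al be i * v ^+ (i < al)%N / v ^+ (i < be)%N * rho (nw w)) * (G * A * B) + C).
  by ring.
rewrite ra [in RHS]mulrDr mulrDr addrC; congr (_ + _); last by ring.
rewrite /C -val_eqE /=; have [ia|_] := eqVneq (i : nat) al; last by rewrite !(mul0r, mulr0).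
rewrite mul1r /G ia.
transitivity ((\prod_(j <- w) Dr v al be j * v ^- count_gt be (nw w)) *
    (A * x (nat_of_ord be :: nw w))).
  by ring.
by rewrite rb; ring.
Qed.

End Twist.

Lemma rootop_E (al be : 'I_n) w x : be = al.+1 :> nat ->
  rootop al be (fun u => invwt v (nw u) * x (nw u)) w =
  invwt v (nw w) * (v *: kop' v al (kop v be (eop v al x))) (nw w).
Proof.
move=> ba.
have neq : (be == al) = false by rewrite -val_eqE /= ba; lia.
rewrite (rootop_invwt (h := al) (rho := fun w : seq nat =>
    v * (v ^- count_mem (al : nat) w * v ^+ count_mem (be : nat) w))).
- by rewrite sclME /kop' /kop /eop -ba; ring.
- move=> i u; rewrite /Dl /twist -!val_eqE /= ba ltnSn.
  have := expf_neq0 (count_mem (al : nat) u) v_neq0.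
  have [->|ia] := eqVneq (i : nat) al.
    rewrite neqS ltnn ltnSn expr0 expr1 /= add1n add0n exprS.
    by move: (v ^+ _) (v ^+ _) => a b b0; field; rewrite ?oner_eq0 ?v_neq0 ?b0.
  have [->|ib] := eqVneq (i : nat) al.+1.
    rewrite ltnn (_ : (al.+1 < al)%N = false) ?expr0 /= ?add1n ?add0n ?exprS ?expr0; last lia.
    by move: (v ^+ _) (v ^+ _) => a b b0; field; rewrite ?oner_eq0 ?v_neq0 ?b0.
  rewrite (_ : (i < al.+1)%N = (i < al)%N) ?add0n; last lia.
  have := expf_neq0 (i < al)%N v_neq0.
  by move: (v ^+ _) (v ^+ _) (v ^+ _) => a b c a0 b0; field; rewrite ?oner_eq0 ?v_neq0 ?a0 ?b0.
- move=> u; have -> : \prod_(j <- u) Dr v al be j = v ^- count_mem (al : nat) (nw u).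
    rewrite -exprVn -(prod_exp (pred1 (al : nat))); apply: eq_bigr => j _.
    rewrite /Dr ba ltnSn -val_eqE /=; case: ifP => // _.
    by case: ifP.
  have eg : count_gt al (nw u) = (count_mem (be : nat) (nw u) + count_gt be (nw u))%N.
    by rewrite /count_gt ba; elim: (nw u) => //= i z ->; lia.
  rewrite /= eqxx (_ : ((al : nat) == be) = false) ?add1n ?add0n ?eg ?exprD ?exprS; last first.
    by rewrite ba; lia.
  have := expf_neq0 (count_mem (al : nat) (nw u)) v_neq0.
  have := expf_neq0 (count_mem (be : nat) (nw u)) v_neq0.
  have := expf_neq0 (count_gt be (nw u)) v_neq0.
  move: (v ^+ _) (v ^+ _) (v ^+ _) => a b c a0 b0 c0.
  by field; rewrite ?oner_eq0 ?v_neq0 ?a0 ?b0 ?c0.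
Qed.

Lemma rootop_F (al be : 'I_n) w x : al = be.+1 :> nat ->
  rootop al be (fun u => invwt v (nw u) * x (nw u)) w =
  invwt v (nw w) * (v ^+ 2 *: kop v be (kop v be (kop' v al (kop' v al (fop v be x))))) (nw w).
Proof.
move=> ab.
rewrite (rootop_invwt (h := be) (rho := fun w : seq nat =>
   v ^+ 2 * (v ^+ count_mem (be : nat) w * v ^+ count_mem (be : nat) w
   * (v ^- count_mem (al : nat) w * v ^- count_mem (al : nat) w)))).
- by rewrite sclME /kop' /kop /fop -ab; ring.
- move=> i u; rewrite /Dl /twist -!val_eqE /= ab (_ : (be.+1 < be)%N = false); last lia.
  have := expf_neq0 (count_mem be.+1 u) v_neq0.
  have [->|ia] := eqVneq (i : nat) be.+1.
    rewrite !neqE ltnn (_ : (be.+1 < be)%N = false) ?expr0 /= ?add1n ?add0n ?exprS ?expr0; last lia.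
    by move: (v ^+ _) (v ^+ _) => a b b0; field; rewrite ?oner_eq0 ?v_neq0 ?b0.
  have [->|ib] := eqVneq (i : nat) be.
    rewrite ltnn ltnSn expr0 expr1 /= add1n add0n !exprS ?expr0.
    by move: (v ^+ _) (v ^+ _) => a b b0; field; rewrite ?oner_eq0 ?v_neq0 ?b0.
  rewrite (_ : (i < be.+1)%N = (i < be)%N) ?add0n; last lia.
  have := expf_neq0 (i < be)%N v_neq0.
  by move: (v ^+ _) (v ^+ _) (v ^+ _) => a b c a0 b0; field; rewrite ?oner_eq0 ?v_neq0 ?a0 ?b0.
- move=> u; have -> : \prod_(j <- u) Dr v al be j = v ^- count_mem (al : nat) (nw u)
       * (v ^+ count_mem (be : nat) (nw u) * v ^+ count_mem (be : nat) (nw u)).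
    rewrite -exprVn -(prod_exp (pred1 (al : nat))) -!(prod_exp (pred1 (be : nat))) -!big_split.
    apply: eq_bigr => j _; rewrite /Dr ab (_ : (be.+1 < be)%N = false); last lia.
    rewrite -!val_eqE /= ab; have [->|_] := eqVneq (j : nat) be.+1.
      by rewrite !neqE !mulr1.
    by case: eqP => _; rewrite ?mulr1 // mul1r expr2.
  have eg : count_gt be (nw u) = (count_mem (al : nat) (nw u) + count_gt al (nw u))%N.
    by rewrite /count_gt ab; elim: (nw u) => //= i z ->; lia.
  rewrite /= eqxx (_ : ((al : nat) == be) = false) ?add1n ?add0n ?eg ?exprD ?exprS; last first.
    by rewrite ab; lia.
  have := expf_neq0 (count_mem (al : nat) (nw u)) v_neq0.
  have := expf_neq0 (count_gt al (nw u)) v_neq0.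
  move: (v ^+ _) (v ^+ _) (v ^+ _) => a b c a0 b0.
  by field; rewrite ?oner_eq0 ?v_neq0 ?a0 ?b0.
Qed.

End Action.

(** * From matrices to operators on words *)

Section MatrixAction.
Variables (k : fieldType) (v : k) (n r : nat).
Hypothesis v_neq0 : v != 0.
Local Notation M := (seq nat -> k^o).
Implicit Types (x : M).
Local Notation nw := (map (@nat_of_ord n)).
Local Notation vec := (@vec k v n r).

Lemma rootmx_vec (al be : 'I_n) x a : (rootmx v r al be *m vec x) a 0 =
  rootop v al be (fun u => invwt v (nw u) * x (nw u)) (enum_val a).
Proof.
rewrite -(sum_t12 v al be (enum_val a) (fun u => invwt v (nw u) * x (nw u))) mxE.
rewrite (reindex_onto enum_rank enum_val) => [|b _]; last exact: enum_valK.
apply: eq_big => [t|t _]; first by rewrite enum_rankK eqxx.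
by rewrite !mxE /letters enum_rankK.
Qed.

Lemma rootmx_E (al be : 'I_n) x : be = al.+1 :> nat ->
  rootmx v r al be *m vec x = vec (v *: kop' v al (kop v be (eop v al x))).
Proof.
by move=> ba; apply/matrixP => a j; rewrite ord1 rootmx_vec rootop_E // mxE.
Qed.

Lemma rootmx_F (al be : 'I_n) x : al = be.+1 :> nat ->
  rootmx v r al be *m vec x =
  vec (v ^+ 2 *: kop v be (kop v be (kop' v al (kop' v al (fop v be x))))).
Proof.
by move=> ab; apply/matrixP => a j; rewrite ord1 rootmx_vec rootop_F // mxE.
Qed.

Lemma cartmx_vec (j : 'I_n) z x : cartmx v r j z *m vec x =
  vec (fun w => v ^ ((count_mem (j : nat) w)%:Z * z) * x w).
Proof.
apply/matrixP => a b; rewrite ord1 !mxE (bigD1 a) //= big1 => [|c /negPf ca].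
  rewrite !mxE eqxx mul1r addr0 /letters count_map mulrCA.
  by rewrite (eq_count (a2 := preim (@nat_of_ord n) (pred1 (j : nat)))).
by rewrite !mxE eq_sym ca !mul0r.
Qed.

Lemma cartmx_K (j : 'I_n) x : cartmx v r j 1 *m vec x = vec (kop v j x).
Proof. by rewrite cartmx_vec; congr vec; apply/funext => w; rewrite mulr1. Qed.

Lemma cartmx_K' (j : 'I_n) x : cartmx v r j (-1) *m vec x = vec (kop' v j x).
Proof.
by rewrite cartmx_vec; congr vec; apply/funext => w; rewrite mulrN1 -exprnN.
Qed.

Section Algebra.
Variable S : set 'M[k]_(words n r).
Hypotheses (SZ : forall c s, S s -> S (c *: s)) (SM : forall s t, S s -> S t -> S (s * t)).
Hypotheses (SE : forall h, S (rootmx v r (lo h) (hi h)))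
  (SF : forall h, S (rootmx v r (hi h) (lo h)))
  (SK : forall j : 'I_n, S (cartmx v r j 1)) (SK' : forall j : 'I_n, S (cartmx v r j (-1))).

Lemma eop_little h : (h.+1 < n)%N -> exists2 s, S s & forall x, s *m vec x = vec (eop v h x).
Proof.
move=> hn; have hn' : (h < n.-1)%N by lia.
pose g := Ordinal hn'.
(* This undoes the diagonal factor v K_lo^-1 K_hi of [rootmx_E], which is possible within S because
   S contains the K's and their inverses. *)
exists (v^-1 *: (cartmx v r (hi g) (-1) * (cartmx v r (lo g) 1 * rootmx v r (lo g) (hi g)))).
  by apply: SZ; apply: (SM (SK' _)); apply: (SM (SK _)).
move=> x; rewrite -scalemxAl -!mulmxA rootmx_E // cartmx_K cartmx_K' -vecZ; congr vec.
apply/funext => w; rewrite sclME /kop /kop' sclME /=.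
have := expf_neq0 (count_mem h w) v_neq0; have := expf_neq0 (count_mem h.+1 w) v_neq0.
move: (v ^+ _) (v ^+ _) (eop v h x w) => a b c a0 b0.
by field; rewrite ?v_neq0 ?a0 ?b0.
Qed.

Lemma fop_little h : (h.+1 < n)%N -> exists2 s, S s & forall x, s *m vec x = vec (fop v h x).
Proof.
move=> hn; have hn' : (h < n.-1)%N by lia.
pose g := Ordinal hn'.
exists (v ^- 2 *: (cartmx v r (hi g) 1 * (cartmx v r (hi g) 1 *
  (cartmx v r (lo g) (-1) * (cartmx v r (lo g) (-1) * rootmx v r (hi g) (lo g)))))).
  by apply: SZ; apply: (SM (SK _)); apply: (SM (SK _)); apply: (SM (SK' _)); apply: (SM (SK' _)).
move=> x; rewrite -scalemxAl -!mulmxA rootmx_F // !(cartmx_K, cartmx_K') -vecZ; congr vec.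
apply/funext => w; rewrite sclME /kop /kop' sclME /=.
have := expf_neq0 (count_mem h w) v_neq0; have := expf_neq0 (count_mem h.+1 w) v_neq0.
have := expf_neq0 2 v_neq0; move: (v ^+ _) (v ^+ _) (v ^+ _) (fop v h x w) => a b c d a0 b0 c0.
by field; rewrite a0 b0 c0.
Qed.

End Algebra.
End MatrixAction.

Section LittleAction.
Variables (k : fieldType) (eps : k) (eps_neq0 : eps != 0) (n r : nat) (n_gt1 : (1 < n)%N).
Variables (zeta : U n -> 'M[Qv]_(words n r)) (zetaP : is_zeta zeta).
Variables (zetak : Uk n eps -> 'M[k]_(words n r)) (zetakP : is_zeta_base_change zeta zetak).
Local Notation M := (seq nat -> k^o).
Local Notation S := (little_qSchur zetak).
Local Notation vec := (@vec k eps n r).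

Lemma little_stable (P : M -> Prop) :
  P 0 -> (forall (c : k) x y, P x -> P y -> P (c *: x + y)) ->
  (forall h x, (h.+1 < n)%N -> P x -> P (eop eps h x)) ->
  (forall h x, (h.+1 < n)%N -> P x -> P (fop eps h x)) ->
  (forall j x, (j < n)%N -> P x -> P (kop eps j x)) ->
  (forall j x, (j < n)%N -> P x -> P (kop' eps j x)) ->
  forall s x, S s -> P x -> exists2 y, P y & s *m vec x = vec y.
Proof.
move=> P0 Pl PE PF PK PK' s x Ss; move: s Ss x.
have PZ c x : P x -> P (c *: x) by move=> Px; rewrite -[_ *: _]addr0; apply: Pl.
apply: (little_ind eps_neq0 n_gt1 zetaP zetakP) =>
  [x Px|s t Qs Qt x Px|s t Qs Qt x Px|c s Qs x Px|h x Px|h x Px|j x Px|j x Px].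
- by exists x; rewrite ?mul1mx.
- have [y Py ys] := Qs x Px; have [z Pz zt] := Qt x Px.
  by exists (y + z); [rewrite -[y]scale1r; apply: Pl|rewrite mulmxDl ys zt vecD].
- have [z Pz zt] := Qt x Px; have [y Py ys] := Qs z Pz.
  by exists y; rewrite // -mulmxA zt.
- by have [y Py ys] := Qs x Px; exists (c *: y); [apply: PZ|rewrite -scalemxAl ys vecZ].
- eexists; last exact: rootmx_E.
  have hn : ((lo h).+1 < n)%N := ltn_ord (hi h).
  by apply: PZ; apply: (PK' (lo h)) => //; apply: (PK (hi h)) => //; apply: PE.
- eexists; last exact: rootmx_F.
  have hn : ((lo h).+1 < n)%N := ltn_ord (hi h).
  by apply: PZ; do 2 apply: (PK (lo h)) => //; do 2 apply: (PK' (hi h)) => //; apply: PF.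
- by exists (kop eps j x); [apply: PK|apply: cartmx_K].
- by exists (kop' eps j x); [apply: PK'|apply: cartmx_K'].
Qed.

End LittleAction.

(** * Conclusion *)

(** The order of eps^2 is l: for odd l' the factor 2 is prime to l', for even l' it cancels against
    l' = 2 (l'/2). *)
Lemma sqr_prim_root (k : fieldType) (l' : nat) (eps : k) (m : nat) :
  l'.-primitive_root eps ->
  ((eps ^+ 2) ^+ m == 1) = ((if odd l' then l' else l'./2) %| m)%N.
Proof.
move=> pe; rewrite -exprM -(prim_order_dvd pe).
have [ol|el] := boolP (odd l'); first by rewrite Gauss_dvdr // coprimen2.
rewrite -{1}(odd_double_half l') (negPf el) add0n -muln2 mulnC.
by rewrite dvdn_pmul2l.
Qed.

Theorem theorem7p2 (k : fieldType) (p : nat) (pchark : p \in [pchar k])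
    (l' : nat) (l'_ge3 : (3 <= l')%N)
    (eps : k) (eps_prim : l'.-primitive_root eps)
    (n r : nat) (n_ge2 : (2 <= n)%N)
    (zeta : U n -> 'M[Qv]_(words n r)) (zetaP : is_zeta zeta)
    (zetak : Uk n eps -> 'M[k]_(words n r))
    (zetakP : is_zeta_base_change zeta zetak) :
  let l := (if odd l' then l' else l'./2)%N in
  semisimple (little_qSchur zetak) <->
  ((r < l)%N \/ [/\ l = 2%N, n = 2%N, (3 <= r)%N & odd r]).
Proof.
move=> l.
have dvdl m : ((eps ^+ 2) ^+ m == 1) = (l %| m)%N by apply: sqr_prim_root.
(* From l' >= 3 follows l >= 2, so eps^2 is not 1 and the denominators of [phi] and [qnum] are
   invertible. *)
have l_gt1 : (1 < l)%N by rewrite /l; have := odd_double_half l'; case: odd => /=; lia.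
have e0 : eps != 0.
  apply/eqP => e0; have := prim_expr_order eps_prim.
  by rewrite e0 expr0n gtn_eqF ?(ltnW l'_ge3) //; [move/eqP; rewrite eq_sym oner_eq0|lia].
have e2 : eps ^+ 2 != 1 by rewrite -[eps ^+ 2]expr1 dvdl dvdn1; lia.
have S1 := little_one zetakP; have SZ := little_scale zetakP.
have SD := little_add zetakP; have SM := little_mul zetakP.
have SE := little_E e0 zetaP zetakP; have SF := little_F e0 zetaP zetakP.
have SK := little_K e0 n_ge2 zetaP zetakP; have SK' := little_K' e0 n_ge2 zetaP zetakP.
have SEop := eop_little e0 SZ SM SE SK SK'.
have SFop := fop_little e0 SZ SM SF SK SK'.
have Sind := little_stable e0 n_ge2 zetaP zetakP.
split=> [ss|[rl|[l2 n2 _ ro]]].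
- have [rl|lr] := ltnP r l; [by left|right].
  have qil a : (qnum eps a == 0) = (l %| a)%N by rewrite qnum_eq0.
  have [nex|ex] := pselect [/\ l = 2%N, n = 2%N & odd r].
    by case: nex => l2 n2 ro; split=> //; move: lr ro; rewrite l2; case: (r) => [|[|[]]].
  by case: (not_semisimple_big e0 e2 n_ge2 S1 SZ SD SM SFop Sind l_gt1 qil lr ex ss).
- apply: (semisimple_small e0 e2 S1 SZ SD SM SEop SFop Sind _ rl) => b /andP[b0 bl].
  rewrite /phi mulf_neq0 ?invr_eq0 ?subr_eq0 //.
    rewrite eq_sym -PoszM -exprnN invr_eq1 mulnC exprM dvdl.
    by apply/negP => /(dvdn_leq b0); lia.
  by rewrite eq_sym invr_eq1.
(* For l = 2 the element eps^2 is a square root of 1 other than 1. *)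
- have eN1 : eps ^+ 2 = -1.
    have : (eps ^+ 2) ^+ 2 == 1 by rewrite dvdl l2.
    by rewrite sqrf_eq1 (negPf e2) => /eqP.
  exact: (semisimple_odd e0 e2 n_ge2 S1 SZ SD SM SEop SFop Sind n2 ro eN1).
Qed.
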